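(* Let $\ell,T,C_{\mathcal Q}>0$ and let $\rho,r,\mu\in L^\infty(0,\ell)$ satisfy $0<\rho_0\le\rho(x)\le\rho_1$, $0<r_0\le r(x)\le r_1$, $\mu(x)\ge 0$ for $x\in(0,\ell)$, with constants $\rho_0,\rho_1,r_0,r_1$. Suppose $w_\ell,\theta_\ell\in L^2(0,T)$. Then the minimization problem $$\mathcal J(q_* )=\inf_{q\in\mathcal Q(0,T)}\mathcal J(q),\qquad \mathcal J(q)=\frac12\int_0^T[u(\ell,t;q)-w_\ell(t)]^2dt+\frac12\int_0^T[u_x(\ell,t;q)-\theta_\ell(t)]^2dt,$$ has at least one solution $q_*\in\mathcal Q(0,T)$. (Hence the inverse problem of determining $q=(M,g)$ from $u(\ell,\cdot)=w_\ell$, $u_x(\ell,\cdot)=\theta_\ell$ has a quasi-solution, a quasi-solution being by definition a solution of this minimization problem.)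
   Context: Admissible inputs: $\mathcal Q(0,T)=\{q=(M,g): M,g\in H^2(0,T),\ \|M\|_{H^2(0,T)}\le C_{\mathcal Q},\ \|g\|_{H^2(0,T)}\le C_{\mathcal Q}\}$. Forward problem: for $q=(M,g)$, $u(x,t;q)$ denotes the unique weak solution of $$\begin{cases}\rho u_{tt}+\mu u_t+(ru_{xx})_{xx}=0, & (x,t)\in(0,\ell)\times(0,T),\\ u(x,0)=u_t(x,0)=0,& x\in(0,\ell),\\ u(0,t)=u_x(0,t)=0,\ (ru_{xx})|_{x=\ell}=M(t),\ -(ru_{xx})_x|_{x=\ell}=g(t),& t\in[0,T].\end{cases}$$ Let $\mathcal V^2(0,\ell)=\{v\in H^2(0,\ell): v(0)=v'(0)=0\}$. A weak solution is $u\in L^2(0,T;\mathcal V^2(0,\ell))$ with $u_t\in L^2(0,T;L^2(0,\ell))$, $u_{tt}\in L^2(0,T;H^{-2}(0,\ell))$ ($H^{-2}$ being the dual of $\mathcal V^2$ with pivot space $L^2$ weighted by $\rho$), satisfying the zero initial conditions and, for every $v\in\mathcal V^2(0,\ell)$, $$\frac{d}{dt}\int_0^\ell\rho u_tv\,dx+\int_0^\ell\mu u_tv\,dx+\int_0^\ell ru_{xx}v''\,dx=M(t)v'(\ell)+g(t)v(\ell)$$ in the sense of distributions on $(0,T)$. *)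

(* Defs.v *)
From HB Require Import structures.
From mathcomp Require Import all_boot all_order all_algebra.
From mathcomp Require Import all_classical all_reals all_analysis.

Set Implicit Arguments.
Unset Strict Implicit.
Unset Printing Implicit Defensive.

Import Order.TTheory GRing.Theory Num.Theory.
Import numFieldNormedType.Exports.

Local Open Scope classical_set_scope.
Local Open Scope ring_scope.

(* Classes of functions modulo a.e. equality are represented by Borel functions
   R -> R, of which only the restriction to the interval at hand matters. *)

Section Intervals.
Context {R : realType}.
Local Notation leb := (@lebesgue_measure R).
Implicit Types (a b : R) (f g : R -> R).

Definition L2 a b : set (R -> R) :=
  [set f | (f \_ `]a, b[) \in Lfun leb 2%:E].

Definition L2norm a b f : R :=
  fine ('N[leb]_2%:E [EFin \o (f \_ `]a, b[)])%E.

Definition Linfty a b : set (R -> R) :=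
  [set f | (f \_ `]a, b[) \in Lfun leb +oo%E].

Definition test_function a b : set (R -> R) :=
  [set phi | (forall n x, derivable (derive1n n phi) x 1) /\
     exists c d, [/\ a < c, d < b & forall x, x \notin `[c, d] -> phi x = 0]].

(* [g] is the [k]-th derivative of [f] in the sense of distributions
   on (a, b) *)
Definition weak_deriv a b k f g : Prop :=
  forall phi, test_function a b phi ->
    \int[leb]_(x in `]a, b[) (f x * derive1n k phi x) =
    (-1) ^+ k * \int[leb]_(x in `]a, b[) (g x * phi x).

Definition H2 a b : set (R -> R) :=
  [set f | [/\ L2 a b f,
     exists g, L2 a b g /\ weak_deriv a b 1 f g &
     exists g, L2 a b g /\ weak_deriv a b 2 f g]].

(* the square integrable weak derivative, determined a.e. when it exists *)
Definition wD a b k f : R -> R :=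
  xget (cst 0) [set g | L2 a b g /\ weak_deriv a b k f g].

Definition H2norm a b f : R :=
  Num.sqrt (L2norm a b f ^+ 2 + L2norm a b (wD a b 1 f) ^+ 2
            + L2norm a b (wD a b 2 f) ^+ 2).

(* Point values of an element of H^1(a, b), up to and including the end points,
   are those of its continuous representative on [a, b]. *)
Definition crep a b f : R -> R :=
  xget f [set g | {within `[a, b], continuous g} /\
                  {ae leb, forall x, x \in `]a, b[ -> g x = f x}].

End Intervals.

(* Functions of time valued in a normed space.  The space is a subset [X] of an
   ambient group [V] with a function [N : V -> R] that is a norm on [X] once
   elements at distance 0 are identified. *)
Section VectorValued.
Context {R : realType} {V : zmodType}.
Local Notation leb := (@lebesgue_measure R).
Variables (T : R) (X : set V) (N : V -> R).

Definition simple_fun (s : R -> V) : Prop :=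
  [/\ finite_set (range s), forall v, measurable (s @^-1` [set v])
    & forall t, X (s t)].

(* Strong (Bochner) measurability on (0, T), for an everywhere defined Borel
   representative: no null set of times is discarded. *)
Definition strongly_measurable (u : R -> V) : Prop :=
  exists2 s : nat -> R -> V, forall n, simple_fun (s n) &
    forall t, t \in `]0, T[ -> (fun n => N (s n t - u t)) @ \oo --> (0 : R).

Definition bochner_L2 : set (R -> V) :=
  [set u | [/\ forall t, t \in `]0, T[ -> X (u t), strongly_measurable u
             & L2 0 T (fun t => N (u t))]].

(* The representative of [u] in C([0, T]; X) vanishes at time 0. *)
Definition initially0 (u : R -> V) : Prop :=
  exists w : R -> V,
    [/\ forall t, t \in `[0, T] -> X (w t),
        forall s, s \in `[0, T] ->
          N (w t - w s) @[t --> within `[0, T]%classic (nbhs s)] --> (0 : R),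
        {ae leb, forall t, t \in `]0, T[ -> N (w t - u t) = 0}
      & N (w 0) = 0].

End VectorValued.

Section Beam.
Context {R : realType}.
Local Notation leb := (@lebesgue_measure R).
Variables (ell T : R) (rho mu r : R -> R).

Definition V2 : set (R -> R) :=
  [set v | [/\ H2 0 ell v, crep 0 ell v 0 = 0
             & crep 0 ell (wD 0 ell 1 v) 0 = 0]].

(* H^{-2}, the dual of V2, and its norm; only values on V2 matter *)
Definition Hm2 : set ((R -> R) -> R) :=
  [set F | (forall c v w, V2 v -> V2 w ->
              F (fun x => c * v x + w x) = c * F v + F w) /\
           exists C, forall v, V2 v -> `|F v| <= C * H2norm 0 ell v].

Definition Hm2norm (F : (R -> R) -> R) : R :=
  sup [set `|F v| | v in [set v | V2 v /\ H2norm 0 ell v <= 1]].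

(* the inclusion of the pivot space L^2 with weight rho into H^{-2} *)
Definition pivot (w : R -> R) : (R -> R) -> R :=
  fun v => \int[leb]_(x in `]0, ell[) (rho x * w x * v x).

(* u_t and u_tt are derivatives in the sense of vector distributions on (0, T),
   the former in L^2(0, ell) and the latter in H^{-2}, as expressed by duality
   against L^2(0, ell) and V2. *)
Definition weak_solution (M g : R -> R) (u : R -> R -> R) : Prop :=
  exists (ut : R -> R -> R) (utt : R -> (R -> R) -> R),
  [/\ [/\ bochner_L2 T V2 (H2norm 0 ell) u,
          bochner_L2 T (L2 0 ell) (L2norm 0 ell) ut
        & bochner_L2 T Hm2 Hm2norm utt],
      (forall w, L2 0 ell w ->
        weak_deriv 0 T 1 (fun t => \int[leb]_(x in `]0, ell[) (u t x * w x))
                         (fun t => \int[leb]_(x in `]0, ell[) (ut t x * w x))) /\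
      (forall v, V2 v ->
        weak_deriv 0 T 1 (fun t => pivot (ut t) v) (fun t => utt t v)),
      initially0 T (L2 0 ell) (L2norm 0 ell) u /\
      initially0 T Hm2 Hm2norm (fun t => pivot (ut t))
    & forall v, V2 v ->
        weak_deriv 0 T 1
          (fun t => \int[leb]_(x in `]0, ell[) (rho x * ut t x * v x))
          (fun t => M t * crep 0 ell (wD 0 ell 1 v) ell + g t * crep 0 ell v ell
             - \int[leb]_(x in `]0, ell[) (mu x * ut t x * v x)
             - \int[leb]_(x in `]0, ell[)
                 (r x * wD 0 ell 2 (u t) x * wD 0 ell 2 v x))].

(* u( . ; q), as a function of t and then x *)
Definition solution (q : (R -> R) * (R -> R)) : R -> R -> R :=
  xget (fun _ _ => 0) [set u | weak_solution q.1 q.2 u].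

Variables (CQ : R) (w_ell theta_ell : R -> R).

Definition admissible : set ((R -> R) * (R -> R)) :=
  [set q | [/\ H2 0 T q.1, H2 0 T q.2, H2norm 0 T q.1 <= CQ
             & H2norm 0 T q.2 <= CQ]].

Definition misfit (u : R -> R -> R) : \bar R :=
  ((2^-1)%:E * (\int[leb]_(t in `]0%R, T[)
      ((crep 0 ell (u t) ell - w_ell t) ^+ 2)%:E) +
   (2^-1)%:E * (\int[leb]_(t in `]0%R, T[)
      ((crep 0 ell (wD 0 ell 1 (u t)) ell - theta_ell t) ^+ 2)%:E))%E.

(* By well-posedness the value +oo is not taken on admissible inputs; it rules
   out that an input without a solution could count as a minimizer. *)
Definition J (q : (R -> R) * (R -> R)) : \bar R :=
  if `[< weak_solution q.1 q.2 (solution q) >] then misfit (solution q)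
  else +oo%E.

Definition quasi_solution (q : (R -> R) * (R -> R)) : Prop :=
  admissible q /\ J q = ereal_inf [set J p | p in admissible].

End Beam.

(* Main.v *)
Require Import Defs.
From HB Require Import structures.
From mathcomp Require Import all_boot all_order all_algebra.
From mathcomp Require Import all_classical all_reals all_analysis.
From mathcomp Require Import measurable_realfun ess_sup_inf.
From mathcomp Require Import ring lra.

Set Implicit Arguments.
Unset Strict Implicit.
Unset Printing Implicit Defensive.

Import Order.TTheory GRing.Theory Num.Theory.
Import numFieldNormedType.Exports.

Local Open Scope classical_set_scope.
Local Open Scope ring_scope.

(* No existence theorem for the beam equation and no weak compactness are used.  If no
   admissible input has a solution, J is identically +oo.  Otherwise the inputs whose
   misfit is within 1/n of the infimum form nested convex sets; elements of nearly
   minimal H^2 norm of these sets form a Cauchy sequence by the parallelogram law, hence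
   converge strongly in H^2.

   It remains to see that solutions depend continuously on the input.  An energy
   estimate, derived by mollifying backward in time and returning to almost every time
   through Lebesgue points, bounds u_xx and u_t in L^2(0, ell) at almost every time by
   the H^2 norms of M and g.  Applied to differences, it gives uniqueness and makes the
   solutions along the sequence Cauchy, uniformly in time; their limit solves the
   problem for the limit input and its boundary traces are the limits of theirs. *)

(** * Integrals on bounded intervals *)

(** Weak compactness would yield inputs converging only weakly; strong convergence makes a Lipschitz
    estimate for solutions enough. The equation is linear in the input, so the misfit is convex
    along midpoints of admissible inputs that have a solution.

    Two obstacles shape the energy estimate. The natural test function u_t has no second space
    derivative; after mollification in time it has one, since (u_xx)_t becomes square integrable in
    space. The kernel sees only the past, so the equation is used inside (0, T) even for times up to
    T, and the zero initial data allow extension by 0 to negative times. The loads M and g, however,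
    need not vanish at time 0: their extensions jump there, and the derivative of a mollified load
    contains a spike of height of order 1/h, whose mass stays bounded.

    An element v of V^2 is handled through z = v'' in L^2: v is the double primitive of z, and slope
    and deflection at the free end are bounded functionals of z. The terms of the equation thus
    become bounded functionals on L^2(0, ell), which is what vector integrals have to commute
    with. *)

Section DiscriminantInequality.
Context {R : realType}.

(** The quadratic is evaluated at its minimiser [- b / c]. For [c = 0] it is affine, and [b != 0]
    would let it reach -1. *)
Lemma discriminant_le (a b c : R) : 0 <= c ->
  (forall t, 0 <= a + 2 * t * b + t ^+ 2 * c) -> b ^+ 2 <= a * c.
Proof.
move=> c0 h; have [c_eq0|cN0] := eqVneq c 0.
  have a0 : 0 <= a by have := h 0; rewrite expr0n /= !(mulr0, mul0r) !addr0.
  have [->|bN0] := eqVneq b 0; first by rewrite expr0n /= c_eq0 mulr0.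
  have := h (- (a + 1) / (2 * b)).
  have -> : a + 2 * (- (a + 1) / (2 * b)) * b + (- (a + 1) / (2 * b)) ^+ 2 * c = -1.
    by rewrite c_eq0 mulr0; field.
  by rewrite ler0N1.
have c_gt0 : 0 < c by rewrite lt_def cN0.
have := h (- b / c).
have -> : a + 2 * (- b / c) * b + (- b / c) ^+ 2 * c = (a * c - b ^+ 2) / c by field.
by rewrite pmulr_lge0 ?invr_gt0// subr_ge0.
Qed.

End DiscriminantInequality.

Section AlmostEverywhere.
Context {R : realType}.
Implicit Types P Q : R -> Prop.

Definition ae P := {ae @lebesgue_measure R, forall x, P x}.

Lemma ae_null P : ae P <-> exists2 N : set R,
  measurable N /\ lebesgue_measure N = 0%E & forall x, ~ N x -> P x.
Proof.
split=> [[N [mN N0 PN]]|[N [mN N0] NP]].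
  by exists N => // x; apply: contra_notP => nP; exact: PN.
by exists N; split => // x /=; apply: contra_notP => /NP.
Qed.

#[local] Instance ae_filter : Filter (almost_everywhere (@lebesgue_measure R)).
Proof. exact: (ae_filter_ringOfSetsType (lebesgue_measure : {measure set _ -> \bar R})). Qed.

Lemma aeW P : (forall x, P x) -> ae P.
Proof. by move=> h; exact: (@nearW _ _ P ae_filter h). Qed.

Lemma aeS P Q : (forall x, P x -> Q x) -> ae P -> ae Q.
Proof. by move=> PQ; exact: (@filterS _ _ ae_filter P Q PQ). Qed.

Lemma aeS2 P1 P2 Q : (forall x, P1 x -> P2 x -> Q x) -> ae P1 -> ae P2 -> ae Q.
Proof. by move=> PQ; exact: filterS2 PQ. Qed.

Lemma aeS3 P1 P2 P3 Q : (forall x, P1 x -> P2 x -> P3 x -> Q x) ->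
  ae P1 -> ae P2 -> ae P3 -> ae Q.
Proof. by move=> PQ; exact: filterS3 PQ. Qed.

Lemma ae_forall (P : nat -> R -> Prop) :
  (forall n, ae (P n)) -> ae (fun x => forall n, P n x).
Proof.
move=> h.
have : (lebesgue_measure : {measure set _ -> \bar R}).-negligible
    (\bigcup_n ~` [set x | P n x]).
  by apply: negligible_bigcup => n; exact: h.
apply: negligibleS => x /= /existsNP[n nP]; by exists n.
Qed.

End AlmostEverywhere.

Section IntegrableOnInterval.
Context {R : realType}.
Local Notation leb := (@lebesgue_measure R).
Variables (a b : R).
Implicit Types (f g h : R -> R).

Definition L1 : set (R -> R) := [set f : R -> R | leb.-integrable `]a, b[ (EFin \o f)].

Lemma L1_measurable f : L1 f -> measurable_fun `]a, b[ f.
Proof. by move=> /measurable_int /measurable_EFinP. Qed.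

Lemma L1_le f g : measurable_fun `]a, b[ f -> L1 g ->
  (forall x, x \in `]a, b[ -> `|f x| <= g x) -> L1 f.
Proof.
move=> mf Lg fg; apply: le_integrable Lg => //; first exact/measurable_EFinP.
by move=> x xab /=; rewrite lee_fin (le_trans (fg x xab))// ler_norm.
Qed.

Lemma L1_ext f g : {in `]a, b[, f =1 g} -> L1 f -> L1 g.
Proof.
move=> fg; apply: eq_integrable => //= x; rewrite inE => xab /=.
by rewrite fg.
Qed.

Lemma L1D f g : L1 f -> L1 g -> L1 (fun x => f x + g x).
Proof. by move=> Lf Lg; exact: (integrableD _ Lf Lg). Qed.

Lemma L1B f g : L1 f -> L1 g -> L1 (fun x => f x - g x).
Proof. by move=> Lf Lg; exact: (integrableB _ Lf Lg). Qed.

Lemma L1Z c f : L1 f -> L1 (fun x => c * f x).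
Proof. by move=> Lf; exact: (integrableZl _ c Lf). Qed.

Lemma L1N f : L1 f -> L1 (fun x => - f x).
Proof. by move=> Lf; exact: (integrableN Lf). Qed.

Lemma L1_norm f : L1 f -> L1 (fun x => `|f x|).
Proof. exact: integrable_norm. Qed.

Lemma L1_cst c : L1 (cst c).
Proof.
apply: measurable_bounded_integrable => //.
  by rewrite [X in (X < _)%E]lebesgue_measure_itv/=; case: ifP => _; rewrite ltry.
by exists `|c|; split; [exact: num_real|move=> M cM x _; exact: ltW].
Qed.

Lemma L1_bounded f c : measurable_fun `]a, b[ f ->
  (forall x, x \in `]a, b[ -> `|f x| <= c) -> L1 f.
Proof. by move=> mf fc; apply: (L1_le mf (L1_cst c)). Qed.

Lemma L1_mulb f g c : measurable_fun `]a, b[ f ->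
  (forall x, x \in `]a, b[ -> `|f x| <= c) -> L1 g ->
  L1 (fun x => f x * g x).
Proof.
move=> mf fc Lg; apply: (@L1_le _ (fun x => c * `|g x|)).
- by apply: measurable_funM => //; exact: L1_measurable.
- exact/L1Z/L1_norm.
- by move=> x xab; rewrite normrM ler_wpM2r// fc.
Qed.

Lemma eq_int_ae f g : measurable_fun `]a, b[ f -> measurable_fun `]a, b[ g ->
  ae (fun x => x \in `]a, b[ -> f x = g x) ->
  \int[leb]_(x in `]a, b[) f x = \int[leb]_(x in `]a, b[) g x.
Proof.
move=> mf mg fg; congr fine; apply: ae_eq_integral => //.
- exact/measurable_EFinP.
- exact/measurable_EFinP.
- by apply: aeS fg => x fg /fg ->.
Qed.

Lemma int_ge0_ae f : measurable_fun `]a, b[ f ->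
  ae (fun x => x \in `]a, b[ -> 0 <= f x) ->
  0 <= \int[leb]_(x in `]a, b[) f x.
Proof.
move=> mf f0; rewrite (@eq_int_ae _ (fun x => `|f x|))//.
- exact: Rintegral_ge0.
- exact: measurableT_comp.
- by apply: aeS f0 => x f0 /f0 /ger0_norm ->.
Qed.

Lemma le_int_ae f g : L1 f -> L1 g ->
  ae (fun x => x \in `]a, b[ -> f x <= g x) ->
  \int[leb]_(x in `]a, b[) f x <= \int[leb]_(x in `]a, b[) g x.
Proof.
move=> Lf Lg fg; rewrite -subr_ge0 -RintegralB//; apply: int_ge0_ae.
  by apply: measurable_funB; exact: L1_measurable.
by apply: aeS fg => x fg /fg; rewrite subr_ge0.
Qed.

Lemma L1_le_ae f g : measurable_fun `]a, b[ f -> L1 g ->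
  ae (fun x => x \in `]a, b[ -> `|f x| <= g x) -> L1 f.
Proof.
move=> mf Lg fg; apply/integrableP; split; first exact/measurable_EFinP.
have /integrableP[mg] := L1_norm Lg; apply: le_lt_trans.
apply: ae_ge0_le_integral => //.
- exact/measurableT_comp/measurable_EFinP.
- exact/measurableT_comp.
- apply: aeS fg => x fg /fg /= {}fg.
  by rewrite lee_fin (le_trans fg)// normr_id ler_norm.
Qed.

Lemma norm_int_le f g : L1 f -> L1 g ->
  ae (fun x => x \in `]a, b[ -> `|f x| <= g x) ->
  `|\int[leb]_(x in `]a, b[) f x| <= \int[leb]_(x in `]a, b[) g x.
Proof.
move=> Lf Lg fg; apply: le_trans (le_normr_Rintegral _ Lf) _ => //.
by apply: le_int_ae => //; exact: L1_norm.
Qed.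

Lemma int_cst c : a <= b -> \int[leb]_(x in `]a, b[) c = c * (b - a).
Proof.
move=> ab; rewrite Rintegral_cst//= lebesgue_measure_itv/=.
by move: ab; rewrite le_eqVlt lte_fin => /predU1P[->|->//]; rewrite ltxx subrr.
Qed.

Lemma int_dominated_cvg (fn : nat -> R -> R) f g :
  (forall n, measurable_fun `]a, b[ (fn n)) -> measurable_fun `]a, b[ f ->
  L1 g ->
  ae (fun x => x \in `]a, b[ -> fn n x @[n --> \oo] --> f x) ->
  ae (fun x => x \in `]a, b[ -> forall n, `|fn n x| <= g x) ->
  \int[leb]_(x in `]a, b[) fn n x @[n --> \oo] --> \int[leb]_(x in `]a, b[) f x.
Proof.
move=> mfn mf Lg cvgf domf.
have Lf : L1 f.
  apply: (L1_le_ae mf Lg); apply: aeS2 cvgf domf => x h1 h2 xab.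
  have /cvg_norm h := h1 xab; rewrite -(cvg_lim _ h)//.
  apply: limr_le; first by apply/cvg_ex; eexists; exact: h.
  by apply: nearW => n; exact: h2.
have [_ _ h] : [/\ leb.-integrable `]a, b[ (EFin \o f),
    [sequence \int[leb]_(x in `]a, b[) `|(fn n x)%:E - (f x)%:E|]_n @ \oo --> 0 &
    [sequence \int[leb]_(x in `]a, b[) ((fn n x)%:E)]_n @ \oo -->
      \int[leb]_(x in `]a, b[) ((f x)%:E)]%E.
  apply: (@dominated_convergence _ _ _ leb `]a, b[%classic _
    (fun n => EFin \o fn n) (EFin \o f) (EFin \o g)) => //.
  - by move=> n; apply/measurable_EFinP; exact: mfn.
  - by apply/measurable_EFinP.
  - by apply: aeS cvgf => x h /h c; apply/cvg_EFin => //; apply: nearW.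
  - by apply: aeS domf => x h n /h /(_ n) /=; rewrite lee_fin.
suff : (\int[leb]_(x in `]a, b[) (fn n x)%:E)%E @[n --> \oo] -->
    (fine (\int[leb]_(x in `]a, b[) (f x)%:E)%E)%:E by move/fine_cvgP => [].
rewrite fineK; first exact: h.
by apply: integrable_fin_num.
Qed.

End IntegrableOnInterval.

Section SequencesOfIntegrals.
Context {R : realType}.
Local Notation leb := (@lebesgue_measure R).
Variables (a b : R).
Implicit Types (f g h : R -> R).

(** Integrability of the limit is part of the conclusion, as completeness of L^2 needs it for a
    limit known only almost everywhere. The lower limit agrees with [|f|] almost everywhere, since
    nonnegative [fn n x] force [0 <= f x]. *)
Lemma int_fatou (fn : nat -> R -> R) f c :
  (forall n, L1 a b (fn n)) -> measurable_fun `]a, b[ f ->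
  (forall n x, x \in `]a, b[ -> 0 <= fn n x) ->
  (forall n, \int[leb]_(x in `]a, b[) fn n x <= c) ->
  ae (fun x => x \in `]a, b[ -> fn n x @[n --> \oo] --> f x) ->
  L1 a b f /\ \int[leb]_(x in `]a, b[) f x <= c.
Proof.
move=> Lfn mf fn0 fnc cvgf.
have mfn n : measurable_fun `]a, b[ (fun x => (fn n x)%:E).
  by apply/measurable_EFinP; exact: L1_measurable (Lfn n).
have einf_ge0 (x : R) : x \in `]a, b[ -> (0 <= limn_einf (fun n => (fn n x)%:E))%E.
  move=> xab; rewrite limn_einf_lim; apply: lime_ge; first exact: is_cvg_einfs.
  apply: nearW => n; apply: le_ereal_inf_tmp => _ [m _ <-].
  by rewrite lee_fin fn0.
have fE : (\int[leb]_(x in `]a, b[) `|(f x)%:E| =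
    \int[leb]_(x in `]a, b[) limn_einf (fun n => (fn n x)%:E))%E.
  apply: ge0_ae_eq_integral => //.
  - exact/measurableT_comp/measurable_EFinP.
  - rewrite /limn_einf; apply: measurableT_comp => //.
    apply: (@measurable_fun_limn_esup _ _ _ _ (fun n x => (- (fn n x)%:E)%E)) => n.
    by apply: measurableT_comp => //; exact: mfn.
  - apply: aeS cvgf => x h /= xab; have {}h := h xab.
    have f0 : 0 <= f x.
      rewrite -(cvg_lim _ h)//; apply: limr_ge; first by apply/cvg_ex; exists (f x).
      by apply: nearW => n; exact: fn0.
    rewrite ger0_norm//.
    have /cvg_limn_einf_sup [->//] : (fn n x)%:E @[n --> \oo] --> (f x)%:E.
    by apply/fine_cvgP; split => //; apply: nearW.
have fc : (\int[leb]_(x in `]a, b[) `|(f x)%:E| <= c%:E)%E.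
  rewrite fE; apply: le_trans (fatou _ _ _ _) _ => //.
  rewrite limn_einf_lim; apply: lime_le; first exact: is_cvg_einfs.
  apply: nearW => n; apply: ereal_inf_le.
  exists (\int[leb]_(x in `]a, b[) (fn n x)%:E)%E; first by exists n => /=.
  have := fnc n; rewrite -lee_fin /Rintegral fineK//.
  by apply: integrable_fin_num => //; exact: Lfn.
have Lf : L1 a b f.
  apply/integrableP; split; first exact/measurable_EFinP.
  exact: le_lt_trans fc (ltry _).
split => //.
apply: (@le_trans _ _ (\int[leb]_(x in `]a, b[) `|f x|)).
  apply: le_int_ae => //; first exact: L1_norm.
  by apply: aeW => x _; exact: ler_norm.
rewrite -lee_fin; apply: le_trans fc.
rewrite /Rintegral fineK//.
apply: integrable_fin_num => //; exact: (L1_norm Lf).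
Qed.

(** The integrals of [|h n|] sum to at most [2 * c], so the series of absolute values has finite
    integral by monotone convergence and is finite almost everywhere. *)
Lemma ae_series_cvg (h : nat -> R -> R) c :
  (forall n, L1 a b (h n)) ->
  (forall n, \int[leb]_(x in `]a, b[) `|h n x| <= c * 2^-1 ^+ n) ->
  ae (fun x => x \in `]a, b[ -> cvgn [series h n x]_n).
Proof.
move=> Lh hc.
have c0 : 0 <= c.
  by have := hc 0%N; rewrite expr0 mulr1; apply: le_trans; exact: Rintegral_ge0.
have mh n : measurable_fun `]a, b[ (fun x => (`|h n x|)%:E).
  by apply/measurable_EFinP; exact: L1_measurable (L1_norm (Lh n)).
have : leb.-integrable `]a, b[ (fun x => \sum_(n <oo) (`|h n x|)%:E)%E.
  apply/integrableP; split.
    apply: (@ge0_emeasurable_sum _ _ _ _ (fun n x => (`|h n x|)%:E) xpredT) => //.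
  under eq_integral => x _ do rewrite gee0_abs ?nneseries_ge0//.
  rewrite integral_nneseries//.
  apply: (@le_lt_trans _ _ (2 * c)%:E); last by rewrite ltry.
  apply: lime_le; first by apply: is_cvg_nneseries => n _ _; exact: integral_ge0.
  apply: nearW => n.
  have : (\sum_(0 <= k < n) \int[leb]_(x in `]a, b[) (`|h k x|)%:E
      <= \sum_(0 <= k < n) (c * 2^-1 ^+ k)%:E)%E.
    apply: lee_sum => k _; have := hc k; rewrite -lee_fin /Rintegral fineK//.
    apply: integrable_fin_num => //; exact: (L1_norm (Lh k)).
  move/le_trans; apply; rewrite sumEFin lee_fin.
  have -> : \sum_(0 <= k < n) c * 2^-1 ^+ k = c * (2 - 2 * 2^-1 ^+ n).
    elim: n => [|n IH]; first by rewrite big_nil expr0 mulr1 subrr mulr0.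
    by rewrite big_nat_recr//= IH exprS; field.
  rewrite mulrBr mulrC lerBlDr lerDl mulr_ge0// mulr_ge0// exprn_ge0//.
move=> /integrable_ae h'; have {}h' := h' (measurable_itv _).
apply: aeS h' => x h' xab; have {}h' := h' xab.
apply: normed_cvg; apply: nondecreasing_is_cvgn.
  by apply/nondecreasing_seqP => n; rewrite /normed_series_of /series/= big_nat_recr//= lerDl.
exists (fine (\sum_(n <oo) (`|h n x|)%:E)%E) => _ [n _ <-].
rewrite -lee_fin fineK//.
rewrite /normed_series_of /series/= -sumEFin.
apply: nneseries_lim_ge => k _ _.
by rewrite lee_fin.
Qed.

End SequencesOfIntegrals.

Section SquareIntegrable.
Context {R : realType}.
Local Notation leb := (@lebesgue_measure R).
Variables (a b : R).
Implicit Types (f g h : R -> R).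

Definition ip f g := \int[leb]_(x in `]a, b[) (f x * g x).

Lemma L2P f : L2 a b f <-> measurable_fun `]a, b[ f /\ L1 a b (fun x => f x ^+ 2).
Proof.
have sqE : (fun x : R => (((f \_ `]a, b[) x) ^+ 2)%:E) =
    (fun x => (f x ^+ 2)%:E) \_ `]a, b[.
  by apply/funext => x; rewrite /patch; case: ifPn => // _; rewrite expr0n.
split=> [Lf|[mf Lf]].
  have := Lf; rewrite /L2/= inE => /andP[+ _]; rewrite inE/= => mf.
  split; first exact/(measurable_restrictT f (measurable_itv _)).
  have := Lfun2_integrable_sqr Lf.
  rewrite [X in leb.-integrable _ X -> _]sqE => h.
  by apply/integrable_mkcond.
rewrite /L2/= inE; apply/andP; split; rewrite inE/=.
  exact/(measurable_restrictT f (measurable_itv _)).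
rewrite /finite_norm unlock /Lnorm; apply: poweR_lty.
have /integrableP[_] : leb.-integrable setT ((fun x => (f x ^+ 2)%:E) \_ `]a, b[).
  have h := integrable_mkcond (mu := leb) (fun x => (f x ^+ 2)%:E) (measurable_itv `]a, b[).
  exact: h.1 Lf.
apply: le_lt_trans; rewrite -sqE; apply: ge0_le_integral => //.
- by move=> x _; exact: poweR_ge0.
- apply: (measurableT_comp (measurable_poweR _)).
  apply: measurableT_comp => //; apply/measurable_EFinP.
  exact/(measurable_restrictT f (measurable_itv _)).
- apply: measurableT_comp => //; apply/measurable_EFinP; apply: measurable_funX.
  exact/(measurable_restrictT f (measurable_itv _)).
- move=> x _ /=; by rewrite lee_fin powR_mulrn// -normrX.
Qed.

Lemma L2_measurable f : L2 a b f -> measurable_fun `]a, b[ f.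
Proof. by move=> /L2P[]. Qed.

Lemma L2_sqr_L1 f : L2 a b f -> L1 a b (fun x => f x ^+ 2).
Proof. by move=> /L2P[]. Qed.

(** If the integral of the square is infinite, both sides are 0, the value that [fine] gives to
    +oo. *)
Lemma L2norm_ip f : L2norm a b f = Num.sqrt (ip f f).
Proof.
rewrite /L2norm unlock /Lnorm.
have -> : (\int[leb]_x (`|(EFin \o f \_ `]a, b[) x| `^ 2) =
   \int[leb]_(x in `]a, b[) (f x * f x)%:E)%E.
  rewrite [RHS]integral_mkcond; apply: eq_integral => x _.
  rewrite /= /patch; case: ifPn => _.
    by rewrite powR_mulrn// -normrX ger0_norm ?exprn_even_ge0.
  by rewrite powR_mulrn// normr0 expr0n.
rewrite poweR12_sqrt; last by apply: integral_ge0 => x _; rewrite lee_fin -expr2 sqr_ge0.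
rewrite /ip /Rintegral; case: (integral _ _ _) => [r| |] //=; rewrite ?sqrtr0//.
Qed.

Lemma ip_ge0 f : 0 <= ip f f.
Proof. by apply: Rintegral_ge0 => x _; rewrite -expr2 sqr_ge0. Qed.

Lemma L2norm_ge0 f : 0 <= L2norm a b f.
Proof. by rewrite L2norm_ip sqrtr_ge0. Qed.

Lemma L2norm_sqr f : L2norm a b f ^+ 2 = ip f f.
Proof. by rewrite L2norm_ip sqr_sqrtr// ip_ge0. Qed.

Lemma L2_le f g : measurable_fun `]a, b[ f -> L2 a b g ->
  (forall x, x \in `]a, b[ -> `|f x| <= `|g x|) -> L2 a b f.
Proof.
move=> mf /L2P[mg Lg] fg; apply/L2P; split => //.
apply: L1_le Lg _ => [|x xab]; first exact: measurable_funX.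
by rewrite normrX -(real_normK (num_real (g x))) lerXn2r ?nnegrE// fg.
Qed.

Lemma L2_mul f g : L2 a b f -> L2 a b g -> L1 a b (fun x => f x * g x).
Proof.
move=> /L2P[mf Lf] /L2P[mg Lg]; apply: (L1_le _ (L1D Lf Lg)).
  exact: measurable_funM.
move=> x _; rewrite ler_norml; apply/andP; split.
  by have := sqr_ge0 (f x + g x); nra.
by have := sqr_ge0 (f x - g x); nra.
Qed.

Lemma L2D f g : L2 a b f -> L2 a b g -> L2 a b (fun x => f x + g x).
Proof.
move=> Lf Lg; have /L2P[mf Lf2] := Lf; have /L2P[mg Lg2] := Lg.
apply/L2P; split; first exact: measurable_funD.
apply: L1_ext (L1D (L1D Lf2 Lg2) (L1Z 2 (L2_mul Lf Lg))) => x _ /=.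
by ring.
Qed.

Lemma L2Z c f : L2 a b f -> L2 a b (fun x => c * f x).
Proof.
move=> /L2P[mf Lf]; apply/L2P; split; first exact: measurable_funM.
by apply: L1_ext (L1Z (c ^+ 2) Lf) => x _ /=; rewrite exprMn.
Qed.

Lemma L2N f : L2 a b f -> L2 a b (fun x => - f x).
Proof. by move=> /(L2Z (-1)); under eq_fun do rewrite mulN1r. Qed.

Lemma L2B f g : L2 a b f -> L2 a b g -> L2 a b (fun x => f x - g x).
Proof. by move=> Lf /L2N; exact: L2D. Qed.

Lemma L2_cst c : L2 a b (cst c).
Proof. by apply/L2P; split => //; exact: (L1_cst a b (c ^+ 2)). Qed.

Lemma L2_bounded f c : measurable_fun `]a, b[ f ->
  (forall x, x \in `]a, b[ -> `|f x| <= c) -> L2 a b f.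
Proof.
move=> mf fc; apply: (L2_le mf (L2_cst c)) => x xab.
exact: le_trans (fc _ xab) (ler_norm _).
Qed.

Lemma L2_mulb f g c : measurable_fun `]a, b[ f ->
  ae (fun x => x \in `]a, b[ -> `|f x| <= c) -> L2 a b g ->
  L2 a b (fun x => f x * g x).
Proof.
move=> mf fc /L2P[mg Lg]; apply/L2P; split; first exact: measurable_funM.
apply: (L1_le_ae _ (L1Z (c ^+ 2) Lg)).
  by apply: measurable_funX; exact: measurable_funM.
apply: aeS fc => x h xab; rewrite exprMn normrM ler_pM//.
  rewrite normrX lerXn2r ?nnegrE ?h//.
  exact: le_trans (h xab).
by rewrite ger0_norm// sqr_ge0.
Qed.

Lemma L2_L1 f : L2 a b f -> L1 a b f.
Proof.
move=> Lf; have := L2_mul Lf (L2_cst 1).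
by apply: L1_ext => x _; rewrite /= mulr1.
Qed.

Lemma ip_sym f g : ip f g = ip g f.
Proof. by apply: eq_Rintegral => x _; rewrite mulrC. Qed.

Lemma ipDl f g h : L2 a b f -> L2 a b g -> L2 a b h ->
  ip (fun x => f x + g x) h = ip f h + ip g h.
Proof.
move=> Lf Lg Lh; rewrite /ip -RintegralD//; [|exact: L2_mul|exact: L2_mul].
by apply: eq_Rintegral => x _; rewrite mulrDl.
Qed.

Lemma ipBl f g h : L2 a b f -> L2 a b g -> L2 a b h ->
  ip (fun x => f x - g x) h = ip f h - ip g h.
Proof.
move=> Lf Lg Lh; rewrite /ip -RintegralB//; [|exact: L2_mul|exact: L2_mul].
by apply: eq_Rintegral => x _; rewrite mulrBl.
Qed.

Lemma ipZl c f h : L2 a b f -> L2 a b h -> ip (fun x => c * f x) h = c * ip f h.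
Proof.
move=> Lf Lh; rewrite /ip -RintegralZl//; last exact: L2_mul.
by apply: eq_Rintegral => x _; rewrite mulrA.
Qed.

Lemma ip_ae f g f' g' : L2 a b f -> L2 a b g -> L2 a b f' -> L2 a b g' ->
  ae (fun x => x \in `]a, b[ -> f x = f' x) ->
  ae (fun x => x \in `]a, b[ -> g x = g' x) -> ip f g = ip f' g'.
Proof.
move=> Lf Lg Lf' Lg' ff gg; apply: eq_int_ae.
- by apply: measurable_funM; exact: L2_measurable.
- by apply: measurable_funM; exact: L2_measurable.
- by apply: aeS2 ff gg => x h1 h2 xab; rewrite h1// h2.
Qed.

Lemma L2norm_ae f g : L2 a b f -> L2 a b g ->
  ae (fun x => x \in `]a, b[ -> f x = g x) -> L2norm a b f = L2norm a b g.
Proof. by move=> Lf Lg fg; rewrite !L2norm_ip (ip_ae Lf Lf Lg Lg fg fg). Qed.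

Lemma cauchy_schwarz f g : L2 a b f -> L2 a b g ->
  `|ip f g| <= L2norm a b f * L2norm a b g.
Proof.
move=> Lf Lg; rewrite -(@ler_pXn2r _ 2)// ?nnegrE ?mulr_ge0 ?L2norm_ge0//.
rewrite real_normK ?num_real// exprMn !L2norm_sqr.
apply: discriminant_le; first exact: ip_ge0.
move=> t; have := ip_ge0 (fun x => f x + t * g x).
rewrite ipDl ?[ip (fun x => t * g x) _]ipZl; try by [|apply: L2Z|apply: L2D => //; apply: L2Z].
rewrite ![ip _ (fun x => f x + t * g x)]ip_sym !ipDl ?ipZl; try by [|apply: L2Z].
by rewrite [ip g f]ip_sym => h; apply: le_trans h _; rewrite le_eqVlt; apply/orP; left; apply/eqP;
  ring.
Qed.

Lemma L2normD f g : L2 a b f -> L2 a b g ->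
  L2norm a b (fun x => f x + g x) <= L2norm a b f + L2norm a b g.
Proof.
move=> Lf Lg; rewrite -(@ler_pXn2r _ 2)// ?nnegrE ?addr_ge0 ?L2norm_ge0//.
rewrite sqrrD !L2norm_sqr ipDl//; last exact: L2D.
rewrite ![ip _ (fun x => f x + g x)]ip_sym !ipDl// [ip g f]ip_sym.
have := le_trans (ler_norm _) (cauchy_schwarz Lf Lg); lra.
Qed.

Lemma L2normZ c f : L2 a b f -> L2norm a b (fun x => c * f x) = `|c| * L2norm a b f.
Proof.
move=> Lf; rewrite !L2norm_ip ipZl//; last exact: L2Z.
rewrite ip_sym ipZl// mulrA -expr2 sqrtrM ?sqr_ge0// sqrtr_sqr//.
Qed.

Lemma L2normN f : L2 a b f -> L2norm a b (fun x => - f x) = L2norm a b f.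
Proof.
move=> Lf; have := L2normZ (-1) Lf; rewrite normrN1 mul1r => <-.
by congr L2norm; apply/funext => x; rewrite mulN1r.
Qed.

Lemma L2normB f g : L2 a b f -> L2 a b g ->
  L2norm a b (fun x => f x - g x) <= L2norm a b f + L2norm a b g.
Proof. by move=> Lf Lg; rewrite -(L2normN Lg); apply: L2normD => //; exact: L2N. Qed.

Lemma L2norm_cst c : a <= b -> L2norm a b (cst c) = `|c| * Num.sqrt (b - a).
Proof.
move=> ab; rewrite L2norm_ip /ip /= (int_cst _ ab) -expr2 sqrtrM ?sqr_ge0//.
by rewrite sqrtr_sqr.
Qed.

Lemma L2norm0_ae f : L2 a b f -> L2norm a b f = 0 ->
  ae (fun x => x \in `]a, b[ -> f x = 0).
Proof.
move=> Lf /(congr1 (fun x => x ^+ 2)); rewrite L2norm_sqr expr0n/= => f0.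
have Lff := L2_mul Lf Lf.
have h : (\int[leb]_(x in `]a, b[) `|(f x * f x)%:E| = 0)%E.
  transitivity (\int[leb]_(x in `]a, b[) ((f x * f x)%:E))%E.
    by apply: eq_integral => x _; rewrite gee0_abs// lee_fin -expr2 sqr_ge0.
  have <- : (ip f f)%:E = 0%E by rewrite f0.
  by rewrite /ip /Rintegral fineK//; apply: integrable_fin_num.
have := (ae_eq_integral_abs leb (measurable_itv _) (measurable_int _ Lff)).1 h.
apply: aeS => x h' xab.
by have [/eqP] := h' xab; rewrite mulf_eq0 orbb => /eqP.
Qed.

Lemma L2norm_le_bounded f c : a <= b -> 0 <= c -> L2 a b f ->
  ae (fun x => x \in `]a, b[ -> `|f x| <= c) ->
  L2norm a b f <= c * Num.sqrt (b - a).
Proof.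
move=> ab c0 Lf fc; have -> : c * Num.sqrt (b - a) = L2norm a b (cst c).
  by rewrite L2norm_cst// ger0_norm.
rewrite !L2norm_ip ler_wsqrtr//; apply: le_int_ae; [exact: L2_mul| |].
  by apply: L2_mul; exact: L2_cst.
apply: aeS fc => x h xab /=; rewrite -!expr2 -(real_normK (num_real (f x))).
by rewrite lerXn2r ?nnegrE// h.
Qed.

Lemma norm_int_L2 f : a <= b -> L2 a b f ->
  \int[leb]_(x in `]a, b[) `|f x| <= Num.sqrt (b - a) * L2norm a b f.
Proof.
move=> ab Lf.
have Lf' : L2 a b (fun x => `|f x|).
  apply: (L2_le _ Lf) => [|x _]; last by rewrite normr_id.
  by apply: measurableT_comp => //; exact: L2_measurable.
have := cauchy_schwarz (L2_cst 1) Lf'.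
rewrite L2norm_cst// normr1 mul1r.
have -> : L2norm a b (fun x => `|f x|) = L2norm a b f.
  rewrite !L2norm_ip; congr Num.sqrt; apply: eq_Rintegral => x _.
  by rewrite -normrM ger0_norm// -expr2 sqr_ge0.
apply: le_trans; apply: le_trans (ler_norm _).
by rewrite /ip; under [in leRHS]eq_Rintegral do rewrite /= mul1r.
Qed.

End SquareIntegrable.

(** * Completeness up to distance 0 *)

Section Seminorms.
Context {R : realType} {V : zmodType}.
Variables (X : set V) (N : V -> R).

(** [V] is only a group, so homogeneity has no place; the triangle inequality is stated for
    differences, from which symmetry and the usual form follow. Functions equal almost everywhere
    remain distinct elements at distance 0, so [N] is not asked to separate points. *)
Record seminormed : Prop := Seminormed {
  seminormed0 : X 0;
  seminormedB : forall x y, X x -> X y -> X (x - y);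
  seminorm0 : N 0 = 0;
  seminorm_ge0 : forall x, X x -> 0 <= N x;
  seminorm_leB : forall x y, X x -> X y -> N (x - y) <= N x + N y }.

Definition cauchy_seq (f : nat -> V) :=
  forall e, 0 < e -> exists n0, forall m n, (n0 <= m)%N -> (n0 <= n)%N -> N (f m - f n) <= e.

Definition complete_seminorm := forall f : nat -> V, (forall n, X (f n)) ->
  cauchy_seq f -> exists2 x, X x & N (f n - x) @[n --> \oo] --> (0 : R).

Hypothesis XN : seminormed.

Lemma seminormN x : X x -> N (- x) = N x.
Proof.
move=> Xx; have XNx y : X y -> X (- y).
  by move=> Xy; rewrite -[- y]add0r; exact: seminormedB XN _ _ (seminormed0 XN) Xy.
have h y : X y -> N (- y) <= N y.
  move=> Xy; have := seminorm_leB XN (seminormed0 XN) Xy.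
  by rewrite add0r (seminorm0 XN) add0r.
apply/eqP; rewrite eq_le h//= -{1}(opprK x); exact/h/XNx.
Qed.

Lemma seminorm_distC x y : X x -> X y -> N (x - y) = N (y - x).
Proof. by move=> Xx Xy; rewrite -seminormN ?opprB//; exact: seminormedB. Qed.

Lemma seminormedN x : X x -> X (- x).
Proof. by move=> Xx; rewrite -[- x]add0r; exact: seminormedB XN _ _ (seminormed0 XN) Xx. Qed.

Lemma seminormedD x y : X x -> X y -> X (x + y).
Proof. by move=> Xx Xy; rewrite -[y]opprK; apply: seminormedB => //; exact: seminormedN. Qed.

Lemma seminormD x y : X x -> X y -> N (x + y) <= N x + N y.
Proof.
move=> Xx Xy; rewrite -(seminormN Xy) -{1}[y]opprK.
by apply: (seminorm_leB XN) => //; exact: seminormedN.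
Qed.

Lemma seminorm_dist x y z : X x -> X y -> X z -> N (x - z) <= N (x - y) + N (y - z).
Proof.
move=> Xx Xy Xz; have -> : x - z = (x - y) + (y - z) by rewrite addrA subrK.
by apply: seminormD; exact: seminormedB.
Qed.

Lemma ler_seminorm x y : X x -> X y -> `|N x - N y| <= N (x - y).
Proof.
move=> Xx Xy; rewrite ler_norml; apply/andP; split.
  rewrite lerNl opprB lerBlDr seminorm_distC// -{1}(subrK x y).
  by apply: seminormD => //; exact: seminormedB.
rewrite lerBlDr -{1}(subrK y x).
by apply: seminormD => //; exact: seminormedB.
Qed.

Lemma seminorm_cvg_shift (f : nat -> V) x y : (forall n, X (f n)) -> X x -> X y ->
  N (f n - x) @[n --> \oo] --> (0 : R) ->
  N (f n - y) @[n --> \oo] --> N (x - y).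
Proof.
move=> Xf Xx Xy fx; apply/cvgrPdist_le => e e0.
move/cvgr0Pnorm_le : fx => /(_ e e0); apply: filterS => n h.
rewrite distrC; apply: le_trans (ler_seminorm _ _) _; try exact: seminormedB.
by rewrite opprB addrA subrK; apply: le_trans h; exact: ler_norm.
Qed.

(** The limit inherits the explicit rate [a n], by letting the other index tend to infinity. When
    the rate does not depend on time, limits taken at each time separately are uniform. *)
Lemma uniform_limit (f : nat -> V) (a : nat -> R) : complete_seminorm -> (forall n, X (f n)) ->
  a @ \oo --> (0 : R) -> (forall m n, N (f m - f n) <= a m + a n) ->
  exists2 x, X x & forall n, N (f n - x) <= a n.
Proof.
move=> cX Xf a0 fa; have [|x Xx cx] := cX f Xf.
  move=> e e0; have e20 : 0 < e / 2 by rewrite divr_gt0.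
  have /cvgr0Pnorm_le/(_ _ e20)[n0 _ h] := a0; exists n0 => m n n0m n0n.
  apply: le_trans (fa m n) _; rewrite [leRHS]splitr.
  by rewrite lerD ?(le_trans (ler_norm _) (h _ _)).
exists x => // n; rewrite seminorm_distC//.
have c := seminorm_cvg_shift Xf Xx (Xf n) cx.
have c2 : a k + a n @[k --> \oo] --> a n.
  by rewrite -[X in _ --> X]add0r; apply: cvgD => //; exact: cvg_cst.
by apply: (@ler_cvg_to _ _ _ _ _ _ _ _ c c2); apply: nearW => k; exact: fa.
Qed.

End Seminorms.

Section SummableSubsequence.
Context {R : realType}.

Lemma geometric_half_small (e : R) : 0 < e -> exists n, 2^-1 ^+ n <= e.
Proof.
move=> e0; have h : `|2^-1 : R| < 1 by rewrite ger0_norm// invf_lt1// ltr1n.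
have /cvgr0Pnorm_le/(_ e e0)[n _ /(_ n (leqnn n))] := cvg_expr h.
by exists n; apply: le_trans (ler_norm _) _.
Qed.

Lemma cauchy_subseq (d : nat -> nat -> R) :
  (forall e, 0 < e -> exists n0, forall m n, (n0 <= m)%N -> (n0 <= n)%N -> d m n <= e) ->
  exists2 phi : nat -> nat, {homo phi : m n / (m < n)%N} &
    forall k m n, (phi k <= m)%N -> (phi k <= n)%N -> d m n <= 2^-1 ^+ k.
Proof.
move=> h; have h' k : {n0 | forall m n, (n0 <= m)%N -> (n0 <= n)%N -> d m n <= 2^-1 ^+ k}.
  by apply: cid; apply: h; rewrite exprn_gt0// invr_gt0.
pose phi := fix F k := if k is k'.+1 then maxn (F k').+1 (sval (h' k)) else sval (h' 0%N).
exists phi.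
  apply: homo_ltn; first exact: ltn_trans.
  by move=> k /=; rewrite leq_max leqnn.
move=> k m n; have kphi : (sval (h' k) <= phi k)%N by case: k => //= k; rewrite leq_maxr.
by move=> /(leq_trans kphi) h1 /(leq_trans kphi) h2; exact: (svalP (h' k)).
Qed.

End SummableSubsequence.

Section L2Complete.
Context {R : realType}.
Local Notation leb := (@lebesgue_measure R).
Variables (a b : R).
Hypothesis ab : a <= b.

Lemma L2_seminormed : seminormed (L2 a b) (L2norm a b).
Proof.
split.
- exact: (L2_cst a b 0).
- by move=> x y; exact: L2B.
- by have := L2norm_cst 0 ab; rewrite normr0 mul0r.
- by move=> x _; exact: L2norm_ge0.
- by move=> x y; exact: L2normB.
Qed.

(** The Riesz-Fischer theorem. Along a subsequence with geometrically small steps the series of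
    increments converges almost everywhere; Fatou's lemma then bounds the distance to the limit of
    every late term, not only of those in the subsequence. *)
Lemma L2_complete : complete_seminorm (L2 a b) (L2norm a b).
Proof.
move=> f Lf fC; have [phi phi_inc phiP] := cauchy_subseq fC.
pose h k := f (phi k.+1) - f (phi k).
have Lh k : L2 a b (h k) by exact: L2B.
have Lsub m n : L2 a b (fun x => f m x - f n x) by exact: L2B.
have cvgh : ae (fun x => x \in `]a, b[ -> cvgn [series h n x]_n).
  apply: (@ae_series_cvg _ _ _ _ (Num.sqrt (b - a))) => k; first exact: L2_L1.
  apply: le_trans (norm_int_L2 ab (Lh k)) _.
  by rewrite ler_wpM2l ?sqrtr_ge0//; apply: phiP => //; exact/ltnW/phi_inc.
have cvgf : ae (fun x => x \in `]a, b[ -> cvgn (fun k => f (phi k) x)).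
  apply: aeS cvgh => x hx xab; have {}hx := hx xab.
  have -> : (fun k => f (phi k) x) = (fun k => f (phi 0%N) x + [series h n x]_n k).
    apply/funext => k; rewrite /series/=.
    elim: k => [|k IH]; first by rewrite big_nil addr0.
    by rewrite big_nat_recr//= addrA -IH /h addrC subrK.
  by apply: is_cvgD => //; exact: is_cvg_cst.
pose g x := fine (limn_esup (fun k => (f (phi k) x)%:E)).
have mg : measurable_fun `]a, b[ g.
  apply: measurableT_comp => //.
  apply: (@measurable_fun_limn_esup _ _ _ _ (fun k x => (f (phi k) x)%:E)) => k.
  by apply/measurable_EFinP; exact: L2_measurable.
have cvgg : ae (fun x => x \in `]a, b[ -> f (phi k) x @[k --> \oo] --> g x).
  apply: aeS cvgf => x hx xab; have /cvg_ex[l hl] := hx xab.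
  suff -> : g x = l by [].
  rewrite /g; have /cvg_limn_einf_sup[_ ->//] : (f (phi k) x)%:E @[k --> \oo] --> l%:E.
  by apply: cvg_EFin => //; apply: nearW.
have key k m : (phi k <= m)%N -> L2 a b (fun x => f m x - g x) /\
    L2norm a b (fun x => f m x - g x) <= 2^-1 ^+ k.
  move=> km.
  have [] := @int_fatou _ a b (fun j x => (f m x - f (phi (j + k)%N) x) ^+ 2)
     (fun x => (f m x - g x) ^+ 2) ((2^-1 ^+ k) ^+ 2).
  - by move=> j; exact: (L2_sqr_L1 (Lsub _ _)).
  - apply: measurable_funX; apply: measurable_funB => //; exact: L2_measurable.
  - by move=> j x _; exact: sqr_ge0.
  - move=> j; have := L2norm_sqr a b (fun x => f m x - f (phi (j + k)%N) x).
    rewrite /ip; under eq_Rintegral do rewrite -expr2; move=> <-.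
    rewrite lerXn2r ?nnegrE ?L2norm_ge0 ?exprn_ge0//; apply: phiP => //.
    have : {homo phi : m n / (m <= n)%N}.
      by apply: homo_leq => //; [exact: leq_trans|move=> i; exact/ltnW/phi_inc].
    by apply; exact: leq_addl.
  - apply: aeS cvgg => x hx xab; have {}hx := hx xab.
    have {}hx : f (phi (j + k)%N) x @[j --> \oo] --> g x.
      by rewrite (cvg_shiftn k (fun j => f (phi j) x)).
    by apply: cvgM; apply: cvgB => //; exact: cvg_cst.
  move=> L1fg ifg; have Lfg : L2 a b (fun x => f m x - g x).
    by apply/L2P; split => //; apply: measurable_funB => //; exact: L2_measurable.
  split => //; rewrite -(@ler_pXn2r _ 2)// ?nnegrE ?L2norm_ge0 ?exprn_ge0//.
  by rewrite L2norm_sqr /ip; under eq_Rintegral do rewrite -expr2.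
exists g.
  have [Lfg _] := key 0%N (phi 0%N) (leqnn _).
  by have := L2B (Lf (phi 0%N)) Lfg; under eq_fun do rewrite opprB addrC subrK.
apply/cvgr0Pnorm_le => e e0; have [k ke] := geometric_half_small e0.
exists (phi k) => // m /= km; rewrite ger0_norm ?L2norm_ge0//.
exact: le_trans (key k m km).2 ke.
Qed.

End L2Complete.

(** * Bump functions and mollifiers *)

Section SmoothFunctions.
Context {R : realType}.
Implicit Types (f g : R -> R) (x : R).

Definition smooth f := forall n x, derivable (derive1n n f) x 1.

Lemma smooth_of_derivatives (D : nat -> R -> R) :
  (forall n x, is_derive x 1 (D n) (D n.+1 x)) ->
  smooth (D 0%N) /\ forall n, derive1n n (D 0%N) = D n.
Proof.
move=> hD; have DE n : derive1n n (D 0%N) = D n.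
  elim: n => [//|n IH]; rewrite derive1nS IH; apply/funext => x.
  by rewrite derive1E; exact: (@derive_val _ _ _ _ _ _ _ (hD n x)).
by split => // n x; rewrite DE; exact: (@ex_derive _ _ _ _ _ _ _ (hD n x)).
Qed.

Lemma smooth_is_derive f n x : smooth f ->
  is_derive x 1 (derive1n n f) (derive1n n.+1 f x).
Proof. by move=> sf; rewrite derive1nS derive1E; exact/derivableP/sf. Qed.

Lemma smooth_derive f : smooth f -> smooth (derive1n 1 f).
Proof. by move=> sf n x; rewrite -derive1Sn; exact: (sf n.+1 x). Qed.

Lemma derivable_all_continuous f : (forall x, derivable f x 1) -> continuous f.
Proof. by move=> df x; exact/differentiable_continuous/derivable1_diffP/df. Qed.

Lemma smooth_continuous f n : smooth f -> continuous (derive1n n f).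
Proof. by move=> sf; apply: derivable_all_continuous => x; exact: sf. Qed.

(** Iterating the choice of a derivative inside [S] yields all orders at once, without a formula for
    the [n]-th derivative. *)
Lemma smooth_family (S : set (R -> R)) :
  (forall f, S f -> exists2 g, S g & forall x, is_derive x 1 f (g x)) ->
  forall f, S f -> smooth f.
Proof.
move=> hS f Sf.
have nxt (u : {f | S f}) : {v : {f | S f} | forall x, is_derive x 1 (sval u) (sval v x)}.
  by apply: cid; have [g Sg ug] := hS _ (svalP u); exists (exist _ g Sg).
pose D := fix D n := if n is k.+1 then sval (nxt (D k)) else exist S f Sf.
have [] := @smooth_of_derivatives (fun n => sval (D n)) => // n x.
exact: (svalP (nxt (D n))).
Qed.

Lemma smoothB f g : smooth f -> smooth g -> smooth (fun x => f x - g x).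
Proof.
move=> sf sg.
have [] := @smooth_of_derivatives (fun n x => derive1n n f x - derive1n n g x) => // n x.
by apply: is_deriveB; exact: smooth_is_derive.
Qed.

Lemma smoothZ c f : smooth f -> smooth (fun x => c * f x).
Proof.
move=> sf.
have [] := @smooth_of_derivatives (fun n x => c * derive1n n f x) => // n x.
by apply: is_deriveZ; exact: smooth_is_derive.
Qed.

Lemma is_derive_affine f (df c d x : R) : is_derive (c * x + d) 1 f df ->
  is_derive x 1 (fun y => f (c * y + d)) (c * df).
Proof.
move=> fdf; have h : is_derive x 1 (fun y : R => c * y + d) c.
  by apply: is_derive_eq; rewrite addr0 /GRing.scale/= mulr1.
by have := @is_derive1_comp _ f (fun y : R => c * y + d) x df c fdf h; rewrite mulrC.
Qed.

Lemma smooth_affine c d f : smooth f -> smooth (fun x => f (c * x + d)) /\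
  forall n x, derive1n n (fun x => f (c * x + d)) x = c ^+ n * derive1n n f (c * x + d).
Proof.
move=> sf; pose D n x := c ^+ n * derive1n n f (c * x + d).
have D0 : D 0%N = (fun x => f (c * x + d)).
  by apply/funext => x; rewrite /D mul1r.
have [] := @smooth_of_derivatives D; last by rewrite D0 => ? h; split => // n x; rewrite h.
move=> n x; rewrite /D exprSr -mulrA; apply: is_deriveZ; apply: is_derive_affine.
exact: smooth_is_derive.
Qed.

Lemma smooth_primitive f g : smooth g -> (forall x, is_derive x 1 f (g x)) -> smooth f.
Proof.
move=> sg fg; pose D n := if n is k.+1 then derive1n k g else f.
have hD n x : is_derive x 1 (D n) (D n.+1 x).
  by case: n => [|n]; [exact: fg|exact: smooth_is_derive].
exact: (smooth_of_derivatives hD).1.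
Qed.

End SmoothFunctions.

Section FundamentalTheorem.
Context {R : realType}.
Local Notation leb := (@lebesgue_measure R).
Implicit Types (f g F : R -> R) (a b x : R).

Lemma continuous_bounded_itv f a b : continuous f ->
  exists2 c, 0 <= c & forall x, x \in `[a, b] -> `|f x| <= c.
Proof.
move=> cf; have [ab|ba] := leP a b; last first.
  exists 0 => // x; rewrite in_itv/= => /andP[h1 h2].
  by have := le_trans h1 h2; rewrite leNgt ba.
have cnf : {within `[a, b], continuous (fun x => `|f x|)}.
  apply: continuous_subspaceT => x; exact: (cvg_norm (cf x)).
by have [c cab hc] := EVT_max ab cnf; exists (`|f c|).
Qed.

Lemma continuous_L1 f a b : continuous f -> L1 a b f.
Proof.
move=> cf; have [c _ fc] := continuous_bounded_itv a b cf.
apply: (@L1_bounded _ _ _ _ c).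
  by apply: measurable_funTS; exact: continuous_measurable_fun.
by move=> x xab; apply: fc; apply: subset_itv_oo_cc.
Qed.

Lemma is_derive_continuous F f : (forall x, is_derive x 1 F (f x)) -> continuous F.
Proof.
move=> Ff; apply: derivable_all_continuous => x.
exact: (@ex_derive _ _ _ _ _ _ _ (Ff x)).
Qed.

Lemma int_derive F f a b : a <= b -> continuous f ->
  (forall x, is_derive x 1 F (f x)) ->
  \int[leb]_(x in `]a, b[) f x = F b - F a.
Proof.
rewrite le_eqVlt => /predU1P[->|ab] cf Ff.
  by rewrite set_itv_ge ?bnd_simp ?ltxx// Rintegral_set0 subrr.
have Lf : leb.-integrable `[a, b] (EFin \o f).
  by apply: continuous_compact_integrable; [exact: segment_compact|exact: continuous_subspaceT].
have Lf' : leb.-integrable `[a, b[ (EFin \o f).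
  by apply: (integrableS _ _ _ Lf) => //; exact: subset_itv_co_cc.
rewrite Rintegral_itv_obnd_cbnd ?Rintegral_itv_bndo_bndc//; last exact: continuous_L1.
rewrite /Rintegral (@continuous_FTC2 _ f F)//.
- exact: continuous_subspaceT.
- split.
  + by move=> x _; exact: (@ex_derive _ _ _ _ _ _ _ (Ff x)).
  + by apply: cvg_at_right_filter; exact: (is_derive_continuous Ff).
  + by apply: cvg_at_left_filter; exact: (is_derive_continuous Ff).
- by move=> x _; rewrite derive1E; exact: (@derive_val _ _ _ _ _ _ _ (Ff x)).
Qed.

Lemma is_derive0_const F a b : (forall x, x \in `[a, b] -> is_derive x 1 F 0) ->
  a <= b -> F a = F b.
Proof.
move=> F0 ab.
have F0' x : x \in `]a, b[ -> is_derive x 1 F ((fun _ : R => 0 : R) x).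
  by move=> xab; apply: F0; exact: subset_itv_oo_cc.
have cF : {within `[a, b], continuous F}.
  apply: derivable_within_continuous => x xab.
  exact: (@ex_derive _ _ _ _ _ _ _ (F0 x xab)).
have [c _] := MVT_segment ab F0' cF.
by rewrite mul0r => /eqP; rewrite subr_eq0 => /eqP.
Qed.

Lemma is_derive_near0 f x : (\forall y \near x, f y = 0) -> is_derive x 1 f 0.
Proof.
move=> f0; have := is_derive_cst (0 : R) x (1 : R).
by apply: near_eq_is_derive => //; apply: filterS f0.
Qed.

Lemma antiderivative_ex f c : continuous f -> (forall x, x <= c -> f x = 0) ->
  exists2 F : R -> R, forall x, is_derive x 1 F (f x) & forall x, x <= c -> F x = 0.
Proof.
(* The integral starts at [c - 1], strictly to the left of every [x >= c], so that the fundamental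
   theorem applies at interior points; up to [c] the integrand is 0. *)
move=> cf f0; pose F x := \int[leb]_(t in `[c - 1, x]) f t.
have F0 x : x <= c -> F x = 0.
  move=> xc; rewrite /F (@eq_Rintegral _ _ _ _ _ (cst 0)) ?Rintegral_cst ?mul0r//.
  move=> y; rewrite inE/= in_itv/= => /andP[_ yx]; rewrite f0//.
  exact: le_trans yx xc.
exists F => // x; have [xc|cx] := ltP x c.
  rewrite (f0 x (ltW xc)); apply: is_derive_near0.
  by near=> y; apply: F0; apply: ltW; near: y; exact: lt_nbhsl.
have cx' : c - 1 < x by apply: lt_le_trans cx; rewrite gtrBl.
have x1 : x < x + 1 by rewrite ltrDl.
have Lf : leb.-integrable `[c - 1, x + 1] (EFin \o f).
  by apply: continuous_compact_integrable; [exact: segment_compact|exact: continuous_subspaceT].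
have [dF FE] := continuous_FTC1_closed x1 Lf cx' (cf x).
by rewrite -FE derive1E; exact: derivableP dF.
Unshelve. all: by end_near. Qed.

End FundamentalTheorem.

Section BumpFunction.
Context {R : realType}.
Local Notation leb := (@lebesgue_measure R).
Implicit Types (x : R).

(** For [k = 0] this is the classical flat function exp(-1/x). Powers of 1/x are included because
    differentiation produces them; the family is then closed under it up to linear combinations. *)
Definition expinv (k : nat) (x : R) : R :=
  if 0 < x then x^-1 ^+ k * expR (- x^-1) else 0.

Lemma expinv_ge0 k x : 0 <= expinv k x.
Proof.
rewrite /expinv; case: ifPn => // x0.
by rewrite mulr_ge0 ?exprn_ge0 ?invr_ge0 ?ltW ?expR_gt0.
Qed.

(** With y = 1/x and n = k + 1, exp y = (exp (y/n))^n >= (y/n)^n. *)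
Lemma expinv_le k x : expinv k x <= k.+1%:R ^+ k.+1 * `|x|.
Proof.
rewrite /expinv; case: ifPn => [x0|_]; last by rewrite mulr_ge0 ?exprn_ge0.
rewrite gtr0_norm// -[in leRHS](invrK x); set y := x^-1.
have y0 : 0 < y by rewrite invr_gt0.
rewrite ler_pdivlMr// mulrAC -exprSr expRN.
rewrite ler_pdivrMr ?expR_gt0// -ler_pdivrMl ?exprn_gt0//.
rewrite mulrC -expr_div_n.
have -> : expR y = expR (y / k.+1%:R) ^+ k.+1.
  by rewrite -expRM_natl mulrC divfK// pnatr_eq0.
rewrite lerXn2r ?nnegrE ?divr_ge0 ?expR_ge0 ?(ltW y0)//.
by apply: le_trans (expR_ge1Dx _); rewrite lerDr.
Qed.

(** At the origin the difference quotient of [expinv k] is [expinv k.+1], which tends to 0 by the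
    linear bound [expinv_le]. *)
Lemma expinv_is_derive k x :
  is_derive x 1 (expinv k) (expinv k.+2 x - k%:R * expinv k.+1 x).
Proof.
have [x0|x0|->] := ltgtP x 0.
- rewrite /expinv ltNge (ltW x0)/= mulr0 subr0; apply: is_derive_near0.
  by near=> y; rewrite ltNge (_ : y <= 0)//; apply: ltW; near: y; exact: lt_nbhsl.
- have xN0 : x != 0 by rewrite gt_eqF.
  have dV : is_derive x 1 (fun y : R => y^-1) (- x ^- 2).
    apply: is_derive_eq (is_deriveV _ _) _ => //.
    by rewrite /GRing.scale/= mulr1.
  have dE : is_derive x 1 (fun y : R => expR (- y^-1)) (x ^- 2 * expR (- x^-1)).
    have := @is_derive1_comp _ expR (fun y : R => - y^-1) x _ _
      (is_derive_expR _) (is_deriveN dV).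
    by rewrite opprK mulrC.
  have := is_deriveM (is_deriveX k dV) dE.
  move=> h; apply: (@near_eq_is_derive _ _ _
      (fun y : R => y^-1 ^+ k * expR (- y^-1))) => //.
    near=> y; rewrite /expinv (_ : 0 < y)//; near: y; exact: lt_nbhsr.
  have -> : (fun y : R => y^-1 ^+ k * expR (- y^-1)) =
      (fun y : R => y^-1) ^+ k * (fun y : R => expR (- y^-1)).
    by apply/funext => y; rewrite !fctE.
  apply: (is_derive_eq h); rewrite /expinv x0 /GRing.scale/= !fctE.
  by clear h; rewrite -!exprVn; case: k => [|k] /=; rewrite !exprS ?expr0; ring.
- have -> : expinv k.+2 0 - k%:R * expinv k.+1 0 = 0 by rewrite /expinv ltxx mulr0 subrr.
  have e0 : expinv k 0 = 0 by rewrite /expinv ltxx.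
  have : h^-1 *: (expinv k (h *: 1 + 0) - expinv k 0) @[h --> (0 : R)^'] --> (0 : R).
    have cv : (expinv k.+1 h : R) @[h --> (0 : R)^'] --> (0 : R).
      apply/cvgr0Pnorm_le => e e_gt0; near=> h.
      rewrite ger0_norm ?expinv_ge0//; apply: le_trans (expinv_le _ _) _.
      rewrite -ler_pdivlMl ?exprn_gt0//; near: h; apply: dnbhs0_le.
      by rewrite mulr_gt0 ?invr_gt0 ?exprn_gt0.
    apply: cvg_trans cv; apply: near_eq_cvg; near=> h.
    have hN0 : h != 0 by near: h; exact: nbhs_dnbhs_neq.
    rewrite e0 subr0 addr0 /GRing.scale/= mulr1 /expinv; case: ifPn => // h0.
      by rewrite exprS mulrA.
    by rewrite mulr0.
  move=> h; split; first by apply/cvg_ex; exists 0.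
  exact: cvg_lim h.
Unshelve. all: by end_near. Qed.

(** Closed under differentiation by the sum, product and chain rules, hence an instance for
    [smooth_family]; the bump function will be a product of two members. *)
Inductive expinv_alg : (R -> R) -> Prop :=
| ExpinvBase k : expinv_alg (expinv k)
| ExpinvAdd f g of expinv_alg f & expinv_alg g : expinv_alg (fun x => f x + g x)
| ExpinvScale c f of expinv_alg f : expinv_alg (fun x => c * f x)
| ExpinvMul f g of expinv_alg f & expinv_alg g : expinv_alg (fun x => f x * g x)
| ExpinvAffine c d f of expinv_alg f : expinv_alg (fun x => f (c * x + d)).

Lemma expinv_alg_smooth f : expinv_alg f -> smooth f.
Proof.
apply: smooth_family => {}f.
elim=> {f} [k|f g Af [f' Af' ff'] Ag [g' Ag' gg']|c f Af [f' Af' ff']|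
  f g Af [f' Af' ff'] Ag [g' Ag' gg']|c d f Af [f' Af' ff']].
- exists (fun x => expinv k.+2 x + (- k%:R) * expinv k.+1 x).
    by apply: ExpinvAdd; [|apply: ExpinvScale]; exact: ExpinvBase.
  by move=> x; rewrite mulNr; exact: expinv_is_derive.
- exists (fun x => f' x + g' x); first exact: ExpinvAdd.
  by move=> x; apply: is_deriveD.
- exists (fun x => c * f' x); first exact: ExpinvScale.
  by move=> x; apply: is_deriveZ.
- exists (fun x => f x * g' x + g x * f' x).
    by apply: ExpinvAdd; exact: ExpinvMul.
  by move=> x; apply: is_deriveM.
- exists (fun x => c * f' (c * x + d)).
    by apply: ExpinvScale; exact: ExpinvAffine.
  by move=> x; apply: is_derive_affine.
Qed.

End BumpFunction.

(** * One-sided mollifiers, Lebesgue points and the fundamental lemma *)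

Section Mollifiers.
Context {R : realType}.
Local Notation leb := (@lebesgue_measure R).
Implicit Types (f g eta H : R -> R) (x a b h e t C : R).

(** The support lies in [[0, h]], so that [eta (t - s)] weighs only the past times [s] in
    [[t - h, t]]. [C] is kept apart from [h] because convergence at Lebesgue points needs one [C]
    for all widths. *)
Record mollifier (C h : R) (eta H : R -> R) : Prop := Mollifier {
  mol_smooth : smooth eta;
  mol_ge0 : forall x, 0 <= eta x;
  mol_le : forall x, eta x <= C / h;
  mol_left : forall x, x <= 0 -> eta x = 0;
  mol_right : forall x, h <= x -> eta x = 0;
  mol_prim : forall x, is_derive x 1 H (eta x);
  mol_prim0 : forall x, x <= 0 -> H x = 0;
  mol_prim1 : forall x, h <= x -> H x = 1;
  mol_prim_ge0 : forall x, 0 <= H x;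
  mol_prim_le1 : forall x, H x <= 1 }.

Lemma is_derive_ge0_homo (F f : R -> R) : (forall x, is_derive x 1 F (f x)) ->
  (forall x, 0 <= f x) -> {homo F : x y / x <= y}.
Proof.
move=> Ff f0 x y xy; have cF : {within `[x, y], continuous F}.
  by apply: continuous_subspaceT; exact: is_derive_continuous Ff.
have [c _] := MVT_segment xy (fun z _ => Ff z) cF.
by move=> e; rewrite -subr_ge0 e mulr_ge0// subr_ge0.
Qed.

Lemma mollifier_ex : exists2 C, 0 <= C & forall h, 0 < h ->
  exists eta H, mollifier C h eta H.
Proof.
pose b x := expinv 0 x * expinv 0 (-1 * x + 1).
have Ab : expinv_alg b.
  by apply: ExpinvMul; [exact: ExpinvBase|apply: ExpinvAffine; exact: ExpinvBase].
have sb := expinv_alg_smooth Ab.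
have b0 x : 0 <= b x by rewrite mulr_ge0// expinv_ge0.
have e1 x : expinv 0 x <= 1.
  rewrite /expinv; case: ifPn => // x0.
  by rewrite expr0 mul1r -expR0 ler_expR oppr_le0 invr_ge0 ltW.
have b1 x : b x <= 1 by rewrite -[leRHS]mulr1 ler_pM ?expinv_ge0.
have bl x : x <= 0 -> b x = 0 by move=> x0; rewrite /b /expinv ltNge x0/= mul0r.
have br x : 1 <= x -> b x = 0.
  by move=> x1; rewrite /b {2}/expinv mulN1r addrC subr_gt0 ltNge x1/= mulr0.
have cb : continuous b by exact: (@smooth_continuous _ _ 0%N sb).
have [P Pb P0] := antiderivative_ex cb bl.
have Pmono := is_derive_ge0_homo Pb b0.
have P1 x : 1 <= x -> P x = P 1.
  move=> x1; apply/esym/is_derive0_const => // y.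
  by rewrite in_itv/= => /andP[y1 _]; rewrite -(br y y1); exact: Pb.
have Pge0 x : 0 <= P x.
  have [x0|/ltW x0] := leP x 0; first by rewrite P0.
  by rewrite -(P0 0)//; exact: Pmono.
have Ple x : P x <= P 1.
  by have [x1|/ltW x1] := leP x 1; [exact: Pmono|rewrite P1].
(* If the total mass were 0, [P] would vanish identically, whereas its derivative [b] is positive at
   1/2. *)
have P1_gt0 : 0 < P 1.
  rewrite lt_def Pge0 andbT; apply/eqP => P10.
  have : is_derive (2^-1 : R) 1 P 0.
    have -> : P = cst 0.
      by apply/funext => y; apply/eqP; rewrite eq_le Pge0 -[0 in X in X && _]P10 Ple.
    exact: is_derive_cst.
  move=> h; have := @derive_val _ _ _ _ _ _ _ h.
  rewrite (@derive_val _ _ _ _ _ _ _ (Pb 2^-1)) => /eqP.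
  rewrite /b /expinv mulN1r addrC subr_gt0 invf_lt1// ltr1n invr_gt0 ltr0n/=.
  have -> : (1 - 2^-1 : R) = 2^-1 by field.
  by rewrite expr0 mul1r mulf_eq0 orbb gt_eqF// expR_gt0.
(* Since [b <= 1], the kernel normalised by its mass [P 1] and rescaled to width [h] has height at
   most [(P 1)^-1 / h]. *)
exists (P 1)^-1; first by rewrite invr_ge0.
move=> h h0; have ih0 : 0 < h^-1 by rewrite invr_gt0.
have scale_le0 x : x <= 0 -> h^-1 * x + 0 <= 0.
  by move=> x0; rewrite addr0 pmulr_rle0.
have scale_ge1 x : h <= x -> 1 <= h^-1 * x + 0.
  by move=> hx; rewrite addr0 ler_pdivlMl// mulr1.
exists (fun x => ((P 1)^-1 * h^-1) * b (h^-1 * x + 0)), (fun x => (P 1)^-1 * P (h^-1 * x + 0)).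
split.
- by apply: smoothZ; have [] := smooth_affine h^-1 0 sb.
- by move=> x; rewrite mulr_ge0// mulr_ge0 ?invr_ge0// ltW.
- by move=> x; rewrite -[leRHS]mulr1 ler_wpM2l// mulr_ge0 ?invr_ge0// ltW.
- by move=> x /scale_le0 h1; rewrite bl// mulr0.
- by move=> x /scale_ge1 h1; rewrite br// mulr0.
- move=> x; rewrite -mulrA; apply: is_deriveZ; exact: is_derive_affine.
- by move=> x /scale_le0 h1; rewrite (P0 _ h1) mulr0.
- by move=> x /scale_ge1 h1; rewrite (P1 _ h1) mulVf// gt_eqF.
- by move=> x; rewrite mulr_ge0 ?invr_ge0.
- by move=> x; rewrite ler_pdivrMl// mulr1.
Qed.

Lemma mollifier_reflect C h eta H t x : mollifier C h eta H ->
  is_derive x 1 (fun s => - H (t - s)) (eta (t - x)).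
Proof.
move=> m; have e : (fun s => - H (t - s)) = (fun s => -1 * H (-1 * s + t)).
  by apply/funext => s; rewrite !mulN1r addrC.
rewrite e.
have -> : eta (t - x) = -1 * (-1 * eta (-1 * x + t)) by rewrite !mulN1r opprK addrC.
apply: is_deriveZ; apply: is_derive_affine; exact: (mol_prim m).
Qed.

Lemma reflect_continuous f t : continuous f -> continuous (fun s => f (t - s)).
Proof. by move=> cf x; apply: continuous_comp; [apply: cvgB; [exact: cvg_cst|exact: cvg_id]|exact:
  cf]. Qed.

Lemma mol_continuous C h eta H : mollifier C h eta H -> continuous eta.
Proof. by move=> m; exact: (@smooth_continuous _ _ 0%N (mol_smooth m)). Qed.

Lemma mollifier_int C h eta H a b t : mollifier C h eta H ->
  a <= t - h -> t <= b -> a <= b ->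
  \int[leb]_(s in `]a, b[) eta (t - s) = 1.
Proof.
move=> m ath tb ab.
have -> := @int_derive R (fun s => - H (t - s)) (fun s => eta (t - s)) a b ab
  (reflect_continuous (mol_continuous m)) (fun x => mollifier_reflect t x m).
rewrite (mol_prim0 m) ?subr_le0// (mol_prim1 m) ?opprK ?oppr0 ?add0r//.
by rewrite lerBrDr addrC -lerBrDr.
Qed.

Lemma mollifier_mul_L1 C h eta H a b f t : mollifier C h eta H ->
  L1 a b f -> L1 a b (fun s => eta (t - s) * f s).
Proof.
move=> m Lf; apply: (@L1_mulb _ _ _ _ _ (C / h)) => //.
  apply: measurable_funTS; apply: continuous_measurable_fun.
  by apply: reflect_continuous; exact: mol_continuous m.
by move=> x _; rewrite ger0_norm ?(mol_ge0 m) ?(mol_le m).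
Qed.

(** A height of [C / h] against a ball of measure [2 * h] bounds the error by [2 * C] times the mean
    oscillation of [f] around [f t], which is small at a Lebesgue point. The threshold [d] serves
    all kernels with the same [C]. *)
Lemma mollifier_cvg C a b f t : 0 <= C -> L1 a b f -> t \in `]a, b[ ->
  lebesgue_pt (f \_ `]a, b[) t -> forall e, 0 < e ->
  exists2 d, 0 < d & forall h eta H, 0 < h -> h < d -> mollifier C h eta H ->
    `|\int[leb]_(s in `]a, b[) (eta (t - s) * f s) - f t| <= e.
Proof.
move=> C0 Lf tab lpt e e0.
have /andP[at_ tb] : (a < t) && (t < b) by move: tab; rewrite in_itv.
have ab := lt_trans at_ tb.
have De : 0 < e / (2 * C + 1) by rewrite divr_gt0// ltr_wpDl// mulr_ge0.
have /fine_cvgP[finD /cvgr0Pnorm_le/(_ _ De) nearD] := lpt.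
have [d0 /= d0_gt0 Hd0] : \forall r \near (0:R)^'+,
    davg (f \_ `]a, b[) t r \is a fin_num /\
    `|fine (davg (f \_ `]a, b[) t r)| <= e / (2 * C + 1).
  by near=> r; split; near: r.
(* [h < t - a] keeps the support of [s |-> eta (t - s)] inside the interval, so that its integral
   there is 1. *)
exists (Num.min d0 (t - a)); first by rewrite lt_min d0_gt0 subr_gt0.
move=> h eta H h0; rewrite lt_min => /andP[hd0 hta] m.
have [finh Hh] : davg (f \_ `]a, b[) t h \is a fin_num /\
    `|fine (davg (f \_ `]a, b[) t h)| <= e / (2 * C + 1).
  by apply: Hd0 => //; rewrite /ball_/= sub0r normrN gtr0_norm.
rewrite -[f t]mul1r.
rewrite -(@mollifier_int C h eta H a b t m); try exact: ltW.
  rewrite -RintegralZr//; last first.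
    by apply: continuous_L1; apply: reflect_continuous; exact: mol_continuous m.
  rewrite -RintegralB//; first last.
  - by apply: mollifier_mul_L1 m _; exact: (L1_cst a b (f t)).
  - exact: mollifier_mul_L1 m Lf.
  have LL : L1 a b (fun x => eta (t - x) * f x - eta (t - x) * f t).
    apply: L1B; first exact: mollifier_mul_L1 m Lf.
    by apply: mollifier_mul_L1 m _; exact: (L1_cst a b (f t)).
  rewrite -lee_fin; apply: le_trans (_ : (2 * C)%:E * davg (f \_ `]a, b[) t h <= _)%E; last first.
    rewrite -(fineK finh) -EFinM lee_fin.
    apply: (@le_trans _ _ (2 * C * (e / (2 * C + 1)))).
      by rewrite ler_wpM2l ?mulr_ge0//; apply: le_trans (ler_norm _) Hh.
    rewrite mulrA ler_pdivrMr ?ltr_wpDl ?mulr_ge0// mulrC mulrDr mulr1 lerDl//; exact: ltW.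
  rewrite EFin_normr_Rintegral//.
  have mF : measurable_fun `]a, b[
      (fun x => (eta (t - x) * f x - eta (t - x) * f t)%:E).
    by apply/measurable_EFinP; exact: L1_measurable LL.
  apply: le_trans (le_abse_integral _ _ _) _; [exact: measurable_itv|exact: mF|].
  rewrite /davg /iavg lebesgue_measure_ball; last exact: ltW.
  have -> : ((h *+ 2)%:E^-1 = ((2 * h)^-1)%:E :> \bar R)%E.
    by rewrite inver mulrn_eq0/= gt_eqF// mulr_natl.
  rewrite muleA -EFinM.
  have -> : 2 * C * (2 * h)^-1 = C / h by field; rewrite gt_eqF.
  rewrite -ge0_integralZl//; last first.
  - by rewrite lee_fin divr_ge0// ltW.
  - apply: measurableT_comp => //; apply/measurable_EFinP/measurable_funB => //.
    apply: measurable_funTS; apply/(measurable_restrictT f (measurable_itv _)).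
    exact: L1_measurable.
  - exact: measurable_ball.
  rewrite integral_mkcond [leRHS]integral_mkcond; apply: ge0_le_integral => //.
  - by move=> x _; apply: erestrict_ge0.
  - apply/(measurable_restrictT _ (measurable_itv _)).
    by apply: measurableT_comp => //; exact: mF.
  - apply/(measurable_restrictT _ (measurable_ball _ _)).
    apply: measurable_funeM; apply: measurableT_comp => //.
    apply/measurable_EFinP/measurable_funB => //.
    apply: measurable_funTS; apply/(measurable_restrictT f (measurable_itv _)).
    exact: L1_measurable.
  - move=> x _; rewrite /patch; case: ifPn => xab; last first.
      by case: ifPn => // _; rewrite mule_ge0// lee_fin divr_ge0// ltW.
    case: ifPn => xball.
      have tab' : t \in `]a, b[%classic by rewrite inE.
      rewrite /= -mulrBr normrM lee_fin tab' xab.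
      by rewrite (ger0_norm (mol_ge0 m _)) ler_wpM2r// (mol_le m).
    rewrite -[X in (_ <= X)%E]/(0%:E) /= -mulrBr lee_fin.
    have -> : eta (t - x) = 0; last by rewrite mul0r normr0.
    have [xt|xt] := leP t x; first by rewrite (mol_left m)// subr_le0.
    apply: (mol_right m); rewrite leNgt; apply: contra xball => txh.
    by rewrite inE/= /ball/= ger0_norm// ltW// subr_gt0.
by rewrite lerBrDr -lerBrDl ltW.
Unshelve. all: by end_near. Qed.

Lemma ae_lebesgue_pt (a b : R) f : L1 a b f ->
  ae (fun x => x \in `]a, b[ -> lebesgue_pt (f \_ `]a, b[) x).
Proof.
move=> Lf; have : locally_integrable setT (f \_ `]a, b[) by exact: integrable_locally.
by move=> /lebesgue_differentiation; apply: aeS => x h _.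
Qed.

(** At a Lebesgue point [t] the function [s |-> eta (t - s)] is itself a test function once its
    width is below [t - a], and its integral against [f] approximates [f t]. *)
Lemma fundamental_lemma (a b : R) f : L1 a b f ->
  (forall phi, test_function a b phi -> \int[leb]_(x in `]a, b[) (f x * phi x) = 0) ->
  ae (fun x => x \in `]a, b[ -> f x = 0).
Proof.
move=> Lf h; apply: aeS (ae_lebesgue_pt Lf) => t lpt tab.
have [C C0 molC] := mollifier_ex.
have /andP[at_ tb] : (a < t) && (t < b) by move: tab; rewrite in_itv.
apply/eqP; rewrite -normr_le0; apply/ler_addgt0Pr => e e0; rewrite add0r.
have [d d0 Hd] := mollifier_cvg C0 Lf tab (lpt tab) e0.
pose k := Num.min d (t - a) / 2.
have m0 : 0 < Num.min d (t - a) by rewrite lt_min d0 subr_gt0.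
have k0 : 0 < k by rewrite divr_gt0.
have : k < Num.min d (t - a) by rewrite ltr_pdivrMr// ltr_pMr// ltr1n.
rewrite lt_min => /andP[kd kta].
have [eta [H m]] := molC k k0.
have := Hd k eta H k0 kd m.
under eq_Rintegral do rewrite mulrC.
rewrite h ?sub0r ?normrN//; split.
  have [s _] := smooth_affine (-1) t (mol_smooth m).
  by under eq_fun do rewrite addrC -mulN1r.
exists (t - k), t; split => //; first by rewrite ltrBrDr -ltrBrDl.
move=> x; rewrite in_itv/= negb_and -!ltNge => /orP[xt|xt].
  by rewrite (mol_right m)// lerBrDr -lerBrDl ltW// -ltrBrDr.
by rewrite (mol_left m)// subr_le0 ltW.
Qed.

End Mollifiers.

(** * Weak derivatives and primitives *)

Section TriangleFubini.
Context {R : realType}.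
Local Notation leb := (@lebesgue_measure R).
Implicit Types (p q f g phi : R -> R) (a b c d e x y : R).

(** Both sides are iterated integrals of p(x) q(y) over the triangle y < x. This is the source of
    integration by parts for primitives of integrable functions. *)
Lemma triangle_fubini a b p q : L1 a b p -> L1 a b q ->
  \int[leb]_(x in `]a, b[) (p x * \int[leb]_(y in `]a, x[) q y) =
  \int[leb]_(y in `]a, b[) (q y * \int[leb]_(x in `]y, b[) p x).
Proof.
move=> Lp Lq; pose I : set R := `]a, b[%classic.
pose f (z : R * R) := (p \_ I) z.1 * (q \_ I) z.2 * (if z.2 < z.1 then 1 else 0).
have mpq h : L1 a b h -> measurable_fun setT (h \_ I).
  by move=> Lh; apply/(measurable_restrictT h (measurable_itv _)); exact: L1_measurable.
have ipq h : L1 a b h -> leb.-integrable setT (EFin \o (h \_ I)).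
  move=> Lh; have e := integrable_mkcond (mu := leb) (EFin \o h) (measurable_itv `]a, b[).
  by have := e.1 Lh; rewrite restrict_EFin.
have mf : measurable_fun setT (EFin \o f).
  apply/measurable_EFinP; apply: measurable_funM.
    apply: measurable_funM.
      by apply: measurableT_comp (mpq _ Lp) _.
    by apply: measurableT_comp (mpq _ Lq) _.
  by apply: measurable_fun_ifT => //; exact: measurable_fun_ltr.
have fle (x y : R) : (`|(EFin \o f) (x, y)| <= `|(p \_ I) x|%:E * `|(q \_ I) y|%:E)%E.
  rewrite /f /= -EFinM lee_fin !normrM ler_piMr ?mulr_ge0//.
  by case: ifP => _; rewrite ?normr1 ?normr0.
have intf : (leb \x leb)%E.-integrable setT (EFin \o f).
  apply/integrable12ltyP => //.
  apply: (@le_lt_trans _ _ (\int[leb]_x (`|(p \_ I) x|%:E * \int[leb]_y `|(q \_ I) y|%:E))%E).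
    apply: ge0_le_integral => //.
    - by move=> x _; exact: integral_ge0.
    - apply: (@measurable_fun_fubini_tonelli_F _ _ _ _ _
        (lebesgue_measure : {sigma_finite_measure set _ -> \bar R}) (abse \o (EFin \o f))) => //=.
      exact: measurableT_comp.
    - apply: emeasurable_funM => //; apply/measurable_EFinP.
      by apply: measurableT_comp => //; exact: mpq.
    - move=> x _; rewrite -ge0_integralZl//; last first.
        by apply/measurable_EFinP; apply: measurableT_comp => //; exact: mpq.
      apply: ge0_le_integral => //.
      + apply: measurableT_comp => //; exact: (measurableT_comp mf).
      + apply: emeasurable_funM => //; apply/measurable_EFinP.
        by apply: measurableT_comp => //; exact: mpq.
  have /integrableP[_ p1] := ipq _ Lp; have /integrableP[_ q1] := ipq _ Lq.
  have qfin : (\int[leb]_y `|(q \_ I) y|%:E)%E \is a fin_num.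
    by rewrite ge0_fin_numE//; exact: integral_ge0.
  rewrite -(fineK qfin) ge0_integralZr//.
  - by rewrite muleC lte_mul_pinfty// lee_fin fine_ge0//; exact: integral_ge0.
  - by apply/measurable_EFinP; apply: measurableT_comp => //; exact: mpq.
  - by rewrite lee_fin fine_ge0//; exact: integral_ge0.
have key (h : R -> R) (J : set R) (c : R) : measurable J -> leb.-integrable J (EFin \o h) ->
    (\int[leb]_y (c * (h \_ J) y)%:E = (c * \int[leb]_(y in J) h y)%:E)%E.
  move=> mJ Lh; have e := integrable_mkcond (mu := leb) (EFin \o h) mJ.
  have {}e := e.1 Lh; rewrite restrict_EFin in e.
  under eq_integral do rewrite EFinM.
  rewrite integralZl// EFinM; congr (_ * _)%E.
  by rewrite Rintegral_mkcond /Rintegral fineK//; apply: integrable_fin_num.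
have subI h (J : set R) : measurable J -> J `<=` I -> L1 a b h -> leb.-integrable J (EFin \o h).
  by move=> mJ JI Lh; exact: (@integrableS _ _ _ leb I J (EFin \o h) (measurable_itv _) mJ JI Lh).
have II x : (x \in I) = (a < x < b) by rewrite /I mem_setE in_itv.
have F1 x : (\int[leb]_y (EFin \o f) (x, y) =
    (((fun x => p x * \int[leb]_(y in `]a, x[) q y) \_ I) x)%:E)%E.
  have [xI|xI] := boolP (x \in I); rewrite [in RHS]/patch ?xI ?(negbTE xI); last first.
    rewrite (eq_integral (cst 0%E)) ?integral0// => y _.
    by rewrite /f /= {1}/patch (negbTE xI) !mul0r.
  move: (xI); rewrite II => /andP[ax xb].
  rewrite -(key q `]a, x[%classic (p x))//; last first.
    by apply: subI => //; apply: subset_itvl; rewrite bnd_simp ltW.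
  apply: eq_integral => y _; congr EFin.
  rewrite /f /= {1}/patch xI -mulrA; congr (_ * _).
  rewrite /patch !mem_setE !in_itv/=; have [yx|yx] := ltP y x.
    by rewrite (lt_trans yx xb) mulr1.
  by rewrite mulr0 andbF.
have F2 y : (\int[leb]_x (EFin \o f) (x, y) =
    (((fun y => q y * \int[leb]_(x in `]y, b[) p x) \_ I) y)%:E)%E.
  have [yI|yI] := boolP (y \in I); rewrite [in RHS]/patch ?yI ?(negbTE yI); last first.
    rewrite (eq_integral (cst 0%E)) ?integral0// => x _.
    by rewrite /f /= {2}/patch (negbTE yI) mulr0 mul0r.
  move: (yI); rewrite II => /andP[ay yb].
  rewrite -(key p `]y, b[%classic (q y))//; last first.
    by apply: subI => //; apply: subset_itvr; rewrite bnd_simp ltW.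
  apply: eq_integral => x _; congr EFin.
  rewrite /f /= {2}/patch yI mulrAC mulrC; congr (_ * _).
  rewrite /patch !mem_setE !in_itv/=; have [yx|yx] := ltP y x.
    by rewrite (lt_trans ay yx) mulr1.
  by rewrite mulr0.
have := Fubini intf.
under eq_integral do rewrite F1.
under [in X in _ = X -> _]eq_integral do rewrite F2.
move=> e; rewrite [LHS]Rintegral_mkcond [RHS]Rintegral_mkcond.
exact: (congr1 fine e).
Qed.

End TriangleFubini.

Section Primitives.
Context {R : realType}.
Local Notation leb := (@lebesgue_measure R).
Implicit Types (p q f g phi : R -> R) (a b c d e x y : R).

Definition prim a g x := \int[leb]_(y in `]a, x[) g y.

Lemma L1_sub a b c d g : a <= c -> d <= b -> L1 a b g -> L1 c d g.
Proof.
move=> ac db; apply: integrableS => //; apply: subset_itv; rewrite bnd_simp//.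
Qed.

Lemma L1_closed a b g : L1 a b g -> leb.-integrable `[a, b] (EFin \o g).
Proof.
move=> Lg; have [ba|ab] := ltP b a.
  by rewrite set_itv_ge ?bnd_simp -?ltNge//; exact: integrable_set0.
have /integrableP[mg ig] := Lg.
apply/integrableP; split.
  by apply/emeasurable_fun_itv_bndo_bndcP/emeasurable_fun_itv_obnd_cbndP.
move: ig; rewrite integral_itv_obnd_cbnd; last first.
  by apply: measurableT_comp.
rewrite integral_itv_bndo_bndc//; apply: measurableT_comp => //.
exact/emeasurable_fun_itv_obnd_cbndP.
Qed.

Lemma primE a b g x : L1 a b g -> x <= b -> prim a g x = \int[leb]_(y in `[a, x]) g y.
Proof.
move=> Lg xb; have Lx := L1_sub (lexx a) xb Lg.
rewrite /prim Rintegral_itv_obnd_cbnd// Rintegral_itv_bndo_bndc//.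
by apply: (integrableS _ _ _ (L1_closed Lx)) => //; exact: subset_itv_co_cc.
Qed.

Lemma prim_left a g : prim a g a = 0.
Proof. by rewrite /prim set_itv_ge ?bnd_simp ?ltxx// Rintegral_set0. Qed.

Lemma prim_continuous a b g : a <= b -> L1 a b g -> {within `[a, b], continuous (prim a g)}.
Proof.
move=> ab Lg; have h := parameterized_integral_continuous ab (L1_closed Lg).
apply: subspace_eq_continuous h => x; rewrite inE/= in_itv/= => /andP[_ xb].
exact/esym/(primE Lg xb).
Qed.

Lemma within_continuous_measurable a b f : {within `[a, b], continuous f} ->
  measurable_fun `]a, b[ f.
Proof.
move=> cf; apply: (@measurable_funS _ _ _ _ `[a, b]%classic) => //.
  exact: subset_itv_oo_cc.
exact: subspace_continuous_measurable_fun.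
Qed.

Lemma prim_bound a b g x : L1 a b g -> x \in `[a, b] ->
  `|prim a g x| <= \int[leb]_(y in `]a, b[) `|g y|.
Proof.
move=> Lg; rewrite in_itv/= => /andP[ax xb].
have Lx := L1_sub (lexx a) xb Lg.
apply: le_trans (le_normr_Rintegral _ Lx) _ => //.
rewrite /Rintegral fine_le//; try by apply: integrable_fin_num => //; exact: L1_norm.
apply: ge0_subset_integral => //.
- by apply: measurable_int (L1_norm Lg).
- by apply: subset_itvl; rewrite bnd_simp.
Qed.

Lemma prim_L2 a b g : a <= b -> L1 a b g -> L2 a b (prim a g).
Proof.
move=> ab Lg; apply: (@L2_bounded _ _ _ _ (\int[leb]_(y in `]a, b[) `|g y|)).
  by apply: within_continuous_measurable; exact: prim_continuous.
move=> x xab; apply: prim_bound => //; exact: subset_itv_oo_cc.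
Qed.

(** Integration by parts: after the exchange on the triangle the inner integral of [dphi] over (y,
    b) is [phi b - phi y]. At [a] the primitive is 0; the term at [b] is kept for weights that do
    not vanish there. *)
Lemma prim_weak a b g phi dphi : a <= b -> L1 a b g -> continuous dphi ->
  (forall x, is_derive x 1 phi (dphi x)) ->
  \int[leb]_(x in `]a, b[) (prim a g x * dphi x) =
  phi b * \int[leb]_(x in `]a, b[) g x - \int[leb]_(x in `]a, b[) (g x * phi x).
Proof.
move=> ab Lg cd dphiP; have Ld := continuous_L1 a b cd.
under eq_Rintegral do rewrite mulrC.
rewrite triangle_fubini//.
have -> : \int[leb]_(y in `]a, b[) (g y * \int[leb]_(x in `]y, b[) dphi x) =
    \int[leb]_(y in `]a, b[) (phi b * g y - g y * phi y).
  apply: eq_Rintegral => y; rewrite inE/= in_itv/= => /andP[ay yb].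
  by rewrite (int_derive (ltW yb) cd dphiP) mulrBr mulrC.
have Lgphi : L1 a b (fun y => g y * phi y).
  have cphi := is_derive_continuous dphiP.
  have [k _ hk] := continuous_bounded_itv a b cphi.
  have : L1 a b (fun y => phi y * g y).
    apply: (@L1_mulb _ _ _ _ _ k) => //.
      by apply: measurable_funTS; exact: continuous_measurable_fun.
    by move=> x xab; apply: hk; exact: subset_itv_oo_cc.
  by apply: L1_ext => y _; rewrite mulrC.
by rewrite RintegralB// ?RintegralZl//; exact: L1Z.
Qed.

Lemma ae_dense (P : R -> Prop) a b : a < b -> ae P -> exists2 x, x \in `]a, b[ & P x.
Proof.
move=> ab /ae_null[N [mN N0] NP]; apply: contrapT => h.
have sub : `]a, b[%classic `<=` N.
  by move=> x xab; apply: contrapT => /NP Px; apply: h; exists x.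
have : (leb `]a, b[%classic <= leb N)%E by apply: le_measure => //; rewrite inE.
by rewrite N0 lebesgue_measure_itv/= lte_fin ab -EFinD lee_fin leNgt subr_gt0 ab.
Qed.

Lemma within_continuousP (a b : R) f : {within `[a, b], continuous f} <->
  forall x, x \in `[a, b] -> forall e, 0 < e -> exists2 d, 0 < d &
    forall y, y \in `[a, b] -> `|y - x| < d -> `|f y - f x| <= e.
Proof.
split=> [/subspace_continuousP h x xab e e0|h].
  have /cvgrPdist_le/(_ e e0) := h x xab.
  move=> [d /= d0 hd]; exists d => // y yab yx; rewrite distrC; apply: hd => //.
  by rewrite /ball_/= distrC.
apply/subspace_continuousP => x xab; apply/cvgrPdist_le => e e0.
have [d d0 hd] := h x xab e e0.
exists d => //= y; rewrite /ball_/= => yx yab; rewrite distrC; apply: hd => //.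
by rewrite distrC.
Qed.

Lemma itv_dense_point (P : R -> Prop) a b x d : a < b -> ae P -> x \in `[a, b] -> 0 < d ->
  exists2 y, (P y /\ y \in `]a, b[) & `|y - x| < d.
Proof.
move=> ab aP; rewrite in_itv/= => /andP[ax xb] d0.
have : Num.max a (x - d) < Num.min b (x + d).
  rewrite lt_min !gt_max ab/= (le_lt_trans ax) ?ltrDl//= ltrBlDr (le_lt_trans xb) ?ltrDl//.
  by rewrite ltrBlDr -addrA ltrDl addr_gt0.
move=> /ae_dense/(_ aP)[y]; rewrite in_itv/= lt_min gt_max => /andP[/andP[ay dy] /andP[yb yd]] Py.
exists y; first by rewrite in_itv/= ay.
by rewrite ltr_distl dy.
Qed.

Lemma within_continuous_ae_le a b f c : a < b -> {within `[a, b], continuous f} ->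
  ae (fun x => x \in `]a, b[ -> f x <= c) -> forall x, x \in `[a, b] -> f x <= c.
Proof.
move=> ab /within_continuousP cf fc x xab; apply/ler_addgt0Pr => e e0.
have [d d0 hd] := cf x xab e e0.
have [y [Py yab] yx] := itv_dense_point ab fc xab d0.
have := hd y (subset_itv_oo_cc yab) yx; rewrite ler_distl => /andP[+ _].
by rewrite lerBlDr => /le_trans; apply; rewrite lerD2r Py.
Qed.

Lemma within_continuous_ae_eq a b f g : a < b ->
  {within `[a, b], continuous f} -> {within `[a, b], continuous g} ->
  ae (fun x => x \in `]a, b[ -> f x = g x) -> forall x, x \in `[a, b] -> f x = g x.
Proof.
move=> ab cf cg fg x xab; apply/eqP; rewrite eq_le; apply/andP; split; rewrite -subr_le0.
  apply: (@within_continuous_ae_le a b (fun x => f x - g x)) => //.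
    by move=> z; apply: cvgB; [exact: cf|exact: cg].
  by apply: aeS fg => z h /h ->; rewrite subrr.
apply: (@within_continuous_ae_le a b (fun x => g x - f x)) => //.
  by move=> z; apply: cvgB; [exact: cg|exact: cf].
by apply: aeS fg => z h /h ->; rewrite subrr.
Qed.

Lemma test_function_deriv a b phi x : test_function a b phi ->
  is_derive x 1 phi (derive1n 1 phi x).
Proof. by move=> [sphi _]; exact: (@smooth_is_derive _ phi 0%N x sphi). Qed.

Lemma test_function_bd a b phi : test_function a b phi -> phi a = 0 /\ phi b = 0.
Proof.
move=> [_ [c [d [ac db h]]]]; split; apply: h; rewrite in_itv/= negb_and -!ltNge ?ac//.
by rewrite db orbT.
Qed.

Lemma test_function_cont a b phi n : test_function a b phi -> continuous (derive1n n phi).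
Proof. by move=> [sphi _]; exact: (@smooth_continuous _ phi n sphi). Qed.

Arguments test_function_cont {a b} [phi] n%_N _.

Lemma L1_mul_cont a b f phi : continuous phi -> L1 a b f -> L1 a b (fun x => f x * phi x).
Proof.
move=> cphi Lf; have [k _ hk] := continuous_bounded_itv a b cphi.
have : L1 a b (fun y => phi y * f y).
  apply: (@L1_mulb _ _ _ _ _ k) => //.
    by apply: measurable_funTS; exact: continuous_measurable_fun.
  by move=> x xab; apply: hk; exact: subset_itv_oo_cc.
by apply: L1_ext => y _; rewrite mulrC.
Qed.

Lemma weak_deriv_unique a b k f g g' : L1 a b g -> L1 a b g' ->
  weak_deriv a b k f g -> weak_deriv a b k f g' ->
  ae (fun x => x \in `]a, b[ -> g x = g' x).
Proof.
move=> Lg Lg' wg wg'.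
have : ae (fun x => x \in `]a, b[ -> g x - g' x = 0).
  apply: (@fundamental_lemma _ a b (fun x => g x - g' x)); first exact: L1B.
  move=> phi tphi; have cphi := test_function_cont 0 tphi.
  under eq_Rintegral do rewrite mulrBl.
  rewrite RintegralB//; [|exact: L1_mul_cont|exact: L1_mul_cont].
  have := wg _ tphi; rewrite (wg' _ tphi) => /(mulfI _) ->; first by rewrite subrr.
  by rewrite signr_eq0.
by apply: aeS => x h /h /eqP; rewrite subr_eq0 => /eqP.
Qed.

Lemma weak_deriv_primitive a b c g : a <= b -> L1 a b g ->
  weak_deriv a b 1 (fun x => c + prim a g x) g.
Proof.
move=> ab Lg phi tphi; have [pa pb] := test_function_bd tphi.
have cd := test_function_cont 1 tphi.
under eq_Rintegral do rewrite mulrDl.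
rewrite RintegralD//; last 2 first.
- exact: (L1_mul_cont cd (L1_cst a b c)).
- by apply: L1_mul_cont => //; apply: L2_L1; exact: prim_L2.
rewrite RintegralZl//; last exact: continuous_L1.
have dP x := test_function_deriv x tphi.
rewrite (int_derive ab cd dP) (prim_weak ab Lg cd dP) pa pb.
by rewrite subrr mulr0 mul0r add0r sub0r expr1 mulN1r.
Qed.

Lemma weak_deriv_ext a b k f f' g g' :
  measurable_fun `]a, b[ f -> measurable_fun `]a, b[ f' ->
  measurable_fun `]a, b[ g -> measurable_fun `]a, b[ g' ->
  ae (fun x => x \in `]a, b[ -> f x = f' x) ->
  ae (fun x => x \in `]a, b[ -> g x = g' x) ->
  weak_deriv a b k f g -> weak_deriv a b k f' g'.
Proof.
move=> mf mf' mg mg' ff gg h phi tphi.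
have mphi n : measurable_fun `]a, b[ (derive1n n phi).
  apply: measurable_funTS; apply: continuous_measurable_fun.
  exact: (test_function_cont n tphi).
have -> : \int[leb]_(x in `]a, b[) (f' x * derive1n k phi x) =
    \int[leb]_(x in `]a, b[) (f x * derive1n k phi x).
  apply: eq_int_ae; [exact: measurable_funM|exact: measurable_funM|].
  by apply: aeS ff => x e /e ->.
rewrite (h _ tphi); congr (_ * _).
apply: eq_int_ae; [exact: (measurable_funM mg (mphi 0%N))|exact: (measurable_funM mg' (mphi 0%N))|].
by apply: aeS gg => x e /e ->.
Qed.

(** [k = f - prim a g] annihilates all derivatives of test functions. Subtracting from a test
    function its integral times a fixed [phi0] of integral 1 leaves such a derivative, so [k] equals
    its own integral against [phi0]. *)
Lemma du_bois_reymond a b f g : a < b -> L1 a b f -> L1 a b g -> weak_deriv a b 1 f g ->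
  exists c, ae (fun x => x \in `]a, b[ -> f x = c + prim a g x).
Proof.
move=> ab Lf Lg wfg; have wp := weak_deriv_primitive 0 (ltW ab) Lg.
pose k x := f x - prim a g x.
have Lprim : L1 a b (prim a g) by apply: L2_L1; apply: prim_L2 => //; exact: ltW.
have Lk : L1 a b k by exact: L1B.
have k0 psi : test_function a b psi -> \int[leb]_(x in `]a, b[) (k x * derive1n 1 psi x) = 0.
  move=> tpsi; have cd := test_function_cont 1 tpsi.
  rewrite /k; under eq_Rintegral do rewrite mulrBl.
  rewrite RintegralB//; [|exact: L1_mul_cont|exact: L1_mul_cont].
  rewrite (wfg _ tpsi) -(wp _ tpsi).
  by under [in X in X - _]eq_Rintegral do rewrite add0r; rewrite subrr.
have [C C0 molC] := @mollifier_ex R.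
(* This width places the support of [phi0] in [[b - 2h, b - h]], inside the open interval. *)
pose h := (b - a) / 4; have h0 : 0 < h by rewrite divr_gt0// subr_gt0.
have [eta [H m]] := molC h h0.
pose t := b - h; pose phi0 s := eta (t - s).
have t0 : test_function a b phi0.
  split.
    have [s _] := smooth_affine (-1) t (mol_smooth m).
    by rewrite /phi0; under eq_fun do rewrite addrC -mulN1r.
  exists (t - h), t; split.
  - by rewrite /t /h; lra.
  - by rewrite /t ltrBlDr ltrDl.
  move=> x; rewrite in_itv/= negb_and -!ltNge => /orP[xt|xt].
    by rewrite /phi0 (mol_right m)// lerBrDr -lerBrDl ltW// -ltrBrDr.
  by rewrite /phi0 (mol_left m)// subr_le0 ltW.
have i0 : \int[leb]_(x in `]a, b[) phi0 x = 1.
  by apply: (mollifier_int m); rewrite /t /h; lra.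
have cphi0 : continuous phi0 := test_function_cont 0 t0.
pose c := \int[leb]_(x in `]a, b[) (k x * phi0 x); exists c.
have : ae (fun x => x \in `]a, b[ -> k x - c = 0).
  apply: (@fundamental_lemma _ a b (fun x => k x - c)).
    by apply: L1B => //; exact: (L1_cst a b c).
  move=> phi tphi; have cphi : continuous phi := test_function_cont 0 tphi.
  pose ip := \int[leb]_(x in `]a, b[) phi x.
  pose dpsi x := phi x - ip * phi0 x.
  have sdpsi : smooth dpsi by apply: smoothB; [case: tphi|apply: smoothZ; case: t0].
  have cdpsi : continuous dpsi := @smooth_continuous _ _ 0%N sdpsi.
  have [_ [c1 [d1 [ac1 d1b h1]]]] := tphi; have [_ [c2 [d2 [ac2 d2b h2]]]] := t0.
  have dpsi_out x : x < Num.min c1 c2 \/ Num.max d1 d2 < x -> dpsi x = 0.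
    rewrite /dpsi lt_min gt_max => -[/andP[x1 x2]|/andP[x1 x2]].
      by rewrite h1 ?h2 ?mulr0 ?subrr// in_itv/= negb_and -!ltNge ?x1 ?x2.
    by rewrite h1 ?h2 ?mulr0 ?subrr// in_itv/= negb_and -!ltNge ?x1 ?x2 orbT.
  (* The primitive of [dpsi] vanishes to the left of both supports, and also to their right because
     [dpsi] has integral 0. The midpoints leave room for a compact support strictly inside. *)
  pose c0 := (a + Num.min c1 c2) / 2; pose d0 := (b + Num.max d1 d2) / 2.
  have ac12 : a < Num.min c1 c2 by rewrite lt_min ac1.
  have bd12 : Num.max d1 d2 < b by rewrite gt_max d1b.
  have [psi dpsiP psi0] : exists2 F : R -> R,
      forall x, is_derive x 1 F (dpsi x) & forall x, x <= c0 -> F x = 0.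
    apply: antiderivative_ex => // x xc; apply: dpsi_out; left.
    by apply: le_lt_trans xc _; rewrite /c0; lra.
  have psib : psi b = 0.
    have := int_derive (ltW ab) cdpsi dpsiP.
    rewrite (psi0 a); last by rewrite /c0; lra.
    rewrite subr0 => <-; rewrite /dpsi RintegralB//; try exact: continuous_L1.
      by rewrite RintegralZl ?i0 ?mulr1 ?subrr//; exact: continuous_L1.
    by apply: L1Z; exact: continuous_L1.
  have psi_r x : d0 <= x -> psi x = 0.
    move=> dx; rewrite -psib.
    have cst y z : d0 <= y -> y <= z -> psi y = psi z.
      move=> dy; apply: is_derive0_const => w; rewrite in_itv/= => /andP[yw _].
      rewrite -(dpsi_out w); first exact: dpsiP.
      by right; apply: lt_le_trans (le_trans dy yw); rewrite /d0; lra.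
    have [xb|/ltW bx] := leP x b; first exact: cst.
    by apply/esym/cst => //; rewrite /d0; lra.
  have tpsi : test_function a b psi.
    split; first exact: smooth_primitive sdpsi dpsiP.
    exists c0, d0; split; [by rewrite /c0; lra|by rewrite /d0; lra|].
    move=> x; rewrite in_itv/= negb_and -!ltNge => /orP[/ltW|/ltW]; [exact: psi0|exact: psi_r].
  have := k0 _ tpsi.
  have -> : derive1n 1 psi = dpsi.
    apply/funext => x; rewrite derive1n1 derive1E.
    exact: (@derive_val _ _ _ _ _ _ _ (dpsiP x)).
  rewrite /dpsi; under eq_Rintegral do rewrite mulrBr mulrCA.
  rewrite RintegralB ?RintegralZl//; try exact: L1_mul_cont; last first.
    by apply: L1Z; exact: L1_mul_cont.
  move=> /eqP; rewrite subr_eq0 => /eqP e.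
  under eq_Rintegral do rewrite mulrBl.
  rewrite RintegralB ?RintegralZl//; try exact: continuous_L1; try exact: L1_mul_cont; last first.
    exact: (L1_mul_cont cphi (L1_cst a b c)).
  by rewrite e mulrC subrr.
by apply: aeS => x hx /hx /eqP; rewrite subr_eq0 /k => /eqP <-; rewrite subrK.
Qed.

(** A continuous representative vanishing at [a] forces [f] to be [prim a g] without additive
    constant, so the weight [phi] has to vanish at [b] only. This is how the zero initial conditions
    enter. *)
Lemma weak_deriv_initial a b f g w phi dphi : a < b -> L1 a b f -> L1 a b g ->
  weak_deriv a b 1 f g -> {within `[a, b], continuous w} ->
  ae (fun x => x \in `]a, b[ -> w x = f x) -> w a = 0 ->
  continuous dphi -> (forall x, is_derive x 1 phi (dphi x)) -> phi b = 0 ->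
  \int[leb]_(x in `]a, b[) (f x * dphi x) = - \int[leb]_(x in `]a, b[) (g x * phi x).
Proof.
move=> ab Lf Lg wfg cw wf w0 cd dP pb; have [c fc] := du_bois_reymond ab Lf Lg wfg.
have cp := prim_continuous (ltW ab) Lg.
have wE : forall x, x \in `[a, b] -> w x = c + prim a g x.
  apply: within_continuous_ae_eq => //.
    by move=> z; apply: cvgD; [exact: cvg_cst|exact: cp].
  by apply: aeS2 wf fc => x h1 h2 xab; rewrite h1// h2.
have c0 : c = 0.
  by have := wE a; rewrite w0 prim_left addr0 => -> //; rewrite in_itv/= lexx ltW.
have mdphi : measurable_fun `]a, b[ dphi.
  by apply: measurable_funTS; exact: continuous_measurable_fun.
have -> : \int[leb]_(x in `]a, b[) (f x * dphi x) = \int[leb]_(x in `]a, b[) (prim a g x * dphi x).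
  apply: eq_int_ae.
  - by apply: measurable_funM => //; exact: L1_measurable.
  - by apply: measurable_funM => //; exact: within_continuous_measurable.
  - by apply: aeS fc => x h /h ->; rewrite c0 add0r.
by rewrite (prim_weak (ltW ab) Lg cd dP) pb mul0r sub0r.
Qed.

End Primitives.

Arguments test_function_cont {R a b} [phi] n%_N _.

Section PrimitiveOperators.
Context {R : realType}.
Local Notation leb := (@lebesgue_measure R).
Variables (a b : R).
Hypothesis ab : a < b.
Implicit Types (f g z v : R -> R) (c d x : R).
Let leab : a <= b := ltW ab.

Lemma L1_left g x : L1 a b g -> x \in `[a, b] -> L1 a x g.
Proof. by move=> Lg; rewrite in_itv/= => /andP[ax xb]; exact: L1_sub (lexx a) xb Lg. Qed.

Lemma prim_ae f g x : L1 a b f -> L1 a b g -> x \in `[a, b] ->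
  ae (fun y => y \in `]a, b[ -> f y = g y) -> prim a f x = prim a g x.
Proof.
move=> Lf Lg xab fg; apply: eq_int_ae; [exact: L1_measurable (L1_left Lf xab)|exact: L1_measurable
  (L1_left Lg xab)|].
apply: aeS fg => y h yax; apply: h; move: yax xab; rewrite !in_itv/=.
by move=> /andP[-> /lt_le_trans h] /andP[_ /h].
Qed.

Lemma prim_lin c d f g x : L1 a b f -> L1 a b g -> x \in `[a, b] ->
  prim a (fun y => c * f y + d * g y) x = c * prim a f x + d * prim a g x.
Proof.
move=> Lf Lg xab; have Lfx := L1_left Lf xab; have Lgx := L1_left Lg xab.
rewrite /prim RintegralD//; [|exact: L1Z|exact: L1Z].
by rewrite !RintegralZl.
Qed.

Lemma prim_le_L2 z x : L2 a b z -> x \in `[a, b] ->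
  `|prim a z x| <= Num.sqrt (b - a) * L2norm a b z.
Proof.
move=> Lz xab; apply: le_trans (prim_bound (L2_L1 Lz) xab) _.
exact: norm_int_L2.
Qed.

Lemma prim_in_L2 z : L2 a b z -> L2 a b (prim a z).
Proof. by move=> /L2_L1; exact: prim_L2. Qed.

Lemma prim_L2norm z : L2 a b z -> L2norm a b (prim a z) <= (b - a) * L2norm a b z.
Proof.
move=> Lz; rewrite -[b - a]sqr_sqrtr ?subr_ge0// expr2 mulrAC.
apply: (L2norm_le_bounded leab _ (prim_in_L2 Lz)).
  by rewrite mulr_ge0 ?sqrtr_ge0 ?L2norm_ge0.
by apply: aeW => x xab; apply: prim_le_L2 => //; exact: subset_itv_oo_cc.
Qed.

Definition prim2 z := prim a (prim a z).

Lemma prim2_in_L2 z : L2 a b z -> L2 a b (prim2 z).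
Proof. by move=> Lz; apply: prim_in_L2; exact: prim_in_L2. Qed.

Lemma prim2_L2norm z : L2 a b z -> L2norm a b (prim2 z) <= (b - a) ^+ 2 * L2norm a b z.
Proof.
move=> Lz; apply: le_trans (prim_L2norm (prim_in_L2 Lz)) _.
by rewrite expr2 -mulrA ler_wpM2l ?subr_ge0// prim_L2norm.
Qed.

Lemma prim2_le_L2 z x : L2 a b z -> x \in `[a, b] ->
  `|prim2 z x| <= Num.sqrt (b - a) * (b - a) * L2norm a b z.
Proof.
move=> Lz xab; apply: le_trans (prim_le_L2 (prim_in_L2 Lz) xab) _.
by rewrite -mulrA ler_wpM2l ?sqrtr_ge0// prim_L2norm.
Qed.

Lemma prim2_lin c d f g x : L2 a b f -> L2 a b g -> x \in `[a, b] ->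
  prim2 (fun y => c * f y + d * g y) x = c * prim2 f x + d * prim2 g x.
Proof.
move=> Lf Lg xab; have Lpf := L2_L1 (prim_in_L2 Lf); have Lpg := L2_L1 (prim_in_L2 Lg).
rewrite /prim2 -prim_lin//; apply: prim_ae => //.
- apply/L2_L1/prim_in_L2; apply: L2D; exact: L2Z.
- by apply: L1D; exact: L1Z.
- apply: aeW => y yab; apply: prim_lin; [exact: L2_L1|exact: L2_L1|].
  exact: subset_itv_oo_cc.
Qed.

Lemma prim_cont z : L2 a b z -> {within `[a, b], continuous (prim a z)}.
Proof. by move=> /L2_L1; exact: prim_continuous. Qed.

(** [crep] is a choice; two continuous representatives agree almost everywhere, hence on the whole
    closed interval. *)
Lemma crep_eq f g : {within `[a, b], continuous g} ->
  ae (fun x => x \in `]a, b[ -> g x = f x) ->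
  forall x, x \in `[a, b] -> crep a b f x = g x.
Proof.
move=> cg gf; rewrite /crep.
have [ch hf] : [set g | {within `[a, b], continuous g} /\
    {ae leb, forall x, x \in `]a, b[ -> g x = f x}]
    (xget f [set g | {within `[a, b], continuous g} /\
    {ae leb, forall x, x \in `]a, b[ -> g x = f x}]).
  by apply: (@xgetPex _ f); exists g.
apply: within_continuous_ae_eq => //.
by apply: aeS2 gf hf => x h1 h2 xab; rewrite h1// h2.
Qed.

End PrimitiveOperators.

(** * The spaces H^2 and V^2 *)

Section SobolevSpaceH2.
Context {R : realType}.
Local Notation leb := (@lebesgue_measure R).
Variables (a b : R).
Hypothesis ab : a < b.
Implicit Types (f g z v : R -> R) (c d x : R).
Let leab : a <= b := ltW ab.

Definition lin2 c d f g : R -> R := fun x => c * f x + d * g x.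

Lemma subr_lin2 f g : f - g = lin2 1 (-1) f g.
Proof. by apply/funext => x; rewrite /lin2 mul1r mulN1r. Qed.

Lemma L2_lin2 c d f g : L2 a b f -> L2 a b g -> L2 a b (lin2 c d f g).
Proof. by move=> Lf Lg; apply: L2D; exact: L2Z. Qed.

Lemma weak_deriv_lin2 k c d f g f' g' :
  L1 a b f -> L1 a b g -> L1 a b f' -> L1 a b g' ->
  weak_deriv a b k f f' -> weak_deriv a b k g g' ->
  weak_deriv a b k (lin2 c d f g) (lin2 c d f' g').
Proof.
move=> Lf Lg Lf' Lg' wf wg phi tphi.
have key h h' psi : continuous psi -> L1 a b h -> L1 a b h' ->
    \int[leb]_(x in `]a, b[) (lin2 c d h h' x * psi x) =
    c * \int[leb]_(x in `]a, b[) (h x * psi x) + d * \int[leb]_(x in `]a, b[) (h' x * psi x).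
  move=> cpsi Lh Lh'; have L := L1_mul_cont cpsi Lh; have L' := L1_mul_cont cpsi Lh'.
  rewrite /lin2; under eq_Rintegral do rewrite mulrDl -!mulrA.
  by rewrite RintegralD ?RintegralZl//; exact: L1Z.
rewrite key//; last exact: test_function_cont k tphi.
rewrite [X in _ = _ * X]key//; last exact: test_function_cont 0 tphi.
by rewrite (wf _ tphi) (wg _ tphi) mulrDr mulrCA; congr (_ + _); rewrite mulrCA.
Qed.

Lemma wDP k f : (exists g, L2 a b g /\ weak_deriv a b k f g) ->
  L2 a b (wD a b k f) /\ weak_deriv a b k f (wD a b k f).
Proof. by move=> h; exact: (@xgetPex _ (cst 0) [set g | L2 a b g /\ weak_deriv a b k f g] h). Qed.

Lemma wD_eq k f g : L2 a b g -> weak_deriv a b k f g ->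
  ae (fun x => x \in `]a, b[ -> wD a b k f x = g x).
Proof.
move=> Lg wg; have [|Lw ww] := @wDP k f; first by exists g.
by apply: weak_deriv_unique ww wg; exact: L2_L1.
Qed.

Lemma H2P f : H2 a b f -> [/\ L2 a b f, L2 a b (wD a b 1 f), L2 a b (wD a b 2 f),
  weak_deriv a b 1 f (wD a b 1 f) & weak_deriv a b 2 f (wD a b 2 f)].
Proof. by move=> [Lf /wDP[L1f w1f] /wDP[L2f w2f]]. Qed.

Lemma test_function_derive phi : test_function a b phi -> test_function a b (derive1n 1 phi).
Proof.
move=> [sphi [c [d [ac db h]]]]; split; first exact: smooth_derive.
exists c, d; split => // x xcd; rewrite derive1n1 derive1E.
apply: (@derive_val _ _ _ _ _ _ _ _); apply: is_derive_near0.
move: xcd; rewrite in_itv/= negb_and -!ltNge => /orP[xc|dx].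
  near=> y; apply: h; rewrite in_itv/= negb_and -!ltNge; apply/orP; left.
  by near: y; exact: lt_nbhsl.
near=> y; apply: h; rewrite in_itv/= negb_and -!ltNge; apply/orP; right.
by near: y; exact: lt_nbhsr.
Unshelve. all: by end_near. Qed.

Lemma weak_deriv2 f f1 f2 : weak_deriv a b 1 f f1 -> weak_deriv a b 1 f1 f2 ->
  weak_deriv a b 2 f f2.
Proof.
move=> w1 w2 phi tphi; have td := test_function_derive tphi.
have := w1 _ td; rewrite (_ : derive1n 1 (derive1n 1 phi) = derive1n 2 phi)// => ->.
by rewrite (w2 _ tphi) !expr1 mulrA -expr2.
Qed.

(** [H2] provides the two derivatives of [f] independently of each other; testing with the
    derivative of [phi] shows that the second is the derivative of the first. *)
Lemma weak_deriv12 f f1 f2 : weak_deriv a b 1 f f1 -> weak_deriv a b 2 f f2 ->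
  weak_deriv a b 1 f1 f2.
Proof.
move=> w1 w2 phi tphi; have td := test_function_derive tphi.
have := w1 _ td; rewrite (_ : derive1n 1 (derive1n 1 phi) = derive1n 2 phi)//.
by rewrite (w2 _ tphi) sqrrN expr1n mul1r expr1 => ->; rewrite mulN1r mulN1r opprK.
Qed.

Lemma H2_repr f : H2 a b f -> exists c0 c1,
  ae (fun x => x \in `]a, b[ -> f x = c0 + prim a (wD a b 1 f) x) /\
  ae (fun x => x \in `]a, b[ -> wD a b 1 f x = c1 + prim a (wD a b 2 f) x).
Proof.
move=> /H2P[Lf L1f L2f w1 w2].
have [c0 h0] := du_bois_reymond ab (L2_L1 Lf) (L2_L1 L1f) w1.
have [c1 h1] := du_bois_reymond ab (L2_L1 L1f) (L2_L1 L2f) (weak_deriv12 w1 w2).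
by exists c0, c1.
Qed.

Lemma H2_lin2 c d f g : H2 a b f -> H2 a b g ->
  [/\ H2 a b (lin2 c d f g),
      ae (fun x => x \in `]a, b[ -> wD a b 1 (lin2 c d f g) x =
        lin2 c d (wD a b 1 f) (wD a b 1 g) x)
    & ae (fun x => x \in `]a, b[ -> wD a b 2 (lin2 c d f g) x =
        lin2 c d (wD a b 2 f) (wD a b 2 g) x)].
Proof.
move=> /H2P[Lf Lf1 Lf2 wf1 wf2] /H2P[Lg Lg1 Lg2 wg1 wg2].
have L := L2_lin2 c d Lf Lg; have L1' := L2_lin2 c d Lf1 Lg1; have L2' := L2_lin2 c d Lf2 Lg2.
have w1 := weak_deriv_lin2 c d (L2_L1 Lf) (L2_L1 Lg) (L2_L1 Lf1) (L2_L1 Lg1) wf1 wg1.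
have w2 := weak_deriv_lin2 c d (L2_L1 Lf) (L2_L1 Lg) (L2_L1 Lf2) (L2_L1 Lg2) wf2 wg2.
split; [|exact: wD_eq|exact: wD_eq].
by split => //; [exists (lin2 c d (wD a b 1 f) (wD a b 1 g))|exists (lin2 c d (wD a b 2 f) (wD a b
  2 g))].
Qed.

Lemma H2norm_ge0 f : 0 <= H2norm a b f.
Proof. exact: sqrtr_ge0. Qed.

Lemma H2norm_sqr f : H2norm a b f ^+ 2 =
  L2norm a b f ^+ 2 + L2norm a b (wD a b 1 f) ^+ 2 + L2norm a b (wD a b 2 f) ^+ 2.
Proof. by rewrite sqr_sqrtr// !addr_ge0 ?sqr_ge0. Qed.

Lemma H2norm_ge f : [/\ L2norm a b f <= H2norm a b f,
  L2norm a b (wD a b 1 f) <= H2norm a b f & L2norm a b (wD a b 2 f) <= H2norm a b f].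
Proof.
have h x : 0 <= x -> x ^+ 2 <= H2norm a b f ^+ 2 -> x <= H2norm a b f.
  by move=> x0; rewrite ler_pXn2r// nnegrE H2norm_ge0.
by split; apply: h; rewrite ?L2norm_ge0// H2norm_sqr;
  have := sqr_ge0 (L2norm a b f); have := sqr_ge0 (L2norm a b (wD a b 1 f));
  have := sqr_ge0 (L2norm a b (wD a b 2 f)); lra.
Qed.

Lemma H2norm_le f : H2norm a b f <=
  L2norm a b f + L2norm a b (wD a b 1 f) + L2norm a b (wD a b 2 f).
Proof.
rewrite -(@ler_pXn2r _ 2)// ?nnegrE ?H2norm_ge0 ?addr_ge0 ?L2norm_ge0//.
rewrite H2norm_sqr.
have := L2norm_ge0 a b f; have := L2norm_ge0 a b (wD a b 1 f).
have := L2norm_ge0 a b (wD a b 2 f).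
set x := L2norm _ _ _; set y := L2norm _ _ _; set w := L2norm _ _ _ => w0 y0 x0.
have := mulr_ge0 x0 y0; have := mulr_ge0 x0 w0; have := mulr_ge0 y0 w0; nra.
Qed.

Lemma parallelogram_L2 f g : L2 a b f -> L2 a b g ->
  L2norm a b (lin2 2^-1 (- 2^-1) f g) ^+ 2 + L2norm a b (lin2 2^-1 2^-1 f g) ^+ 2 =
  2^-1 * (L2norm a b f ^+ 2 + L2norm a b g ^+ 2).
Proof.
move=> Lf Lg; rewrite !L2norm_sqr /lin2.
have Z c h : L2 a b h -> L2 a b (fun x => c * h x) := @L2Z _ a b c h.
have D c d : ip a b (fun x => c * f x + d * g x) (fun x => c * f x + d * g x) =
    c ^+ 2 * ip a b f f + 2 * c * d * ip a b f g + d ^+ 2 * ip a b g g.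
  rewrite ipDl ?ipZl//; try by [exact: Z|apply: L2D; exact: Z].
  rewrite ![ip a b _ (fun x => _ + _)]ip_sym !ipDl ?ipZl//; try exact: Z.
  by rewrite [ip a b g f]ip_sym; ring.
by rewrite !D; field.
Qed.

Lemma parallelogram_H2 f g : H2 a b f -> H2 a b g ->
  H2norm a b (lin2 2^-1 (- 2^-1) f g) ^+ 2 + H2norm a b (lin2 2^-1 2^-1 f g) ^+ 2 =
  2^-1 * (H2norm a b f ^+ 2 + H2norm a b g ^+ 2).
Proof.
move=> Hf Hg; have [Hm m1 m2] := H2_lin2 2^-1 (- 2^-1) Hf Hg.
have [Hp p1 p2] := H2_lin2 2^-1 2^-1 Hf Hg.
have [Lf Lf1 Lf2 _ _] := H2P Hf; have [Lg Lg1 Lg2 _ _] := H2P Hg.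
have [_ Lm1 Lm2 _ _] := H2P Hm; have [_ Lp1 Lp2 _ _] := H2P Hp.
rewrite !H2norm_sqr.
have -> := L2norm_ae Lm1 (L2_lin2 2^-1 (- 2^-1) Lf1 Lg1) m1.
have -> := L2norm_ae Lm2 (L2_lin2 2^-1 (- 2^-1) Lf2 Lg2) m2.
have -> := L2norm_ae Lp1 (L2_lin2 2^-1 2^-1 Lf1 Lg1) p1.
have -> := L2norm_ae Lp2 (L2_lin2 2^-1 2^-1 Lf2 Lg2) p2.
have := parallelogram_L2 Lf Lg; have := parallelogram_L2 Lf1 Lg1.
have := parallelogram_L2 Lf2 Lg2; lra.
Qed.

(** Minkowski's inequality for the triples of L^2 norms of a function and its two derivatives; the
    cross terms are compared by the Cauchy-Schwarz inequality in R^3. *)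
Lemma H2norm_lin2 c d f g : H2 a b f -> H2 a b g ->
  H2norm a b (lin2 c d f g) <= `|c| * H2norm a b f + `|d| * H2norm a b g.
Proof.
move=> Hf Hg; have [Hm m1 m2] := H2_lin2 c d Hf Hg.
have [Lf Lf1 Lf2 _ _] := H2P Hf; have [Lg Lg1 Lg2 _ _] := H2P Hg.
have [_ Lm1 Lm2 _ _] := H2P Hm.
have N0 := H2norm_ge0; have n0 := L2norm_ge0 a b.
have key h h' : L2 a b h -> L2 a b h' ->
    L2norm a b (lin2 c d h h') <= `|c| * L2norm a b h + `|d| * L2norm a b h'.
  move=> Lh Lh'; apply: le_trans (L2normD (L2Z c Lh) (L2Z d Lh')) _.
  by rewrite !L2normZ.
rewrite -(@ler_pXn2r _ 2)// ?nnegrE ?addr_ge0 ?mulr_ge0//.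
rewrite H2norm_sqr.
have -> := L2norm_ae Lm1 (L2_lin2 c d Lf1 Lg1) m1.
have -> := L2norm_ae Lm2 (L2_lin2 c d Lf2 Lg2) m2.
have k0 := key _ _ Lf Lg; have k1 := key _ _ Lf1 Lg1; have k2 := key _ _ Lf2 Lg2.
have sq (x y : R) : 0 <= x -> x <= y -> x ^+ 2 <= y ^+ 2.
  by move=> x0 xy; rewrite lerXn2r ?nnegrE// (le_trans x0).
have {}k0 := sq _ _ (n0 _) k0; have {}k1 := sq _ _ (n0 _) k1; have {}k2 := sq _ _ (n0 _) k2.
apply: le_trans (lerD (lerD k0 k1) k2) _.
rewrite !sqrrD !exprMn !H2norm_sqr.
suff : L2norm a b f * L2norm a b g + L2norm a b (wD a b 1 f) * L2norm a b (wD a b 1 g) +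
    L2norm a b (wD a b 2 f) * L2norm a b (wD a b 2 g) <= H2norm a b f * H2norm a b g.
  move=> h; have := ler_wpM2l (mulr_ge0 (normr_ge0 c) (normr_ge0 d)) h.
  set u := `|c|; set w := `|d| => {}h.
  by rewrite -subr_ge0 in h; rewrite -subr_ge0; nra.
rewrite -(@ler_pXn2r _ 2)// ?nnegrE ?addr_ge0 ?mulr_ge0// exprMn !H2norm_sqr.
set x0 := L2norm _ _ f; set x1 := L2norm _ _ (wD _ _ 1 f); set x2 := L2norm _ _ (wD _ _ 2 f).
set y0 := L2norm _ _ g; set y1 := L2norm _ _ (wD _ _ 1 g); set y2 := L2norm _ _ (wD _ _ 2 g).
rewrite -subr_ge0.
(* Lagrange's identity. *)
have -> : (x0 ^+ 2 + x1 ^+ 2 + x2 ^+ 2) * (y0 ^+ 2 + y1 ^+ 2 + y2 ^+ 2) -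
   (x0 * y0 + x1 * y1 + x2 * y2) ^+ 2 =
   (x0 * y1 - x1 * y0) ^+ 2 + (x0 * y2 - x2 * y0) ^+ 2 + (x1 * y2 - x2 * y1) ^+ 2 by ring.
by rewrite !addr_ge0 ?sqr_ge0.
Qed.

Lemma H2_0 : H2 a b 0.
Proof.
have L0 : L2 a b 0 by exact: (L2_cst a b 0).
have w0 k : weak_deriv a b k 0 0.
  move=> phi _; rewrite !(@eq_Rintegral _ _ _ _ _ (cst 0)) ?mulr0//;
    try by move=> x _; rewrite /= mul0r.
  by rewrite Rintegral_cst// mul0r mulr0.
by split => //; exists 0.
Qed.

Lemma H2_seminormed : seminormed (H2 a b) (H2norm a b).
Proof.
have HB f g : H2 a b f -> H2 a b g -> H2 a b (f - g).
  by move=> Hf Hg; rewrite subr_lin2; have [] := H2_lin2 1 (-1) Hf Hg.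
have tri f g : H2 a b f -> H2 a b g -> H2norm a b (f - g) <= H2norm a b f + H2norm a b g.
  move=> Hf Hg; rewrite subr_lin2; apply: le_trans (H2norm_lin2 _ _ Hf Hg) _.
  by rewrite normrN normr1 !mul1r.
split => //; first exact: H2_0.
  apply/eqP; rewrite eq_le H2norm_ge0 andbT.
  have -> : (0 : R -> R) = lin2 0 0 0 0 by apply/funext => x; rewrite /lin2 !mul0r addr0.
  by apply: le_trans (H2norm_lin2 _ _ H2_0 H2_0) _; rewrite normr0 !mul0r addr0.
by move=> f _; exact: H2norm_ge0.
Qed.

End SobolevSpaceH2.

Section CompletenessH2.
Context {R : realType}.
Local Notation leb := (@lebesgue_measure R).
Variables (a b : R).
Hypothesis ab : a < b.
Implicit Types (f g z v : R -> R) (c d x : R).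
Let leab : a <= b := ltW ab.

Lemma ip_cvg (fn : nat -> R -> R) f g : (forall n, L2 a b (fn n)) -> L2 a b f -> L2 a b g ->
  L2norm a b (fn n - f) @[n --> \oo] --> (0 : R) ->
  ip a b (fn n) g @[n --> \oo] --> ip a b f g.
Proof.
move=> Lfn Lf Lg cf; apply/cvgrPdist_le => e e0.
have g0 := L2norm_ge0 a b g.
have De : 0 < e / (L2norm a b g + 1) by rewrite divr_gt0// ltr_wpDl.
move/cvgr0Pnorm_le : cf => /(_ _ De); apply: filterS => n.
rewrite ger0_norm ?L2norm_ge0// => h; rewrite distrC -ipBl//.
apply: le_trans (cauchy_schwarz (L2B (Lfn n) Lf) Lg) _.
apply: le_trans (ler_wpM2r g0 h) _.
by rewrite mulrAC ler_pdivrMr ?ltr_wpDl// ler_wpM2l ?lerDl// ltW.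
Qed.

Lemma weak_deriv_cvg k (fn gn : nat -> R -> R) f g :
  (forall n, L2 a b (fn n)) -> L2 a b f -> (forall n, L2 a b (gn n)) -> L2 a b g ->
  L2norm a b (fn n - f) @[n --> \oo] --> (0 : R) ->
  L2norm a b (gn n - g) @[n --> \oo] --> (0 : R) ->
  (forall n, weak_deriv a b k (fn n) (gn n)) -> weak_deriv a b k f g.
Proof.
move=> Lfn Lf Lgn Lg cf cg w phi tphi.
have Lphi n : L2 a b (derive1n n phi).
  have cphi := test_function_cont n tphi.
  have [c _ hc] := continuous_bounded_itv a b cphi.
  apply: (@L2_bounded _ _ _ _ c).
    by apply: measurable_funTS; exact: continuous_measurable_fun.
  by move=> x xab; apply: hc; exact: subset_itv_oo_cc.
have cl := ip_cvg Lfn Lf (Lphi k) cf; have cr := ip_cvg Lgn Lg (Lphi 0%N) cg.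
apply: (cvg_unique _ cl) => //.
rewrite (_ : (fun n => _) = (fun n => (-1) ^+ k * ip a b (gn n) (derive1n 0 phi))).
  exact: cvgM (cvg_cst _) cr.
by apply/funext => n; exact: (w n _ tphi).
Qed.

Lemma cauchy_seq_le (V W : zmodType) (N : V -> R) (N' : W -> R) (f : nat -> V) (g : nat -> W) :
  (forall m n, N' (g m - g n) <= N (f m - f n)) -> cauchy_seq N f -> cauchy_seq N' g.
Proof.
move=> h c e e0; have [n0 hn] := c e e0; exists n0 => m n m0 n0'.
exact: le_trans (h _ _) (hn _ _ m0 n0').
Qed.

Lemma H2_dist_ge f g : H2 a b f -> H2 a b g ->
  [/\ L2norm a b (f - g) <= H2norm a b (f - g),
      L2norm a b (wD a b 1 f - wD a b 1 g) <= H2norm a b (f - g)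
    & L2norm a b (wD a b 2 f - wD a b 2 g) <= H2norm a b (f - g)].
Proof.
move=> Hf Hg; have [_ Lf1 Lf2 _ _] := H2P Hf; have [_ Lg1 Lg2 _ _] := H2P Hg.
have [h0 h1 h2] := H2norm_ge a b (f - g); split => //.
  apply: le_trans h1; rewrite (subr_lin2 f) subr_lin2.
  have [/H2P[_ L' _ _ _] e _] := H2_lin2 1 (-1) Hf Hg.
  by rewrite (L2norm_ae L' (L2_lin2 1 (-1) Lf1 Lg1) e).
apply: le_trans h2; rewrite (subr_lin2 f) subr_lin2.
have [/H2P[_ _ L' _ _] _ e] := H2_lin2 1 (-1) Hf Hg.
by rewrite (L2norm_ae L' (L2_lin2 1 (-1) Lf2 Lg2) e).
Qed.

Lemma H2_dist_le f g : H2 a b f -> H2 a b g -> H2norm a b (f - g) <=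
  L2norm a b (f - g) + L2norm a b (wD a b 1 f - wD a b 1 g) +
  L2norm a b (wD a b 2 f - wD a b 2 g).
Proof.
move=> Hf Hg; have [_ Lf1 Lf2 _ _] := H2P Hf; have [_ Lg1 Lg2 _ _] := H2P Hg.
apply: le_trans (H2norm_le _ _ _) _.
rewrite (subr_lin2 f) (subr_lin2 (wD a b 1 f)) (subr_lin2 (wD a b 2 f)).
have [/H2P[_ L1' L2' _ _] e1 e2] := H2_lin2 1 (-1) Hf Hg.
by rewrite (L2norm_ae L1' (L2_lin2 1 (-1) Lf1 Lg1) e1) (L2norm_ae L2' (L2_lin2 1 (-1) Lf2 Lg2) e2).
Qed.

Lemma L2norm_cvg_ae (fn : nat -> R -> R) f g : (forall n, L2 a b (fn n)) -> L2 a b f ->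
  L2 a b g -> ae (fun x => x \in `]a, b[ -> g x = f x) ->
  L2norm a b (fn n - f) @[n --> \oo] --> (0 : R) ->
  L2norm a b (fn n - g) @[n --> \oo] --> (0 : R).
Proof.
move=> Lfn Lf Lg gf; rewrite (_ : (fun n => L2norm a b (fn n - f)) = fun n => L2norm a b (fn n -
  g))//.
apply/funext => n; apply: L2norm_ae; [exact: L2B|exact: L2B|].
by apply: aeS gf => x h /h e /=; rewrite -[LHS]/(fn n x - f x) -e.
Qed.

Lemma H2_complete : complete_seminorm (H2 a b) (H2norm a b).
Proof.
move=> f Hf fC.
have Lf n := H2P (Hf n).
have [||g0 Lg0 c0] := @L2_complete R a b leab f.
- by move=> n; have [] := Lf n.
- by apply: cauchy_seq_le fC => m n; have [] := H2_dist_ge (Hf m) (Hf n).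
have [||g1 Lg1 c1] := @L2_complete R a b leab (fun n => wD a b 1 (f n)).
- by move=> n; have [] := Lf n.
- by apply: cauchy_seq_le fC => m n; have [] := H2_dist_ge (Hf m) (Hf n).
have [||g2 Lg2 c2] := @L2_complete R a b leab (fun n => wD a b 2 (f n)).
- by move=> n; have [] := Lf n.
- by apply: cauchy_seq_le fC => m n; have [] := H2_dist_ge (Hf m) (Hf n).
have w1 : weak_deriv a b 1 g0 g1.
  by apply: (weak_deriv_cvg _ _ _ _ c0 c1) => // n; have [] := Lf n.
have w2 : weak_deriv a b 2 g0 g2.
  by apply: (weak_deriv_cvg _ _ _ _ c0 c2) => // n; have [] := Lf n.
have Hg : H2 a b g0 by split => //; [exists g1|exists g2].
exists g0 => //; have [_ L1' L2' _ _] := H2P Hg.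
(* [wD] picks its own representative of the derivative of [g0], known to equal [g1] only almost
   everywhere. *)
have {}c1 : L2norm a b (wD a b 1 (f n) - wD a b 1 g0) @[n --> \oo] --> (0 : R).
  apply: L2norm_cvg_ae c1 => //; last exact: wD_eq.
  by move=> n; have [] := Lf n.
have {}c2 : L2norm a b (wD a b 2 (f n) - wD a b 2 g0) @[n --> \oo] --> (0 : R).
  apply: L2norm_cvg_ae c2 => //; last exact: wD_eq.
  by move=> n; have [] := Lf n.
apply: (@squeeze_cvgr _ _ _ _ (cst 0) (fun n => L2norm a b (f n - g0) +
    L2norm a b (wD a b 1 (f n) - wD a b 1 g0) + L2norm a b (wD a b 2 (f n) - wD a b 2 g0))).
- by apply: nearW => n; rewrite H2norm_ge0 H2_dist_le.
- exact: cvg_cst.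
- by have := cvgD (cvgD c0 c1) c2; rewrite !addr0; apply.
Qed.

(** A constant for the embedding of H^1(a, b) into the continuous functions: the first summand
    controls the value at [a], through the L^2 norm of a constant function, the second the increment
    from there. *)
Definition H1const := (1 + (b - a)) / Num.sqrt (b - a) + Num.sqrt (b - a).

Lemma H1const_ge0 : 0 <= H1const.
Proof. by rewrite addr_ge0 ?divr_ge0 ?sqrtr_ge0// addr_ge0// subr_ge0. Qed.

Lemma H1_bound f f1 c N : L2 a b f -> L2 a b f1 -> L2norm a b f <= N -> L2norm a b f1 <= N ->
  ae (fun x => x \in `]a, b[ -> f x = c + prim a f1 x) ->
  `|c| <= H1const * N /\ forall x, x \in `[a, b] -> `|c + prim a f1 x| <= H1const * N.
Proof.
move=> Lf Lf1 fN f1N fE; have s0 : 0 < Num.sqrt (b - a) by rewrite sqrtr_gt0 subr_gt0.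
have N0 : 0 <= N by apply: le_trans fN; exact: L2norm_ge0.
have cN : `|c| <= (1 + (b - a)) / Num.sqrt (b - a) * N.
  rewrite mulrAC ler_pdivlMr// -(L2norm_cst c leab).
  have Lp := prim_in_L2 ab Lf1.
  rewrite (@L2norm_ae _ a b _ (fun x => f x - prim a f1 x)); first last.
  - by apply: aeS fE => x h /h -> /=; rewrite addrK.
  - exact: L2B.
  - exact: L2_cst.
  apply: le_trans (L2normB Lf Lp) _; rewrite mulrDl mul1r lerD//.
  apply: le_trans (prim_L2norm ab Lf1) _; rewrite ler_wpM2l// subr_ge0//.
split.
  apply: le_trans cN _; rewrite ler_wpM2r// /H1const lerDl; exact: ltW.
move=> x xab; apply: le_trans (ler_normD _ _) _; rewrite /H1const mulrDl lerD//.
by apply: le_trans (prim_le_L2 ab Lf1 xab) _; rewrite ler_wpM2l// ltW.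
Qed.

(** H^2 embeds into W^{1,infty}, the derivative being represented by the continuous [f1]. The
    pointwise bounds on the loads and their derivatives come from here. *)
Lemma H2_bound f : H2 a b f -> exists c0 f1,
  [/\ {within `[a, b], continuous f1}, `|c0| <= H1const * H2norm a b f,
      forall x, x \in `[a, b] -> `|f1 x| <= H1const * H2norm a b f,
      forall x, x \in `[a, b] -> `|c0 + prim a f1 x| <= H1const * H2norm a b f
    & ae (fun x => x \in `]a, b[ -> f x = c0 + prim a f1 x)].
Proof.
move=> Hf; have [Lf Lf1 Lf2 _ _] := H2P Hf.
have [c0 [c1 [fE f1E]]] := H2_repr ab Hf.
have [N0 N1 N2] := H2norm_ge a b f.
have [c0N h0] := H1_bound Lf Lf1 N0 N1 fE; have [c1N h1] := H1_bound Lf1 Lf2 N1 N2 f1E.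
pose g x := c1 + prim a (wD a b 2 f) x.
have Lg : L2 a b g by apply: L2D; [exact: L2_cst|exact: prim_in_L2].
have gE x : x \in `[a, b] -> prim a (wD a b 1 f) x = prim a g x.
  by move=> xab; apply: (@prim_ae R a b) => //; exact: L2_L1.
exists c0, g; split => //.
- by move=> z; apply: cvgD; [exact: cvg_cst|exact: prim_cont].
- by move=> x xab; rewrite -gE// h0.
- by apply: aeS fE => x h xab; rewrite h// gE//; exact: subset_itv_oo_cc.
Qed.

End CompletenessH2.

Section SpaceV2.
Context {R : realType}.
Local Notation leb := (@lebesgue_measure R).
Variables (ell : R).
Hypothesis ell0 : 0 < ell.
Implicit Types (f g z v w : R -> R) (c d x : R).
Let leell : 0 <= ell := ltW ell0.
Let in0 : (0 : R) \in `[0, ell]. Proof. by rewrite in_itv/= lexx. Qed.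

Lemma V2_H2 v : V2 ell v -> H2 0 ell v.
Proof. by case. Qed.

(** The two vanishing traces at 0 remove the constants of integration. *)
Lemma V2_repr v : V2 ell v ->
  ae (fun x => x \in `]0, ell[ -> v x = prim2 0 (wD 0 ell 2 v) x) /\
  ae (fun x => x \in `]0, ell[ -> wD 0 ell 1 v x = prim 0 (wD 0 ell 2 v) x).
Proof.
move=> [Hv v0 v10]; have [c0 [c1 [vE v1E]]] := H2_repr ell0 Hv.
have [Lv Lv1 Lv2 _ _] := H2P Hv.
have cD c z : L2 0 ell z -> {within `[0, ell], continuous (fun x => c + prim 0 z x)}.
  by move=> Lz y; apply: cvgD; [exact: cvg_cst|exact: prim_cont].
have sym f g : ae (fun x => x \in `]0, ell[ -> f x = g x) -> ae (fun x => x \in `]0, ell[ -> g x =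
  f x).
  by apply: aeS => x h /h.
have c10 : c1 = 0.
  move: v10; rewrite (crep_eq ell0 (cD c1 _ Lv2) (sym _ _ v1E) in0).
  by rewrite prim_left addr0.
have c00 : c0 = 0.
  move: v0; rewrite (crep_eq ell0 (cD c0 _ Lv1) (sym _ _ vE) in0).
  by rewrite prim_left addr0.
have {}v1E : ae (fun x => x \in `]0, ell[ -> wD 0 ell 1 v x = prim 0 (wD 0 ell 2 v) x).
  by apply: aeS v1E => x h /h; rewrite c10 add0r.
split => //; apply: aeS vE => x h xl; rewrite h// c00 add0r /prim2.
apply: (@prim_ae R 0 ell) => //; first exact: L2_L1.
  exact: (L2_L1 (prim_in_L2 ell0 Lv2)).
exact: subset_itv_oo_cc.
Qed.

(** Converse of [V2_repr]; together they identify V^2 with L^2(0, ell) through the second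
    derivative. *)
Lemma V2_intro v z : L2 0 ell v -> L2 0 ell z ->
  ae (fun x => x \in `]0, ell[ -> v x = prim2 0 z x) ->
  [/\ V2 ell v, ae (fun x => x \in `]0, ell[ -> wD 0 ell 1 v x = prim 0 z x)
    & ae (fun x => x \in `]0, ell[ -> wD 0 ell 2 v x = z x)].
Proof.
move=> Lv Lz vE.
have Lp := prim_in_L2 ell0 Lz; have Lp2 := prim2_in_L2 ell0 Lz.
have sym f g : ae (fun x => x \in `]0, ell[ -> f x = g x) -> ae (fun x => x \in `]0, ell[ -> g x =
  f x).
  by apply: aeS => x h /h.
have prim_d y : L2 0 ell y -> weak_deriv 0 ell 1 (prim 0 y) y.
  move=> Ly; have := weak_deriv_primitive 0 leell (L2_L1 Ly).
  by under eq_fun do rewrite add0r.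
have w1 : weak_deriv 0 ell 1 v (prim 0 z).
  apply: weak_deriv_ext (prim_d _ Lp); try exact: L2_measurable.
    exact: sym.
  exact: aeW.
have w2 : weak_deriv 0 ell 2 v z by apply: weak_deriv2 w1 (prim_d _ Lz).
have e1 := wD_eq Lp w1; have e2 := wD_eq Lz w2.
split => //; split.
- by split => //; [exists (prim 0 z)|exists z].
- by rewrite (crep_eq ell0 (prim_cont ell0 Lp) (sym _ _ vE) in0) prim_left.
- by rewrite (crep_eq ell0 (prim_cont ell0 Lz) (sym _ _ e1) in0) prim_left.
Qed.

Lemma V2_prim2 z : L2 0 ell z -> V2 ell (prim2 0 z) /\
  ae (fun x => x \in `]0, ell[ -> wD 0 ell 2 (prim2 0 z) x = z x).
Proof.
by move=> Lz; have [] := V2_intro (prim2_in_L2 ell0 Lz) Lz; first exact: aeW.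
Qed.

Lemma V2_L2 v : V2 ell v -> L2 0 ell v /\ L2 0 ell (wD 0 ell 2 v).
Proof. by move=> [/H2P[]]. Qed.

Lemma V2_crep v x : V2 ell v -> x \in `[0, ell] ->
  crep 0 ell v x = prim2 0 (wD 0 ell 2 v) x /\
  crep 0 ell (wD 0 ell 1 v) x = prim 0 (wD 0 ell 2 v) x.
Proof.
move=> Vv xl; have [vE v1E] := V2_repr Vv; have [_ Lz] := V2_L2 Vv.
have Lp := prim_in_L2 ell0 Lz.
split; apply: (crep_eq ell0) => //; try exact: prim_cont.
  by apply: aeS vE => y h /h.
by apply: aeS v1E => y h /h.
Qed.

Lemma V2_lin2 c d v w : V2 ell v -> V2 ell w -> V2 ell (lin2 c d v w) /\
  ae (fun x => x \in `]0, ell[ ->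
    wD 0 ell 2 (lin2 c d v w) x = lin2 c d (wD 0 ell 2 v) (wD 0 ell 2 w) x).
Proof.
move=> Vv Vw; have [vE _] := V2_repr Vv; have [wE _] := V2_repr Vw.
have [Lv Lzv] := V2_L2 Vv; have [Lw Lzw] := V2_L2 Vw.
have [] := @V2_intro (lin2 c d v w) (lin2 c d (wD 0 ell 2 v) (wD 0 ell 2 w)).
- exact: L2_lin2.
- exact: L2_lin2.
- apply: aeS2 vE wE => x h1 h2 xl; rewrite /lin2 h1// h2//.
  by rewrite (prim2_lin ell0)//; exact: subset_itv_oo_cc.
- by [].
Qed.

Lemma V2_subr v w : V2 ell v -> V2 ell w -> V2 ell (v - w) /\
  ae (fun x => x \in `]0, ell[ -> wD 0 ell 2 (v - w) x = wD 0 ell 2 v x - wD 0 ell 2 w x).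
Proof.
move=> Vv Vw; rewrite subr_lin2; have [V e] := V2_lin2 1 (-1) Vv Vw; split => //.
by apply: aeS e => x h /h ->; rewrite /lin2 mul1r mulN1r.
Qed.

(** A Poincare constant: the summands bound the norms of v, v' and v'' by that of v''. *)
Definition V2const := ell ^+ 2 + ell + 1.

Lemma V2const_ge0 : 0 <= V2const.
Proof. by rewrite !addr_ge0// sqr_ge0. Qed.

Lemma V2norm_le v : V2 ell v -> H2norm 0 ell v <= V2const * L2norm 0 ell (wD 0 ell 2 v).
Proof.
move=> Vv; have [vE v1E] := V2_repr Vv; have [Lv Lz] := V2_L2 Vv.
have [_ L1' _ _ _] := H2P (V2_H2 Vv).
apply: le_trans (H2norm_le _ _ _) _.
have -> := L2norm_ae Lv (prim2_in_L2 ell0 Lz) vE.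
have -> := L2norm_ae L1' (prim_in_L2 ell0 Lz) v1E.
rewrite /V2const !mulrDl mul1r !lerD//.
  by have := prim2_L2norm ell0 Lz; rewrite subr0.
by have := prim_L2norm ell0 Lz; rewrite subr0.
Qed.

Lemma V2norm_ge v : L2norm 0 ell (wD 0 ell 2 v) <= H2norm 0 ell v.
Proof. by have [] := H2norm_ge 0 ell v. Qed.

Lemma V2_0 : V2 ell 0.
Proof.
have L0 : L2 0 ell 0 by exact: (L2_cst 0 ell 0).
have [] := @V2_intro 0 0 L0 L0 => //; apply: aeW => x xl.
have p0 y : prim 0 (0 : R -> R) y = 0 by rewrite /prim Rintegral_cst// mul0r.
by rewrite /prim2 (_ : prim 0 0 = 0) ?p0//; apply/funext => y; rewrite p0.
Qed.

Lemma V2_seminormed : seminormed (V2 ell) (H2norm 0 ell).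
Proof.
have S := H2_seminormed 0 ell; split.
- exact: V2_0.
- by move=> v w Vv Vw; have [] := V2_subr Vv Vw.
- exact: seminorm0 S.
- by move=> v _; exact: H2norm_ge0.
- by move=> v w /V2_H2 Hv /V2_H2 Hw; exact: (seminorm_leB S).
Qed.

(** Convergence of the second derivatives suffices, the limit being the double primitive of
    theirs. *)
Lemma V2_complete : complete_seminorm (V2 ell) (H2norm 0 ell).
Proof.
move=> v Vv vC.
have [||z Lz cz] := @L2_complete R 0 ell leell (fun n => wD 0 ell 2 (v n)).
- by move=> n; have [] := V2_L2 (Vv n).
- by apply: cauchy_seq_le vC => m n; have [] := H2_dist_ge (V2_H2 (Vv m)) (V2_H2 (Vv n)).
have [Vz zE] := V2_prim2 Lz; exists (prim2 0 z) => //.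
apply: (@squeeze_cvgr _ _ _ _ (cst 0) (fun n => V2const * L2norm 0 ell (wD 0 ell 2 (v n) - z))).
- apply: nearW => n; rewrite H2norm_ge0/=; have [Vd dE] := V2_subr (Vv n) Vz.
  apply: le_trans (V2norm_le Vd) _; rewrite ler_wpM2l ?V2const_ge0//.
  have [_ Ln] := V2_L2 (Vv n); have [_ Ld] := V2_L2 Vd.
  rewrite (L2norm_ae Ld (L2B Ln Lz))//.
  by apply: aeS2 dE zE => x h1 h2 xl; rewrite h1// h2.
- exact: cvg_cst.
- by rewrite -[X in _ --> X](mulr0 V2const); apply: cvgM cz; exact: cvg_cst.
Qed.

End SpaceV2.

(** * Strong measurability and the Bochner integral *)

Section SimpleFunctions.
Context {R : realType}.
Local Notation leb := (@lebesgue_measure R).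

Lemma simple_map2 (V1 V2 V3 : zmodType) (X1 : set V1) (X2 : set V2) (X3 : set V3)
    (h : V1 -> V2 -> V3) (s1 : R -> V1) (s2 : R -> V2) :
  (forall x y, X1 x -> X2 y -> X3 (h x y)) ->
  simple_fun X1 s1 -> simple_fun X2 s2 -> simple_fun X3 (fun t => h (s1 t) (s2 t)).
Proof.
move=> hX [f1 m1 X1s] [f2 m2 X2s]; split; last by move=> t; exact: hX.
  apply: (@sub_finite_set _ _ ((fun p => h p.1 p.2) @` (range s1 `*` range s2))).
    by move=> _ [t _ <-]; exists (s1 t, s2 t) => //; split; exists t.
  by apply: finite_image; exact: finite_setX.
move=> v.
rewrite (_ : _ @^-1` _ = \bigcup_(p in (range s1 `*` range s2) `&` [set p | h p.1 p.2 = v])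
   (s1 @^-1` [set p.1] `&` s2 @^-1` [set p.2])).
  apply: fin_bigcup_measurable.
    by apply: finite_setIl; exact: finite_setX.
  by move=> p _; apply: measurableI.
apply/seteqP; split=> [t /= <-|t [p [_ /= <-]] [/= -> ->]//].
by exists (s1 t, s2 t) => //; split => //; split; exists t.
Qed.

Lemma simple_indic (A : set R) : measurable A -> simple_fun setT (\1_A : R -> R).
Proof.
move=> mA; split => //.
by move=> v; rewrite -[X in measurable X]setTI; exact: measurable_indic.
Qed.

Lemma simple_restrict (V : zmodType) (X : set V) (A : set R) (s : R -> V) (x : V) :
  measurable A -> X x -> simple_fun X s ->
  simple_fun X (fun t => if t \in A then s t else x).
Proof.
move=> mA Xx ss.
have := @simple_map2 V R V X setT X (fun v (r : R) => if r == 1 then v else x) s (\1_A).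
rewrite (_ : (fun t => if t \in A then s t else x) =
  fun t => (fun v (r : R) => if r == 1 then v else x) (s t) (\1_A t)).
  apply => //; last exact: simple_indic.
  by move=> v r Xv _; case: ifP.
apply/funext => t; rewrite indicE; case: (_ \in _); first by rewrite eqxx.
by rewrite eq_sym oner_eq0.
Qed.

Lemma simple_measurable (s : R -> R) : simple_fun setT s -> measurable_fun setT s.
Proof.
move=> [fs ms _] _ B mB; rewrite setTI.
rewrite (_ : s @^-1` B = \bigcup_(v in range s `&` B) s @^-1` [set v]).
  by apply: fin_bigcup_measurable; [exact: finite_setIl|move=> v _; exact: ms].
apply/seteqP; split=> [t Bt|t [v [_ Bv] /= ->]//].
by exists (s t) => //; split => //; exists t.
Qed.

Lemma simple_seq (V : zmodType) (X : set V) (s : R -> V) : simple_fun X s ->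
  exists l : seq V, [/\ uniq l, forall x, x \in l -> X x & forall t, s t \in l].
Proof.
move=> [/finite_seqP[l lE] _ Xs]; exists (undup l); split; first exact: undup_uniq.
  by move=> x; rewrite mem_undup => xl; have : range s x by [rewrite lE]; move=> [t _ <-].
move=> t; rewrite mem_undup; have : range s (s t) by exists t.
by rewrite lE.
Qed.

End SimpleFunctions.

Section StrongMeasurability.
Context {R : realType}.
Local Notation leb := (@lebesgue_measure R).
Variable T : R.

Lemma sm_map2 (V1 V2 V3 : zmodType) (X1 : set V1) (X2 : set V2) (X3 : set V3)
    (N1 : V1 -> R) (N2 : V2 -> R) (N3 : V3 -> R) (h : V1 -> V2 -> V3) (C : R) u1 u2 :
  (forall x y, X1 x -> X2 y -> X3 (h x y)) ->
  (forall x y, X3 x -> X3 y -> 0 <= N3 (x - y)) ->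
  (forall x y x' y', X1 x -> X2 y -> X1 x' -> X2 y' ->
    N3 (h x y - h x' y') <= C * (N1 (x - x') + N2 (y - y'))) ->
  (forall t, t \in `]0, T[ -> X1 (u1 t)) -> (forall t, t \in `]0, T[ -> X2 (u2 t)) ->
  strongly_measurable T X1 N1 u1 -> strongly_measurable T X2 N2 u2 ->
  strongly_measurable T X3 N3 (fun t => h (u1 t) (u2 t)).
Proof.
move=> hX N30 hL Xu1 Xu2 [s1 ss1 cs1] [s2 ss2 cs2].
exists (fun n t => h (s1 n t) (s2 n t)); first by move=> n; apply: simple_map2 hX _ _.
move=> t tT; have X1n n : X1 (s1 n t) by have [_ _] := ss1 n; apply.
have X2n n : X2 (s2 n t) by have [_ _] := ss2 n; apply.
apply: (@squeeze_cvgr _ _ _ _ (cst 0) (fun n => C * (N1 (s1 n t - u1 t) + N2 (s2 n t - u2 t)))).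
- apply: nearW => n; rewrite N30 ?hL//; [exact: Xu1|exact: Xu2|exact: hX|].
  by apply: hX; [exact: Xu1|exact: Xu2].
- exact: cvg_cst.
- rewrite -[X in _ --> X](mulr0 C) -[X in _ --> C * X](addr0 0).
  by apply: cvgM; [exact: cvg_cst|apply: cvgD; [exact: cs1|exact: cs2]].
Qed.

Lemma sm_map1 (V1 V3 : zmodType) (X1 : set V1) (X3 : set V3)
    (N1 : V1 -> R) (N3 : V3 -> R) (h : V1 -> V3) (C : R) u1 :
  (forall x, X1 x -> X3 (h x)) ->
  (forall x y, X3 x -> X3 y -> 0 <= N3 (x - y)) ->
  (forall x x', X1 x -> X1 x' -> N3 (h x - h x') <= C * N1 (x - x')) ->
  (forall t, t \in `]0, T[ -> X1 (u1 t)) ->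
  strongly_measurable T X1 N1 u1 ->
  strongly_measurable T X3 N3 (fun t => h (u1 t)).
Proof.
move=> hX N30 hL Xu1 [s1 ss1 cs1].
exists (fun n t => h (s1 n t)).
  by move=> n; apply: (@simple_map2 R V1 V1 V3 X1 X1 X3 (fun x _ => h x) (s1 n) (s1 n)) => // x y
    Xx _; exact: hX.
move=> t tT; have X1n n : X1 (s1 n t) by have [_ _] := ss1 n; apply.
apply: (@squeeze_cvgr _ _ _ _ (cst 0) (fun n => C * N1 (s1 n t - u1 t))).
- apply: nearW => n; rewrite N30 ?hL//; [exact: Xu1|exact: hX|].
  by apply: hX; exact: Xu1.
- exact: cvg_cst.
- rewrite -[X in _ --> X](mulr0 C).
  by apply: cvgM; [exact: cvg_cst|exact: cs1].
Qed.

Lemma sm_measurable (f : R -> R) : strongly_measurable T setT (@Num.norm R R) f ->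
  measurable_fun `]0, T[ f.
Proof.
move=> [s ss cs]; apply: (@measurable_fun_cvg _ _ _ _ (fun n => s n)).
  by move=> n; apply: measurable_funTS; exact: simple_measurable.
move=> t tT; have /cvgr0Pnorm_le h := cs t tT.
by apply/cvgrPdist_le => e /h; apply: filterS => n; rewrite normr_id distrC.
Qed.

Import HBSimple.

Lemma measurable_sm (f : R -> R) : L1 0 T f -> strongly_measurable T setT (@Num.norm R R) f.
Proof.
move=> Lf; have [g_ [_ cg _]] := @approximation_sfun_integrable _ _ _ leb `]0, T[%classic
  (measurable_itv _) (EFin \o f) Lf.
exists (fun n => g_ n).
  move=> n; split => //; first exact: (fimfunP (g_ n)).
  by move=> v; rewrite -[X in measurable X]setTI; apply: (measurable_funPT (g_ n)).
move=> t tT; have /fine_cvgP[_ h] := cg t tT.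
have h' : g_ n t - f t @[n --> \oo] --> (0 : R).
  by rewrite -(subrr (f t)); apply: cvgB; [exact: h|exact: cvg_cst].
apply/cvgr0Pnorm_le => e e0; move/cvgr0Pnorm_le : h' => /(_ e e0).
by apply: filterS => n; rewrite normr_id.
Qed.

Section VectorValuedFunctions.
Variables (V : zmodType) (X : set V) (N : V -> R).
Hypothesis XN : seminormed X N.
Implicit Types (u : R -> V).

Definition valued_in u := forall t, t \in `]0, T[ -> X (u t).

Lemma sm_norm_measurable u v : valued_in u -> X v -> strongly_measurable T X N u ->
  measurable_fun `]0, T[ (fun t => N (u t - v)).
Proof.
move=> Xu Xv su; apply: sm_measurable.
apply: (@sm_map1 V R X setT N (@Num.norm R R) (fun x => N (x - v)) 1) su => //.
move=> x y Xx Xy; rewrite mul1r.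
have Bx : X (x - v) by exact: (seminormedB XN).
have By : X (y - v) by exact: (seminormedB XN).
by have := ler_seminorm XN Bx By; rewrite opprB addrA subrK.
Qed.

Lemma sm_norm u : valued_in u -> strongly_measurable T X N u ->
  measurable_fun `]0, T[ (fun t => N (u t)).
Proof.
move=> Xu su; have := sm_norm_measurable Xu (seminormed0 XN) su.
rewrite (_ : (fun t => N (u t - 0)) = fun t => N (u t))//.
by apply/funext => t; rewrite subr0.
Qed.

(** The points are the values of the approximating simple functions, enumerated through pairs of a
    stage and a position in its finite list of values. One half of a Pettis criterion, [sm_of_dense]
    being the other. *)
Lemma sm_dense u : valued_in u -> strongly_measurable T X N u -> exists v : nat -> V,
  (forall k, X (v k)) /\
  forall t, t \in `]0, T[ -> forall e, 0 < e -> exists k, N (u t - v k) <= e.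
Proof.
move=> Xu [s ss cs].
have h n : {l : seq V | (forall x, x \in l -> X x) /\ forall t, s n t \in l}.
  apply: cid; have [fs _ Xs] := ss n; have [l lE] := (finite_seqP _).1 fs.
  exists l; split=> [x xl|t]; last by have : range (s n) (s n t) by [exists t]; rewrite lE.
  by have : range (s n) x by [rewrite lE]; move=> [t _ <-].
pose v k := if @unpickle (nat * nat)%type k is Some p then nth 0 (sval (h p.1)) p.2 else 0.
exists v; split.
  move=> k; rewrite /v; case: unpickle => [[n j]|]; last exact: (seminormed0 XN).
  have [hX _] := svalP (h n); rewrite /=.
  have [jl|lj] := ltnP j (size (sval (h n))); first by apply: hX; exact: mem_nth.
  by rewrite nth_default//; exact: (seminormed0 XN).
move=> t tT e e0; have /cvgr0Pnorm_le/(_ e e0)[n _ /(_ n (leqnn n)) hn] := cs t tT.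
have [_ /(_ t) ht] := svalP (h n).
exists (pickle (n, index (s n t) (sval (h n)))).
rewrite /v pickleK /= nth_index//.
have Xs : X (s n t) by have [_ _] := ss n; apply.
rewrite (seminorm_distC XN)//; last exact: Xu.
exact: le_trans (ler_norm _) hn.
Qed.

(* The [n]-th simple function picks the best of the first [n] points of [v]. *)
Lemma sm_of_dense u (v : nat -> V) : valued_in u -> (forall k, X (v k)) ->
  (forall k, measurable_fun `]0, T[ (fun t => N (u t - v k))) ->
  (forall t, t \in `]0, T[ -> forall e, 0 < e -> exists k, N (u t - v k) <= e) ->
  strongly_measurable T X N u.
Proof.
move=> Xu Xv mv dv; pose D : set R := `]0, T[%classic.
pose fD k t := ((fun t => N (u t - v k)) \_ D) t.
have mfD k : measurable_fun setT (fD k).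
  by apply/(measurable_restrictT _ (measurable_itv _)); exact: mv.
pose idx := fix idx n t := if n is n'.+1 then
  (if fD n t < fD (idx n' t) t then n else idx n' t) else 0%N.
have idx_le n t : (idx n t <= n)%N.
  by elim: n => //= n IH; case: ifP => // _; exact: leqW.
have fidxS n t : fD (idx n.+1 t) t = Num.min (fD n.+1 t) (fD (idx n t) t).
  by rewrite /=; case: ltP.
have midx n : measurable_fun setT (fun t => fD (idx n t) t).
  elim: n => [|n IH]; first exact: mfD.
  by under eq_fun do rewrite fidxS; exact: measurable_minr.
have midxk n k : measurable [set t | idx n t = k].
  elim: n k => [|n IH] k.
    case: k => [|k]; first by rewrite (_ : [set _ | _] = setT)//; apply/seteqP; split.
    by rewrite (_ : [set _ | _] = set0)//; apply/seteqP; split.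
  have mlt : measurable [set t | fD n.+1 t < fD (idx n t) t].
    have := measurable_fun_ltr (mfD n.+1) (midx n).
    by move=> /(_ measurableT [set true]); rewrite setTI; apply.
  have [->|kn] := eqVneq k n.+1.
    rewrite (_ : [set t | _] = [set t | fD n.+1 t < fD (idx n t) t])//.
    apply/seteqP; split => t /=; case: ifP => // _ e.
    by have := idx_le n t; rewrite e ltnn.
  rewrite (_ : [set t | _] = [set t | idx n t = k] `&` ~` [set t | fD n.+1 t < fD (idx n t) t]).
    by apply: measurableI => //; exact: measurableC.
  apply/seteqP; split => t /=.
    by case: ifP => [_ /esym/eqP|/negbT nlt ->]; [rewrite (negbTE kn)|split => //; exact/negP].
  by move=> [ek /negP nlt]; rewrite (negbTE nlt).
exists (fun n t => v (idx n t)).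
  move=> n; split => //.
    apply: (@sub_finite_set _ _ (v @` `I_n.+1)); last exact: finite_image.
    by move=> _ [t _ <-]; exists (idx n t) => //=; rewrite ltnS.
  move=> w; rewrite (_ : _ @^-1` _ = \bigcup_(k in `I_n.+1 `&` [set k | v k = w]) [set t | idx n t
    = k]).
    by apply: fin_bigcup_measurable => //; exact: finite_setIl.
  apply/seteqP; split=> [t /= e|t [k [_ /= <-]] /= ->//].
  by exists (idx n t) => //; split => //=; rewrite ltnS.
move=> t tT; have fDE k : fD k t = N (u t - v k) by rewrite /fD /patch mem_set.
apply/cvgr0Pnorm_le => e e0; have [k hk] := dv t tT e e0.
exists k => // n /= kn.
have Xut := Xu t tT.
rewrite (seminorm_distC XN)// ger0_norm; last exact/(seminorm_ge0 XN)/(seminormedB XN).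
rewrite -fDE; apply: le_trans hk; rewrite -fDE.
elim: n kn => [|n IH]; first by rewrite leqn0 => /eqP ->.
rewrite leq_eqVlt fidxS ge_min => /predU1P[->|]; first by rewrite lexx.
by rewrite ltnS => /IH ->; rewrite orbT.
Qed.

(** Both parts of the criterion survive pointwise limits: the dense sequences of all [un n] are
    pooled into one, and the distance of [u] to a fixed point is a limit of measurable functions. *)
Lemma sm_limit (un : nat -> R -> V) u : (forall n, valued_in (un n)) -> valued_in u ->
  (forall n, strongly_measurable T X N (un n)) ->
  (forall t, t \in `]0, T[ -> N (un n t - u t) @[n --> \oo] --> (0 : R)) ->
  strongly_measurable T X N u.
Proof.
move=> Xun Xu sun cu.
have h n : {v : nat -> V | (forall k, X (v k)) /\
    forall t, t \in `]0, T[ -> forall e, 0 < e -> exists k, N (un n t - v k) <= e}.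
  by apply: cid; exact: sm_dense.
pose v k := if @unpickle (nat * nat)%type k is Some p then sval (h p.1) p.2 else 0.
have Xv k : X (v k).
  rewrite /v; case: unpickle => [[n j]|]; last exact: (seminormed0 XN).
  by have [] := svalP (h n).
apply: (@sm_of_dense u v) => //.
  move=> k; apply: (@measurable_fun_cvg _ _ _ _ (fun n t => N (un n t - v k))).
    by move=> n; exact: sm_norm_measurable.
  move=> t tT; apply: (seminorm_cvg_shift XN (fun n => Xun n t tT)) => //; first exact: Xu.
  exact: cu.
move=> t tT e e0; have e20 : 0 < e / 2 by rewrite divr_gt0.
have /cvgr0Pnorm_le/(_ _ e20)[n _ /(_ n (leqnn n)) hn] := cu t tT.
have [_ /(_ t tT _ e20)[k hk]] := svalP (h n).
exists (pickle (n, k)); rewrite /v pickleK/=; have [Xk _] := svalP (h n).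
apply: le_trans (seminorm_dist XN (Xu t tT) (Xun n t tT) (Xk k)) _.
rewrite [leRHS]splitr lerD// (seminorm_distC XN); [|exact: Xu|exact: Xun].
exact: le_trans (ler_norm _) hn.
Qed.

Lemma sm_sub u1 u2 : valued_in u1 -> valued_in u2 ->
  strongly_measurable T X N u1 -> strongly_measurable T X N u2 ->
  strongly_measurable T X N (fun t => u1 t - u2 t).
Proof.
apply: (@sm_map2 V V V X X X N N N (fun x y => x - y) 1) => //.
- by move=> x y; exact: (seminormedB XN).
- by move=> x y Xx Xy; apply: (seminorm_ge0 XN); exact: (seminormedB XN).
- move=> x y x' y' Xx Xy Xx' Xy'; rewrite mul1r.
  rewrite [X in N X](_ : _ = (x - x') - (y - y')).
    by apply: (seminorm_leB XN); exact: (seminormedB XN).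
  by rewrite !opprB addrACA [RHS]addrACA [- y + _]addrC.
Qed.

Lemma sm_restrict u (A : set R) x : measurable A -> X x -> N (x - x) = 0 ->
  strongly_measurable T X N u ->
  strongly_measurable T X N (fun t => if t \in A then u t else x).
Proof.
move=> mA Xx xx [s ss cs]; exists (fun n t => if t \in A then s n t else x).
  by move=> n; exact: simple_restrict.
move=> t tT; case: ifP => _; first exact: cs.
by rewrite xx; exact: cvg_cst.
Qed.

End VectorValuedFunctions.
End StrongMeasurability.

Section BochnerIntegral.
Context {R : realType}.
Local Notation leb := (@lebesgue_measure R).
Variables (ell T : R).
Hypothesis ell0 : 0 < ell.
Local Notation X := (L2 0 ell).
Local Notation N := (L2norm 0 ell).
Implicit Types (f g v w : R -> R) (L : (R -> R) -> R) (c d C K t : R).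
Let XN : seminormed X N := L2_seminormed (ltW ell0).

(** A continuous linear functional on L^2(0, ell), given on functions and constrained on square
    integrable ones. Inner products, weighted products and boundary traces are all of this kind. *)
Record bounded_functional L C : Prop := BoundedFunctional {
  blf_lin : forall c d f g, X f -> X g -> L (lin2 c d f g) = c * L f + d * L g;
  blf_le : forall f, X f -> `|L f| <= C * N f }.

Lemma blfB L C f g : bounded_functional L C -> X f -> X g -> L (f - g) = L f - L g.
Proof. by move=> bL Xf Xg; rewrite subr_lin2 (blf_lin bL)// mul1r mulN1r. Qed.

Lemma blf0 L C : bounded_functional L C -> L 0 = 0.
Proof.
by move=> bL; have := blfB bL (seminormed0 XN) (seminormed0 XN); rewrite !subrr.
Qed.

Lemma blf_ip w : X w -> bounded_functional (fun f => ip 0 ell f w) (N w).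
Proof.
move=> Xw; split=> [c d f g Xf Xg|f Xf].
  by rewrite /lin2 ipDl ?ipZl//; exact: L2Z.
by rewrite mulrC; exact: cauchy_schwarz.
Qed.

Lemma ip_norm_le f c : X f -> 0 <= c -> (forall w, X w -> `|ip 0 ell f w| <= c * N w) ->
  N f <= c.
Proof.
move=> Xf c0 h; have := h f Xf; rewrite ger0_norm ?ip_ge0// -L2norm_sqr expr2.
have := L2norm_ge0 0 ell f; rewrite le_eqVlt => /predU1P[<-//|N0].
by rewrite ler_pM2r.
Qed.

Lemma sm_blf L C u : bounded_functional L C -> valued_in T X u ->
  strongly_measurable T X N u -> measurable_fun `]0, T[ (fun t => L (u t)).
Proof.
move=> bL Xu su; apply: sm_measurable.
apply: (@sm_map1 R T _ _ X setT N (@Num.norm R R) L C) su => //.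
by move=> f g Xf Xg; rewrite -(blfB bL)//; apply: (blf_le bL); exact: (seminormedB XN).
Qed.

Lemma simple_bochner (s : R -> R -> R) (ker : R -> R) K : simple_fun X s -> measurable_fun `]0, T[
  ker ->
  (forall t, t \in `]0, T[ -> `|ker t| <= K) ->
  exists2 Y, X Y & forall L C, bounded_functional L C ->
    L Y = \int[leb]_(t in `]0, T[) (ker t * L (s t)).
Proof.
move=> ss mker kerK; have [l [ul Xl sl]] := simple_seq ss; have [_ ms Xs] := ss.
pose ind v t : R := (s t == v)%:R.
have mind v : measurable_fun setT (ind v).
  have -> : ind v = \1_(s @^-1` [set v]).
    apply/funext => t; rewrite indicE /ind; congr (_%:R).
  exact: measurable_indic.
have Lind v c : L1 0 T (fun t => ker t * (ind v t * c)).
  apply: (@L1_bounded _ _ _ _ (K * `|c|)).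
    apply: measurable_funM => //; apply: measurable_funM => //.
    exact: measurable_funTS.
  move=> t tT; rewrite !normrM ler_pM ?kerK ?mulr_ge0//.
  by rewrite ler_piMl// /ind; case: (_ == _); rewrite ?normr1 ?normr0.
(* Writing [L (s t)] as a sum over the finitely many values of [s] allows induction on their
   list. *)
suff [Y XY YE] : exists2 Y, X Y & forall L C, bounded_functional L C ->
    L1 0 T (fun t => ker t * \sum_(v <- l) ind v t * L v) /\
    L Y = \int[leb]_(t in `]0, T[) (ker t * \sum_(v <- l) ind v t * L v).
  exists Y => // L C bL; rewrite (YE L C bL).2; apply: eq_Rintegral => t _.
  congr (_ * _); rewrite (bigD1_seq (s t))//= /ind eqxx mul1r big1 ?addr0// => v.
  by rewrite eq_sym => /negbTE ->; rewrite mul0r.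
elim: l Xl {ul sl} => [_|v l IH Xl].
  exists 0; first exact: (seminormed0 XN).
  move=> L C bL; rewrite (blf0 bL).
  have e : (fun t => ker t * \sum_(v <- [::]) ind v t * L v) = cst 0.
    by apply/funext => t; rewrite big_nil mulr0.
  rewrite e; split; first exact: L1_cst.
  by rewrite Rintegral_cst// mul0r.
have Xv : X v by apply: Xl; rewrite mem_head.
have [|Y XY YE] := IH; first by move=> x xl; apply: Xl; rewrite inE xl orbT.
pose c := \int[leb]_(t in `]0, T[) (ker t * (ind v t * 1)).
exists (lin2 c 1 v Y); first exact: L2_lin2.
move=> L C bL; have [LY YE'] := YE L C bL.
have e : (fun t => ker t * \sum_(v <- v :: l) ind v t * L v) =
    (fun t => ker t * (ind v t * L v) + ker t * \sum_(v <- l) ind v t * L v).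
  by apply/funext => t; rewrite big_cons mulrDr.
rewrite e; split; first exact: L1D.
have -> := blf_lin bL c 1 Xv XY; rewrite RintegralD//; last exact: Lind.
rewrite YE' mul1r; congr (_ + _).
rewrite /c -RintegralZr//; last exact: Lind.
by apply: eq_Rintegral => t _; rewrite mulr1 mulrA.
Qed.

Lemma sm_N_L1 u : bochner_L2 T X N u -> [/\ valued_in T X u,
  measurable_fun `]0, T[ (fun t => N (u t)) & L1 0 T (fun t => N (u t))].
Proof.
move=> [Xu su Lu]; split => //; first exact: L2_measurable Lu.
exact: L2_L1.
Qed.

(** Simple values of norm above [2 * N (u t)] are replaced by 0. Where [N (u t)] is positive this
    stops at late stages; where it is 0, all truncated values have norm 0. The bound provides a
    dominating function. *)
Lemma truncated_approximation u : valued_in T X u -> strongly_measurable T X N u ->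
  exists s : nat -> R -> R -> R, [/\ forall n, simple_fun X (s n),
    forall n t, t \in `]0, T[ -> N (s n t) <= 2 * N (u t)
  & forall t, t \in `]0, T[ -> N (s n t - u t) @[n --> \oo] --> (0 : R)].
Proof.
move=> Xu su; have [s ss cs] := su; have Xs n t : X (s n t) by have [_ _] := ss n.
pose A n : set R := [set t | N (s n t) <= 2 * N (u t) /\ t \in `]0, T[].
have mA n : measurable (A n).
  have mf : measurable_fun `]0, T[ (fun t => N (s n t) <= 2 * N (u t)).
    apply: measurable_fun_ler.
      apply: (sm_norm XN); first by move=> t _; exact: Xs.
      by exists (fun _ => s n) => // t _; rewrite subrr (seminorm0 XN); exact: cvg_cst.
    by apply: measurable_funM => //; exact: (sm_norm XN).
  have := mf (measurable_itv _) [set true] I.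
  congr measurable; apply/seteqP; split=> t /=; last by move=> [ht tT].
  by move=> [tT ht].
exists (fun n t => if t \in A n then s n t else 0); split.
- by move=> n; apply: simple_restrict => //; exact: (seminormed0 XN).
- move=> n t tT; case: ifPn => [|_]; first by rewrite inE => -[].
  by rewrite (seminorm0 XN) mulr_ge0// L2norm_ge0.
move=> t tT; have Xut := Xu t tT; have := L2norm_ge0 0 ell (u t).
rewrite le_eqVlt => /predU1P[u0|u0].
  rewrite (_ : (fun _ => _) = cst 0); first exact: cvg_cst.
  apply/funext => n /=; apply/eqP; rewrite eq_le L2norm_ge0 andbT.
  have h x : X x -> N x <= 0 -> N (x - u t) <= 0.
    by move=> Xx x0; apply: le_trans (seminorm_leB XN Xx Xut) _; rewrite -u0 addr0.
  case: ifPn => [|_]; last by apply: h; [exact: (seminormed0 XN)|rewrite (seminorm0 XN)].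
  by rewrite inE => -[+ _]; rewrite -u0 mulr0; exact: h.
apply: cvg_trans (cs t tT); apply: near_eq_cvg.
move/cvgr0Pnorm_le : (cs t tT) => /(_ _ u0); apply: filterS => n h.
rewrite mem_set//; split => //; rewrite mulr2n mulrDl mul1r -lerBlDr.
apply: le_trans h; apply: le_trans (ler_norm _).
by apply: le_trans (ler_norm _) (ler_seminorm XN (Xs n t) Xut).
Qed.

(** The integrals of the truncated simple functions form a Cauchy sequence: by duality their
    distances are bounded through the integrals of [N (s n t - u t)], which tend to 0 by dominated
    convergence. The limit is characterised by its commutation with bounded functionals. *)
Lemma bochner_integral (u : R -> R -> R) (ker : R -> R) K : valued_in T X u -> strongly_measurable
  T X N u ->
  L1 0 T (fun t => N (u t)) -> measurable_fun `]0, T[ ker ->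
  (forall t, t \in `]0, T[ -> `|ker t| <= K) -> 0 <= K ->
  exists2 Y, X Y & forall L C, bounded_functional L C ->
    L Y = \int[leb]_(t in `]0, T[) (ker t * L (u t)).
Proof.
move=> Xu su Lu mker kerK K0; have [s [ss s2 cs]] := truncated_approximation Xu su.
have Xs n t : X (s n t) by have [_ _] := ss n.
have ssu n : strongly_measurable T X N (s n).
  by exists (fun _ => s n) => // t _; rewrite subrr (seminorm0 XN); exact: cvg_cst.
have [Y hY] : exists Y : nat -> R -> R, forall n, X (Y n) /\
    forall L C, bounded_functional L C -> L (Y n) = \int[leb]_(t in `]0, T[) (ker t * L (s n t)).
  have h n : {Y : R -> R | X Y /\
    forall L C, bounded_functional L C -> L Y = \int[leb]_(t in `]0, T[) (ker t * L (s n t))}.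
    by apply: cid; have [Y XY YE] := simple_bochner (ss n) mker kerK; exists Y.
  by exists (fun n => sval (h n)) => n; exact: (svalP (h n)).
have XY n := (hY n).1; have YE n := (hY n).2.
pose d n t := N (s n t - u t).
have md n : measurable_fun `]0, T[ (d n).
  apply: (sm_norm XN); first by move=> t tT; apply: (seminormedB XN) => //; exact: Xu.
  by apply: (sm_sub XN) => // t _; exact: Xs.
have dle n t : t \in `]0, T[ -> `|d n t| <= 3 * N (u t).
  move=> tT; have Xut := Xu t tT; rewrite ger0_norm ?L2norm_ge0//.
  apply: le_trans (seminorm_leB XN (Xs n t) Xut) _.
  by have := s2 n t tT; lra.
have Ld n : L1 0 T (d n) by apply: L1_le (md n) (L1Z 3 Lu) (dle n).
pose A n := \int[leb]_(t in `]0, T[) d n t.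
have A0 n : 0 <= A n by apply: Rintegral_ge0 => t _; exact: L2norm_ge0.
have cA : A n @[n --> \oo] --> (0 : R).
  have -> : 0 = \int[leb]_(t in `]0, T[) (cst 0 t) :> R by rewrite Rintegral_cst// mul0r.
  apply: (int_dominated_cvg md _ (L1Z 3 Lu)) => //.
    by apply: aeW => t tT; exact: cs.
  by apply: aeW => t tT n; exact: dle.
have est L C n : bounded_functional L C -> 0 <= C ->
    `|L (Y n) - \int[leb]_(t in `]0, T[) (ker t * L (u t))| <= K * C * A n.
  move=> bL C0; have mLs := sm_blf bL (fun t _ => Xs n t) (ssu n); have mLu := sm_blf bL Xu su.
  have LLu : L1 0 T (fun t => ker t * L (u t)).
    apply: (L1_mulb mker kerK); apply: (L1_le mLu (L1Z C Lu)) => t tT.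
    by apply: (blf_le bL); exact: Xu.
  have LLs : L1 0 T (fun t => ker t * L (s n t)).
    apply: (L1_mulb mker kerK); apply: (L1_le mLs (L1Z (C * 2) Lu)) => t tT.
    apply: le_trans (blf_le bL (Xs n t)) _; rewrite -mulrA ler_wpM2l//; exact: s2.
  rewrite (YE n L C bL) -RintegralB// /A -RintegralZl//; last exact: Ld.
  apply: norm_int_le; [exact: L1B|exact: L1Z|].
  apply: aeW => t tT; have Xut := Xu t tT; rewrite -mulrBr -(blfB bL)// normrM -mulrA.
  by rewrite ler_pM ?kerK//; apply: (blf_le bL); exact: (seminormedB XN).
have YC : cauchy_seq N Y.
  have YmYn m n : N (Y m - Y n) <= K * A m + K * A n.
    have Xd : X (Y m - Y n) by exact: (seminormedB XN).
    apply: ip_norm_le => //; first by rewrite addr_ge0// mulr_ge0.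
    move=> w Xw; have bw := blf_ip Xw; rewrite (blfB bw)//.
    have h1 := est _ _ m bw (L2norm_ge0 0 ell w); have h2 := est _ _ n bw (L2norm_ge0 0 ell w).
    apply: le_trans (ler_distD (\int[leb]_(t in `]0, T[) (ker t * ip 0 ell (u t) w)) _ _) _.
    rewrite mulrDl lerD//; first by rewrite mulrAC.
    by rewrite distrC mulrAC.
  move=> e e0; have De : 0 < e / (2 * (K + 1)) by rewrite divr_gt0// mulr_gt0// ltr_wpDl.
  have /cvgr0Pnorm_le/(_ _ De)[n0 _ hn0] := cA.
  exists n0 => m n mn0 nn0; apply: le_trans (YmYn m n) _.
  have h k : (n0 <= k)%N -> K * A k <= e / 2.
    move=> /hn0; rewrite ger0_norm// => h.
    apply: le_trans (ler_wpM2l K0 h) _.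
    rewrite mulrA ler_pdivrMr ?mulr_gt0 ?ltr_wpDl//.
    by rewrite mulrA divfK// mulrC ler_wpM2l ?lerDl// ltW.
  by rewrite [leRHS]splitr lerD// h.
have [y Xy cy] := L2_complete (ltW ell0) XY YC.
exists y => // L C bL.
have bL' : bounded_functional L `|C|.
  split; first exact: (blf_lin bL).
  move=> f Xf; apply: le_trans (blf_le bL Xf) _.
  by rewrite ler_wpM2r ?L2norm_ge0// ler_norm.
have c1 : L (Y n) @[n --> \oo] --> L y.
  apply/cvgrPdist_le => e e0; have De : 0 < e / (`|C| + 1) by rewrite divr_gt0// ltr_wpDl.
  move/cvgr0Pnorm_le : cy => /(_ _ De); apply: filterS => n; rewrite ger0_norm ?L2norm_ge0// => h.
  rewrite distrC -(blfB bL)//; apply: le_trans (blf_le bL' (seminormedB XN (XY n) Xy)) _.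
  apply: le_trans (ler_wpM2l (normr_ge0 _) h) _.
  by rewrite mulrA ler_pdivrMr ?ltr_wpDl// mulrC ler_wpM2l ?lerDl// ltW.
apply: (cvg_unique _ c1) => //.
apply/cvgrPdist_le => e e0; have De : 0 < e / (K * `|C| + 1).
  by rewrite divr_gt0// ltr_wpDl// mulr_ge0.
move/cvgr0Pnorm_le : cA => /(_ _ De); apply: filterS => n; rewrite ger0_norm// => h.
rewrite distrC; apply: le_trans (est L _ n bL' (normr_ge0 _)) _.
apply: le_trans (ler_wpM2l (mulr_ge0 K0 (normr_ge0 _)) h) _.
by rewrite mulrA ler_pdivrMr ?ltr_wpDl ?mulr_ge0// mulrC ler_wpM2l ?lerDl// ltW.
Qed.

End BochnerIntegral.

(** * Mollification in time *)

Section MeanValue.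
Context {R : realType}.
Implicit Types (F f : R -> R) (x y z d k C K : R).

Lemma mvt_le F f x y K : x <= y -> (forall z, is_derive z 1 F (f z)) ->
  (forall z, z \in `[x, y] -> f z <= K) -> F y - F x <= K * (y - x).
Proof.
move=> xy Ff fK; have cF : {within `[x, y], continuous F}.
  by apply: continuous_subspaceT; exact: is_derive_continuous Ff.
have [c cxy ->] := MVT_segment xy (fun z _ => Ff z) cF.
by rewrite ler_wpM2r ?subr_ge0//; exact: fK.
Qed.

Lemma mvt_norm F f x y K : (forall z, is_derive z 1 F (f z)) ->
  (forall z, `|z - x| <= `|y - x| -> `|f z| <= K) -> `|F y - F x| <= K * `|y - x|.
Proof.
move=> Ff fK; have cF a b : {within `[a, b], continuous F}.
  by apply: continuous_subspaceT; exact: is_derive_continuous Ff.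
have [xy|/ltW yx] := leP x y.
  have [c] := MVT_segment xy (fun z _ => Ff z) (cF _ _).
  rewrite in_itv/= => /andP[xc cy] ->; rewrite normrM ler_wpM2r//; apply: fK.
  by rewrite !ger0_norm ?subr_ge0// lerD2r.
have [c] := MVT_segment yx (fun z _ => Ff z) (cF _ _).
rewrite in_itv/= => /andP[yc cx] e; rewrite distrC e normrM distrC ler_wpM2r//; apply: fK.
by rewrite !(distrC _ x) !ger0_norm ?subr_ge0// lerD2l lerN2.
Qed.

Lemma is_derive_of_sqr_bound f x d C :
  (forall k, `|k| <= 1 -> `|f (x + k) - f x - k * d| <= C * k ^+ 2) -> is_derive x 1 f d.
Proof.
move=> hC; have C0 : 0 <= C.
  by have := hC 1; rewrite normr1 lexx expr1n mulr1 => /(_ isT); exact: le_trans.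
have h : k^-1 *: (f (k *: 1 + x) - f x) @[k --> (0 : R)^'] --> d.
  apply/cvgrPdist_le => e e0; near=> k.
  have k0 : k != 0 by near: k; exact: nbhs_dnbhs_neq.
  have k1 : `|k| <= 1 by near: k; exact: dnbhs0_le.
  have ke : `|k| <= e / (C + 1) by near: k; apply: dnbhs0_le; rewrite divr_gt0// ltr_wpDl.
  have := hC k k1; rewrite /GRing.scale/= mulr1 [k + x]addrC => hk.
  have -> : d - k^-1 * (f (x + k) - f x) = - (k^-1 * (f (x + k) - f x - k * d)) by field.
  rewrite normrN normrM normfV ler_pdivrMl ?normr_gt0//.
  apply: le_trans hk _; rewrite -real_normK ?num_real// expr2 mulrA mulrC.
  rewrite ler_wpM2l//; apply: le_trans (ler_wpM2l C0 ke) _.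
  by rewrite mulrA ler_pdivrMr ?ltr_wpDl// mulrC ler_wpM2l ?lerDl// ltW.
split; first by apply/cvg_ex; exists d.
exact: cvg_lim h.
Unshelve. all: by end_near. Qed.

End MeanValue.

Section ConvolutionInTime.
Context {R : realType}.
Local Notation leb := (@lebesgue_measure R).
Variables (T C h : R) (ker H : R -> R).
Hypotheses (T0 : 0 < T) (m : mollifier C h ker H).
Implicit Types (f g : R -> R) (c k t s z K : R).

(** In effect [f] is extended by 0 outside (0, T). For a kernel supported in positive times and
    [t <= T], only the extension to negative times is seen. *)
Definition tconv (w f : R -> R) t := \int[leb]_(s in `]0, T[) (w (t - s) * f s).

Local Notation dker := (derive1n 1 ker).

Lemma mol_is_derive n t : is_derive t 1 (derive1n n ker) (derive1n n.+1 ker t).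
Proof. exact: smooth_is_derive (mol_smooth m). Qed.

Lemma mol_vanish n t : t < 0 \/ h < t -> derive1n n ker t = 0.
Proof.
elim: n t => [|n IH] t ht.
  by case: ht => /ltW ht; [exact: (mol_left m)|exact: (mol_right m)].
have h0 : is_derive t 1 (derive1n n ker) 0.
  apply: is_derive_near0; case: ht => ht; near=> y; apply: IH.
    by left; near: y; exact: lt_nbhsl.
  by right; near: y; exact: lt_nbhsr.
by rewrite -(@derive_val _ _ _ _ _ _ _ (mol_is_derive n t)) (@derive_val _ _ _ _ _ _ _ h0).
Unshelve. all: by end_near. Qed.

Lemma mol_derive_bounded n : exists2 K, 0 <= K & forall t, `|derive1n n ker t| <= K.
Proof.
have [K K0 hK] := continuous_bounded_itv 0 h (@smooth_continuous _ _ n (mol_smooth m)).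
exists K => // t; have [t0|t0] := ltP t 0; first by rewrite mol_vanish ?normr0//; left.
have [ht|ht] := ltP h t; first by rewrite mol_vanish ?normr0//; right.
by apply: hK; rewrite in_itv/= t0.
Qed.

Lemma mol_taylor : exists2 K, 0 <= K & forall t k,
  `|ker (t + k) - ker t - k * dker t| <= K * k ^+ 2.
Proof.
have [K K0 hK] := mol_derive_bounded 2; exists K => // t k.
pose F z := ker (1 * z + t) - z * dker t.
have dF z : is_derive z 1 F (dker (1 * z + t) - dker t).
  have h1 : is_derive z 1 (fun y => ker (1 * y + t)) (1 * dker (1 * z + t)).
    by apply: is_derive_affine; exact: (mol_is_derive 0).
  have h2 : is_derive z 1 (fun y => y * dker t) (dker t).
    by apply: is_derive_eq; rewrite /GRing.scale/=; ring.
  by have := is_deriveB h1 h2; rewrite mul1r.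
have := @mvt_norm R F _ 0 k (K * `|k|) dF.
have -> : F k - F 0 = ker (t + k) - ker t - k * dker t.
  by rewrite /F !mul1r mul0r subr0 add0r [k + t]addrC addrAC.
rewrite subr0 -[K * k ^+ 2]/(K * (k * k)) => hF.
have -> : K * k ^+ 2 = K * `|k| * `|k| by rewrite -mulrA -expr2 real_normK ?num_real.
apply: hF => z; rewrite subr0 => zk.
apply: le_trans (@mvt_norm R dker _ t (1 * z + t) K (mol_is_derive 1) _) _ => //.
by rewrite mul1r addrK ler_wpM2l.
Qed.

Lemma reflect_measurable n t : measurable_fun `]0, T[ (fun s => derive1n n ker (t - s)).
Proof.
apply: measurable_funTS; apply: continuous_measurable_fun.
by apply: reflect_continuous; exact: smooth_continuous (mol_smooth m).
Qed.

Lemma mol_reflect_derive t s : is_derive s 1 (fun s => - ker (t - s)) (dker (t - s)).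
Proof.
have e : (fun s => - ker (t - s)) = (fun s => -1 * ker (-1 * s + t)).
  by apply/funext => z; rewrite !mulN1r addrC.
rewrite e.
have -> : dker (t - s) = -1 * (-1 * dker (-1 * s + t)) by rewrite !mulN1r opprK addrC.
by apply: is_deriveZ; apply: is_derive_affine; exact: (mol_is_derive 0).
Qed.

Lemma tconv_L1 n f t : L1 0 T f -> L1 0 T (fun s => derive1n n ker (t - s) * f s).
Proof.
move=> Lf; have [K K0 hK] := mol_derive_bounded n.
by apply: (@L1_mulb _ _ _ _ _ K) => //; exact: reflect_measurable.
Qed.

(** [K] is the same for all [f]: applied to the scalar functions [ip (u s) w] for every [w], it
    gives by duality the differentiability in norm of a vector valued convolution. *)
Lemma tconv_taylor : exists2 K, 0 <= K & forall f t k, L1 0 T f ->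
  `|tconv ker f (t + k) - tconv ker f t - k * tconv dker f t| <=
    K * k ^+ 2 * \int[leb]_(s in `]0, T[) `|f s|.
Proof.
have [K K0 hK] := mol_taylor; exists K => // f t k Lf.
rewrite /tconv -RintegralZl//; last exact: (tconv_L1 1).
rewrite -RintegralB//; [|exact: (tconv_L1 0)|exact: (tconv_L1 0)].
rewrite -RintegralB//; [|by apply: L1B; exact: (tconv_L1 0)|by apply: L1Z; exact: (tconv_L1 1)].
rewrite -RintegralZl//; last exact: L1_norm.
apply: norm_int_le.
- apply: L1B; first by apply: L1B; exact: (tconv_L1 0).
  by apply: L1Z; exact: (tconv_L1 1).
- by apply: L1Z; exact: L1_norm.
apply: aeW => s sT; have := hK (t - s) k; rewrite [t - s + k]addrAC => h1.
rewrite (_ : _ - _ - _ = (ker (t + k - s) - ker (t - s) - k * dker (t - s)) * f s); last by ring.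
by rewrite normrM ler_wpM2r.
Qed.

Lemma tconv_is_derive f t : L1 0 T f -> is_derive t 1 (tconv ker f) (tconv dker f t).
Proof.
move=> Lf; have [K K0 hK] := tconv_taylor.
apply: (@is_derive_of_sqr_bound _ _ _ _ (K * \int[leb]_(s in `]0, T[) `|f s|)) => k _.
by rewrite mulrAC; exact: hK.
Qed.

Lemma tconv_le f c t : L1 0 T f -> 0 <= c -> ae (fun s => s \in `]0, T[ -> `|f s| <= c) ->
  `|tconv ker f t| <= c.
Proof.
move=> Lf c0 fc; have Lk : L1 0 T (fun s => ker (t - s)).
  by apply: continuous_L1; apply: reflect_continuous; exact: mol_continuous m.
have ik : \int[leb]_(s in `]0, T[) ker (t - s) <= 1.
  rewrite (@int_derive R (fun s => - H (t - s)) (fun s => ker (t - s)) 0 T (ltW T0)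
    (reflect_continuous (mol_continuous m)) (fun x => mollifier_reflect t x m)).
  rewrite opprK subr0; have := mol_prim_ge0 m (t - T).
  by have := mol_prim_le1 m t; lra.
apply: le_trans (_ : \int[leb]_(s in `]0, T[) (c * ker (t - s)) <= _).
  apply: norm_int_le; [exact: (tconv_L1 0)|exact: L1Z|].
  apply: aeS fc => s fc sT; rewrite normrM mulrC (ger0_norm (mol_ge0 m _)).
  by rewrite ler_wpM2r ?(mol_ge0 m)//; exact: fc.
by rewrite RintegralZl// ler_piMr.
Qed.

Lemma tconv_past f t : t <= 0 -> tconv ker f t = 0.
Proof.
move=> t0; rewrite /tconv (@eq_Rintegral _ _ _ leb _ (cst 0)).
  by rewrite Rintegral_cst// mul0r.
move=> s; rewrite inE/= in_itv/= => /andP[s0 _].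
by rewrite (mol_left m) ?mul0r// subr_le0 (le_trans t0)// ltW.
Qed.

(** Extended by 0 to negative times, [f] jumps by [c] at 0, and the jump contributes [c * ker t] to
    the derivative. No term appears at [T], because the kernel vanishes at [t - T <= 0]. *)
Lemma tconv_derive_primitive f f1 c t : t <= T -> measurable_fun `]0, T[ f -> L1 0 T f1 ->
  ae (fun s => s \in `]0, T[ -> f s = c + prim 0 f1 s) ->
  tconv dker f t = c * ker t + tconv ker f1 t.
Proof.
move=> tT mf Lf1 fE; have leT := ltW T0.
have Lp : L1 0 T (prim 0 f1) by apply: L2_L1; exact: prim_L2.
have mp := L1_measurable Lp.
rewrite /tconv (@eq_int_ae _ 0 T _ (fun s => c * dker (t - s) + prim 0 f1 s * dker (t - s))).
- have cd : continuous (fun s => dker (t - s)).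
    by apply: reflect_continuous; exact: smooth_continuous (mol_smooth m).
  have Ld : L1 0 T (fun s => dker (t - s)) by exact: continuous_L1.
  have dk s := mol_reflect_derive t s.
  rewrite RintegralD//; [|exact: L1Z|exact: L1_mul_cont].
  rewrite RintegralZl// (int_derive leT cd dk) subr0 (mol_left m) ?subr_le0// oppr0 add0r opprK.
  congr (_ + _); rewrite (prim_weak leT Lf1 cd dk) (mol_left m) ?subr_le0// oppr0 mul0r add0r.
  rewrite -mulN1r -RintegralZl//; first by apply: eq_Rintegral => s _; ring.
  rewrite (_ : (fun x => _) = (fun x => - (ker (t - x) * f1 x))).
    by apply: L1N; exact: (tconv_L1 0).
  by apply/funext => x; ring.
- by apply: measurable_funM => //; exact: (reflect_measurable 1).
- apply: measurable_funD; apply: measurable_funM => //; exact: (reflect_measurable 1).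
- by apply: aeS fE => s hs sT; rewrite hs//; ring.
Qed.

End ConvolutionInTime.

(** * Weighted products and boundary traces as functionals on L^2(0, ell) *)

Section WeightedProduct.
Context {R : realType}.
Local Notation leb := (@lebesgue_measure R).
Variables (ell : R).
Hypothesis ell0 : 0 < ell.
Local Notation X := (L2 0 ell).
Local Notation N := (L2norm 0 ell).
Implicit Types (c f g z : R -> R) (B d k : R).

Record coefficient B c : Prop := Coefficient {
  coef_ge0 : 0 <= B;
  coef_measurable : measurable_fun `]0, ell[ c;
  coef_le : ae (fun x => x \in `]0, ell[ -> `|c x| <= B) }.

Definition wip c f g := \int[leb]_(x in `]0, ell[) (c x * f x * g x).

Lemma coef_L2 B c f : coefficient B c -> X f -> X (fun x => c x * f x).
Proof. by move=> [B0 mc cB] Xf; exact: L2_mulb mc cB Xf. Qed.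

Lemma wip_L1 B c f g : coefficient B c -> X f -> X g -> L1 0 ell (fun x => c x * f x * g x).
Proof. by move=> cB Xf Xg; apply: L2_mul => //; exact: (coef_L2 cB). Qed.

Lemma wip_lin B c d k f g z : coefficient B c -> X f -> X g -> X z ->
  wip c (lin2 d k f g) z = d * wip c f z + k * wip c g z.
Proof.
move=> cB Xf Xg Xz; have L1' := wip_L1 cB Xf Xz; have L2' := wip_L1 cB Xg Xz.
rewrite /wip -!RintegralZl// -RintegralD//; [|exact: L1Z|exact: L1Z].
by apply: eq_Rintegral => x _; rewrite /lin2; ring.
Qed.

Lemma wip_sym c f g : wip c f g = wip c g f.
Proof. by apply: eq_Rintegral => x _; ring. Qed.

Lemma wip_le B c f g : coefficient B c -> X f -> X g -> `|wip c f g| <= B * N f * N g.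
Proof.
move=> cB Xf Xg; have Xn u : X u -> X (fun x => `|u x|).
  move=> Xu; apply: (L2_le _ Xu); last by move=> x _; rewrite normr_id.
  by apply: measurableT_comp => //; exact: L2_measurable Xu.
have Xa := Xn f Xf; have Xb := Xn g Xg.
have na u : N (fun x => `|u x|) = N u.
  by rewrite !L2norm_ip; congr Num.sqrt; apply: eq_Rintegral => x _; rewrite -!expr2 real_normK
    ?num_real.
apply: le_trans (_ : B * ip 0 ell (fun x => `|f x|) (fun x => `|g x|) <= _).
  rewrite /ip -RintegralZl//; last exact: L2_mul.
  apply: norm_int_le; [exact: (wip_L1 cB)|by apply: L1Z; exact: L2_mul|].
  apply: aeS (coef_le cB) => x h xI; rewrite !normrM -mulrA ler_wpM2r ?mulr_ge0//.
  exact: h.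
rewrite -mulrA ler_wpM2l ?(coef_ge0 cB)//; apply: le_trans (ler_norm _) _.
by have := cauchy_schwarz Xa Xb; rewrite !na.
Qed.

Lemma wip_ge c d B f : coefficient B c -> X f -> ae (fun x => x \in `]0, ell[ -> d <= c x) ->
  d * N f ^+ 2 <= wip c f f.
Proof.
move=> cB Xf dc; rewrite L2norm_sqr /ip -RintegralZl//; last exact: L2_mul.
apply: le_int_ae; [by apply: L1Z; exact: L2_mul|exact: (wip_L1 cB)|].
apply: aeS dc => x h xI; rewrite -mulrA ler_wpM2r ?h//.
by rewrite -expr2 sqr_ge0.
Qed.

Lemma wip_ae B c f g g' : coefficient B c -> X f -> X g -> X g' ->
  ae (fun x => x \in `]0, ell[ -> g x = g' x) -> wip c f g = wip c f g'.
Proof. by move=> cB Xf Xg Xg' e; apply: ip_ae => //; [exact: (coef_L2 cB)|exact: (coef_L2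
  cB)|exact: aeW]. Qed.

Lemma blf_wip B c z : coefficient B c -> X z ->
  bounded_functional ell (fun f => wip c f z) (B * N z).
Proof.
move=> cB Xz; split=> [d k f g Xf Xg|f Xf]; first exact: (wip_lin _ _ cB).
by rewrite mulrAC; exact: (wip_le cB).
Qed.

(** If [f] is the second derivative of an element of V^2, this functional is the slope at the free
    end, and that of [blf_prim2_trace] the deflection there. *)
Lemma blf_prim_trace : bounded_functional ell (fun f => prim 0 f ell) (Num.sqrt ell).
Proof.
have ie : ell \in `[0, ell] by rewrite in_itv/= lexx ltW.
split=> [d k f g Xf Xg|f Xf]; first by apply: (@prim_lin _ 0 ell) => //; exact: L2_L1.
by have := prim_le_L2 ell0 Xf ie; rewrite subr0.
Qed.

Lemma blf_prim2_trace :
  bounded_functional ell (fun f => prim2 0 f ell) (Num.sqrt ell * ell).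
Proof.
have ie : ell \in `[0, ell] by rewrite in_itv/= lexx ltW.
split=> [d k f g Xf Xg|f Xf]; first by apply: (@prim2_lin _ 0 ell).
by have := prim2_le_L2 ell0 Xf ie; rewrite subr0.
Qed.

Lemma blf_prim2_ip z : X z ->
  bounded_functional ell (fun f => ip 0 ell (prim2 0 f) z) (ell ^+ 2 * N z).
Proof.
move=> Xz; have P f : X f -> X (prim2 0 f) by exact: prim2_in_L2.
split=> [d k f g Xf Xg|f Xf].
  rewrite (_ : ip _ _ _ _ = ip 0 ell (lin2 d k (prim2 0 f) (prim2 0 g)) z).
    rewrite /lin2 ipDl; [|by apply: L2Z; exact: P|by apply: L2Z; exact: P|by []].
    by rewrite !ipZl//; exact: P.
  apply: eq_Rintegral => x; rewrite inE/= in_itv/= => /andP[x0 xl].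
  by rewrite /lin2 (@prim2_lin _ 0 ell)// in_itv/= !ltW.
apply: le_trans (cauchy_schwarz (P _ Xf) Xz) _; rewrite mulrAC ler_wpM2r ?L2norm_ge0//.
by have := prim2_L2norm ell0 Xf; rewrite subr0.
Qed.

End WeightedProduct.

Section MollifiedFunctions.
Context {R : realType}.
Local Notation leb := (@lebesgue_measure R).
Variables (ell T : R).
Hypotheses (ell0 : 0 < ell) (T0 : 0 < T).
Local Notation X := (L2 0 ell).
Local Notation N := (L2norm 0 ell).
Variables (C h : R) (ker H : R -> R).
Hypothesis m : mollifier C h ker H.
Local Notation dker := (derive1n 1 ker).
Implicit Types (f g w : R -> R) (u Y : R -> R -> R) (L : (R -> R) -> R) (B D K t k : R).

(** [Y] and [Y1] are the convolutions of [u] with the kernel and with its derivative, described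
    through bounded functionals. The Taylor bound makes [Y1] the derivative of [Y] in norm, as
    differentiating quadratic expressions requires. *)
Record mollified u Y (Y1 : R -> R -> R) K : Prop := Mollified {
  moll_ge0 : 0 <= K;
  moll_in : forall t, X (Y t);
  moll_in1 : forall t, X (Y1 t);
  moll_blf : forall L D t, bounded_functional ell L D ->
    L (Y t) = tconv T ker (fun s => L (u s)) t;
  moll_blf1 : forall L D t, bounded_functional ell L D ->
    L (Y1 t) = tconv T dker (fun s => L (u s)) t;
  moll_bound : forall t, N (Y t) <= K;
  moll_taylor : forall t k,
    N (lin2 1 (- k) (Y (t + k) - Y t) (Y1 t)) <= K * k ^+ 2 }.

Lemma blf_L1 L D u : bounded_functional ell L D -> bochner_L2 T X N u ->
  L1 0 T (fun s => L (u s)).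
Proof.
move=> bL Bu; have [Xu mN LN] := sm_N_L1 Bu; have [_ su _] := Bu.
apply: L1_le (sm_blf ell0 bL Xu su) (L1Z D LN) _ => s sT.
by apply: (blf_le bL); exact: Xu.
Qed.

Lemma mollified_ex u : bochner_L2 T X N u -> exists Y Y1 K, mollified u Y Y1 K.
Proof.
move=> Bu; have [Xu mN LN] := sm_N_L1 Bu; have [_ su _] := Bu.
have ex n t : {Y : R -> R | X Y /\ forall L D, bounded_functional ell L D ->
    L Y = tconv T (derive1n n ker) (fun s => L (u s)) t}.
  apply: cid; have [K K0 hK] := mol_derive_bounded m n.
  have [|Y XY YE] := bochner_integral ell0 Xu su LN (@reflect_measurable R T C h ker H m n t) _ K0.
    by move=> s _; exact: hK.
  by exists Y; split.
pose A := \int[leb]_(s in `]0, T[) N (u s).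
have A0 : 0 <= A by apply: Rintegral_ge0 => s _; exact: L2norm_ge0.
have [K0 K00 hK0] := mol_derive_bounded m 0.
have [K2 K20 hK2] := tconv_taylor T m.
pose Y t := sval (ex 0%N t); pose Y1 t := sval (ex 1%N t).
have XY t : X (Y t) by exact: (svalP (ex 0%N t)).1.
have XY1 t : X (Y1 t) by exact: (svalP (ex 1%N t)).1.
have YE t := (svalP (ex 0%N t)).2; have Y1E t := (svalP (ex 1%N t)).2.
have ipA w : X w -> \int[leb]_(s in `]0, T[) `|ip 0 ell (u s) w| <= N w * A.
  move=> Xw; have bw := blf_ip Xw; rewrite -RintegralZl//.
  apply: le_int_ae; [by apply: L1_norm; exact: (blf_L1 bw)|exact: L1Z|].
  by apply: aeW => s sT; apply: (blf_le bw); exact: Xu.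
exists Y, Y1, (K0 * A + K2 * A); split => //.
- by rewrite addr_ge0// mulr_ge0.
- by move=> L D t bL; exact: YE bL.
- by move=> L D t bL; exact: Y1E bL.
- move=> t; apply: (@le_trans _ _ (K0 * A)); last by rewrite lerDl mulr_ge0.
  apply: ip_norm_le => //; first by rewrite mulr_ge0.
  move=> w Xw; have bw := blf_ip Xw; rewrite (YE t _ _ bw) /tconv.
  apply: le_trans (_ : K0 * \int[leb]_(s in `]0, T[) `|ip 0 ell (u s) w| <= _).
    rewrite -RintegralZl//; last by apply: L1_norm; exact: (blf_L1 bw).
    apply: norm_int_le.
    + by apply: (tconv_L1 m 0); exact: (blf_L1 bw).
    + by apply: L1Z; apply: L1_norm; exact: (blf_L1 bw).
    + by apply: aeW => s _; rewrite normrM ler_wpM2r//; exact: hK0.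
  by rewrite -mulrA ler_wpM2l// mulrC ipA.
- move=> t k; have Xd : X (Y (t + k) - Y t) by exact: (seminormedB (L2_seminormed (ltW ell0))).
  apply: (@le_trans _ _ (K2 * A * k ^+ 2)).
    apply: ip_norm_le.
    + by apply: L2_lin2.
    + by rewrite mulr_ge0 ?sqr_ge0 ?mulr_ge0.
    + move=> w Xw; have bw := blf_ip Xw.
      rewrite (blf_lin bw)// (blfB bw)// mul1r mulNr (YE _ _ _ bw) (YE _ _ _ bw) (Y1E _ _ _ bw).
      apply: le_trans (hK2 _ t k (blf_L1 bw Bu)) _.
      rewrite [leRHS](_ : _ = K2 * k ^+ 2 * (N w * A)); last by ring.
      by rewrite ler_wpM2l ?ipA// mulr_ge0// sqr_ge0.
  by rewrite mulrDl lerDr mulr_ge0 ?sqr_ge0// mulr_ge0.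
Qed.

Lemma mollified_past u Y Y1 K t : mollified u Y Y1 K -> t <= 0 -> N (Y t) = 0.
Proof.
move=> mY t0; apply/eqP; rewrite eq_le L2norm_ge0 andbT; apply: ip_norm_le => //.
  exact: (moll_in mY).
move=> w Xw; rewrite (moll_blf mY _ (blf_ip Xw)) (tconv_past _ m)//.
by rewrite normr0 mul0r.
Qed.

Lemma mollified_trace_derive u Y Y1 K L D t : bochner_L2 T X N u -> mollified u Y Y1 K ->
  bounded_functional ell L D -> is_derive t 1 (fun t => L (Y t)) (L (Y1 t)).
Proof.
move=> Bu mY bL; rewrite (moll_blf1 mY _ bL).
rewrite (_ : (fun t => L (Y t)) = tconv T ker (fun s => L (u s))).
  by apply: (tconv_is_derive m); exact: (blf_L1 bL).
by apply/funext => s; rewrite (moll_blf mY _ bL).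
Qed.

(** Write Y(t + k) = Y(t) + D with D = k Y1(t) + Z and Z the Taylor remainder. Expanding the
    quadratic form leaves 2 <Z, Y> + <D, D> beyond the linear term, and both are of order k^2. *)
Lemma mollified_wip_derive u Y Y1 K B c t : mollified u Y Y1 K -> coefficient ell B c ->
  is_derive t 1 (fun t => wip ell c (Y t) (Y t)) (2 * wip ell c (Y1 t) (Y t)).
Proof.
move=> mY cB; have XY := moll_in mY; have XY1 := moll_in1 mY; have B0 := coef_ge0 cB.
have XN := L2_seminormed (ltW ell0); have K0 := moll_ge0 mY.
apply: (@is_derive_of_sqr_bound _ _ _ _ (2 * (B * K * K) + B * (N (Y1 t) + K) ^+ 2)) => k k1.
pose Z := lin2 1 (- k) (Y (t + k) - Y t) (Y1 t).
have XZ : X Z by apply: L2_lin2 => //; exact: (seminormedB XN).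
pose D := lin2 k 1 (Y1 t) Z; have XD : X D by exact: L2_lin2.
have YE : Y (t + k) = lin2 1 1 (Y t) D.
  by apply/funext => x; rewrite /D /Z /lin2 !fctE; ring.
have e : wip ell c (Y (t + k)) (Y (t + k)) - wip ell c (Y t) (Y t) -
    k * (2 * wip ell c (Y1 t) (Y t)) = 2 * wip ell c Z (Y t) + wip ell c D D.
  rewrite YE (wip_lin _ _ cB)//; last exact: L2_lin2.
  rewrite ![wip _ _ _ (lin2 1 1 _ _)]wip_sym !(wip_lin 1 1 cB)//.
  rewrite (wip_sym _ _ (Y t) D).
  have -> : wip ell c D (Y t) = k * wip ell c (Y1 t) (Y t) + wip ell c Z (Y t).
    by rewrite (wip_lin _ _ cB)// mul1r.
  by ring.
rewrite e; have NZ : N Z <= K * k ^+ 2 by exact: (moll_taylor mY).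
have ND : N D <= `|k| * (N (Y1 t) + K).
  apply: le_trans (L2normD (L2Z _ (XY1 t)) (L2Z _ XZ)) _.
  rewrite !L2normZ// normr1 mul1r mulrDr lerD2l; apply: le_trans NZ _.
  by rewrite mulrC ler_wpM2r// -real_normK ?num_real// expr2 ler_piMr.
have h1 : `|wip ell c Z (Y t)| <= B * K * K * k ^+ 2.
  apply: le_trans (wip_le cB XZ (XY t)) _.
  rewrite [leRHS](_ : _ = B * (K * k ^+ 2) * K); last by ring.
  by rewrite ler_pM ?mulr_ge0 ?L2norm_ge0 ?(moll_bound mY)// ler_wpM2l.
have h2 : `|wip ell c D D| <= B * (N (Y1 t) + K) ^+ 2 * k ^+ 2.
  apply: le_trans (wip_le cB XD XD) _.
  rewrite [leRHS](_ : _ = B * (`|k| * (N (Y1 t) + K)) * (`|k| * (N (Y1 t) + K))); last first.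
    by rewrite -[k ^+ 2]real_normK ?num_real//; ring.
  by rewrite ler_pM ?mulr_ge0 ?L2norm_ge0// ler_wpM2l.
apply: le_trans (ler_normD _ _) _; rewrite normrM (ger0_norm (ler0n _ 2)); lra.
Qed.

End MollifiedFunctions.

(** * The energy estimate *)

Section EnergyEstimate.
Context {R : realType}.
Local Notation leb := (@lebesgue_measure R).
Variables (ell T : R).
Hypotheses (ell0 : 0 < ell) (T0 : 0 < T).
Local Notation X := (L2 0 ell).
Local Notation N := (L2norm 0 ell).
Implicit Types (f g w z phi dphi M : R -> R) (u Z V : R -> R -> R) (c C h S K t s : R).

(** With [G] the supremum of [f], the last hypothesis gives G^2 <= q G. The bound [K] makes [G]
    finite but does not appear in the conclusion, which matters because in the application it
    depends on the kernel. *)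
Lemma sup_quadratic (D : set R) (f : R -> R) K q : D !=set0 -> 0 <= q ->
  (forall t, D t -> 0 <= f t <= K) ->
  (forall G, (forall t, D t -> f t <= G) -> forall t, D t -> f t ^+ 2 <= q * G) ->
  forall t, D t -> f t <= q.
Proof.
move=> [t0 Dt0] q0 fK hG t Dt; pose A := [set f t | t in D]; pose G := sup A.
have supA : has_sup A.
  split; first by exists (f t0), t0.
  by exists K => _ [s Ds <-]; case/andP: (fK s Ds).
have fG s : D s -> f s <= G by move=> Ds; apply: ub_le_sup; [exact: supA.2|exists s].
have G0 : 0 <= G by apply: le_trans (fG _ Dt0); case/andP: (fK _ Dt0).
have Gsq : G <= Num.sqrt (q * G).
  apply: ge_sup; first exact: supA.1.
  move=> _ [s Ds <-]; have /andP[f0 _] := fK s Ds.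
  by rewrite -(ger0_norm f0) -sqrtr_sqr ler_wsqrtr//; exact: hG.
apply: le_trans (fG t Dt) _; move: Gsq; rewrite -[X in X <= _ -> _](ger0_norm G0) -sqrtr_sqr.
rewrite ler_sqrt ?mulr_ge0// expr2; move: G0; rewrite le_eqVlt => /predU1P[<-//|G0].
by rewrite ler_pM2r.
Qed.

(* Lebesgue points of the countably many scalar functions [ip (u t) (v k)], with [v]
   dense in the range of [u], replace a vector valued differentiation theorem. *)
Lemma ae_norm_le_of_mollified u c C : bochner_L2 T X N u -> 0 <= c -> 0 <= C ->
  (forall h, 0 < h -> exists ker H, mollifier C h ker H) ->
  (forall h ker H w t, 0 < h -> mollifier C h ker H -> X w -> t \in `]0, T[ ->
    `|tconv T ker (fun s => ip 0 ell (u s) w) t| <= c * N w) ->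
  ae (fun t => t \in `]0, T[ -> N (u t) <= c).
Proof.
move=> Bu c0 C0 mex hu; have [Xu su _] := Bu; have XN := L2_seminormed (ltW ell0).
have [v [Xv dv]] := sm_dense XN Xu su.
have Lk k := blf_L1 ell0 (blf_ip (Xv k)) Bu.
have := ae_forall (fun k => ae_lebesgue_pt (Lk k)); apply: aeS => t ht tT.
have Xut := Xu t tT.
have ipv k : `|ip 0 ell (u t) (v k)| <= c * N (v k).
  apply/ler_addgt0Pr => e e0.
  have [d d0 hd] := mollifier_cvg C0 (Lk k) tT (ht k tT) e0.
  have d20 : 0 < d / 2 by rewrite divr_gt0.
  have [ker [H m]] := mex _ d20.
  have d2d : d / 2 < d by rewrite ltr_pdivrMr// ltr_pMr// ltr1n.
  have h1 := hd _ _ _ d20 d2d m; have h2 := hu _ _ _ _ _ d20 m (Xv k) tT.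
  have h1' := h1; rewrite distrC in h1'; have h3 := le_trans (lerB_dist (ip 0 ell (u t) (v k)) _)
    h1'.
  by move: h2 h3; rewrite /tconv lerBlDr => h2 h3; apply: le_trans h3 _; rewrite addrC lerD2r.
(* The product of [u t] with itself is compared with its product with a nearby [v k]; the errors
   [c * (e / D)] and [N (u t) * (e / D)] are together at most [e] by the choice of [D]. *)
have nn : N (u t) ^+ 2 <= c * N (u t).
  apply/ler_addgt0Pr => e e0; pose D := c + N (u t) + 1.
  have D0 : 0 < D by rewrite ltr_wpDl// addr_ge0// L2norm_ge0.
  have [k hk] := dv t tT (e / D) (divr_gt0 e0 D0).
  have Xd : X (u t - v k) by exact: (seminormedB XN).
  have h1 : ip 0 ell (u t) (u t) = ip 0 ell (u t) (v k) + ip 0 ell (u t) (u t - v k).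
    have -> : ip 0 ell (u t) (u t - v k) = ip 0 ell (u t) (u t) - ip 0 ell (u t) (v k).
      by rewrite !(ip_sym _ _ (u t)); exact: ipBl.
    by ring.
  rewrite L2norm_sqr h1.
  have h2 := ipv k; have h3 := cauchy_schwarz Xut Xd.
  have h4 : N (v k) <= N (u t) + e / D.
    have := seminorm_leB XN Xut Xd; rewrite opprB addrC subrK => h; apply: le_trans h _.
    by rewrite lerD2l.
  have h5 : ip 0 ell (u t) (v k) <= c * (N (u t) + e / D).
    by apply: le_trans (ler_norm _) (le_trans h2 _); rewrite ler_wpM2l.
  have h6 : ip 0 ell (u t) (u t - v k) <= N (u t) * (e / D).
    by apply: le_trans (ler_norm _) (le_trans h3 _); rewrite ler_wpM2l// L2norm_ge0.
  have h7 : (c + N (u t)) * (e / D) <= e.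
    by rewrite mulrA ler_pdivrMr// mulrC ler_wpM2l ?lerDl// ltW.
  by lra.
have := L2norm_ge0 0 ell (u t); rewrite le_eqVlt => /predU1P[<-//|N0].
by move: nn; rewrite expr2 ler_pM2r.
Qed.

Variables (rho mu r : R -> R) (Brho Bmu Br rho0 r0 : R).
Hypotheses (rhoB : coefficient ell Brho rho) (muB : coefficient ell Bmu mu)
  (rB : coefficient ell Br r) (rho0_gt0 : 0 < rho0) (r0_gt0 : 0 < r0).
Hypothesis rho_ge : ae (fun x => x \in `]0, ell[ -> rho0 <= rho x).
Hypothesis r_ge : ae (fun x => x \in `]0, ell[ -> r0 <= r x).
Hypothesis mu_ge : ae (fun x => x \in `]0, ell[ -> 0 <= mu x).

(* [Z] and [V] stand for u_xx and u_t.  The time weights [phi] vanish at [T] only: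
   the zero initial data absorb the boundary term at 0. *)
Record beam_core M g Z V : Prop := BeamCore {
  core_Z : bochner_L2 T X N Z;
  core_V : bochner_L2 T X N V;
  core_velocity : forall w phi dphi, X w -> continuous dphi ->
    (forall s, is_derive s 1 phi (dphi s)) -> phi T = 0 ->
    \int[leb]_(s in `]0, T[) (ip 0 ell (prim2 0 (Z s)) w * dphi s) =
    - \int[leb]_(s in `]0, T[) (ip 0 ell (V s) w * phi s);
  core_momentum : forall z phi dphi, X z -> continuous dphi ->
    (forall s, is_derive s 1 phi (dphi s)) -> phi T = 0 ->
    \int[leb]_(s in `]0, T[) (wip ell rho (V s) (prim2 0 z) * dphi s) =
    - \int[leb]_(s in `]0, T[) ((M s * prim 0 z ell + g s * prim2 0 z ell
        - wip ell mu (V s) (prim2 0 z) - wip ell r (Z s) z) * phi s) }.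

(** A bound in W^{1,infty}: [M1] is the derivative of [M] and [c] its initial value, which is
    allowed to differ from 0. *)
Record bounded_datum S M : Prop := BoundedDatum {
  datum_L1 : L1 0 T M;
  datum_le : ae (fun s => s \in `]0, T[ -> `|M s| <= S);
  datum_repr : exists c M1, [/\ L1 0 T M1, `|c| <= S,
    ae (fun s => s \in `]0, T[ -> `|M1 s| <= S) &
    ae (fun s => s \in `]0, T[ -> M s = c + prim 0 M1 s)] }.

Lemma datum_derive_le S M C h ker H t : mollifier C h ker H -> bounded_datum S M ->
  0 <= S -> t <= T -> `|tconv T (derive1n 1 ker) M t| <= S * (ker t + 1).
Proof.
move=> m [LM _ [c [M1 [LM1 cS M1S ME]]]] S0 tT.
rewrite (tconv_derive_primitive T0 m tT (L1_measurable LM) LM1 ME) mulrDr mulr1.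
apply: le_trans (ler_normD _ _) (lerD _ (tconv_le T0 m t LM1 S0 M1S)).
by rewrite normrM (ger0_norm (mol_ge0 m _)) ler_wpM2r// (mol_ge0 m).
Qed.

(** The weight [s |-> - ker (t - s)] vanishes at [T] because [t <= T], but in general not at 0,
    which is why [beam_core] admits such weights. The equation then holds at each single time, and
    the mollified velocity is the double primitive of [Y1 t], hence a legitimate test function. *)
Lemma mollified_momentum M g Z V C h ker H Y Y1 K W W1 K' t : mollifier C h ker H ->
  beam_core M g Z V -> L1 0 T M -> L1 0 T g ->
  mollified ell T ker Z Y Y1 K -> mollified ell T ker V W W1 K' -> t <= T ->
  ae (fun x => x \in `]0, ell[ -> prim2 0 (Y1 t) x = W t x) /\
  forall z, X z -> wip ell rho (W1 t) (prim2 0 z) =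
    tconv T ker M t * prim 0 z ell + tconv T ker g t * prim2 0 z ell
      - wip ell mu (W t) (prim2 0 z) - wip ell r (Y t) z.
Proof.
move=> m core LM Lg mY mW tT; have XN := L2_seminormed (ltW ell0).
have cd : continuous (fun s => derive1n 1 ker (t - s)).
  by apply: reflect_continuous; exact: smooth_continuous (mol_smooth m).
have dk s := mol_reflect_derive m t s.
have kT : - ker (t - T) = 0 by rewrite (mol_left m) ?oppr0// subr_le0.
have XW := moll_in mW t; have XY1 := moll_in1 mY t; have XP := prim2_in_L2 ell0 XY1.
split=> [|z Xz].
  have Xd : X (prim2 0 (Y1 t) - W t) by exact: (seminormedB XN).
  have e w : X w -> ip 0 ell (prim2 0 (Y1 t)) w = ip 0 ell (W t) w.
    move=> Xw; rewrite (moll_blf1 mY _ (blf_prim2_ip ell0 Xw)) (moll_blf mW _ (blf_ip Xw)).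
    have := core_velocity core Xw cd dk kT.
    rewrite /tconv; under eq_Rintegral do rewrite mulrC; move=> ->.
    rewrite -mulN1r -RintegralZl//; first by apply: eq_Rintegral => s _; ring.
    rewrite (_ : (fun x => _) = (fun s => - (ker (t - s) * ip 0 ell (V s) w))).
      by apply: L1N; apply: (tconv_L1 m 0); exact: (blf_L1 ell0 (blf_ip Xw) (core_V core)).
    by apply/funext => s; ring.
  have d0 : N (prim2 0 (Y1 t) - W t) = 0.
    by apply/eqP; rewrite -sqrf_eq0 L2norm_sqr; apply/eqP; rewrite {1}/GRing.add/= ipBl// e// subrr.
  by apply: aeS (L2norm0_ae Xd d0) => x hx xI; apply/eqP; rewrite -subr_eq0; apply/eqP; exact: hx.
have XPz := prim2_in_L2 ell0 Xz.
rewrite (moll_blf1 mW _ (blf_wip rhoB XPz)) (moll_blf mW _ (blf_wip muB XPz)).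
rewrite (moll_blf mY _ (blf_wip rB Xz)) /tconv.
have := core_momentum core Xz cd dk kT.
under eq_Rintegral do rewrite mulrC; move=> ->.
have L1a := L1Z (prim 0 z ell) (tconv_L1 m 0 t LM).
have L1b := L1Z (prim2 0 z ell) (tconv_L1 m 0 t Lg).
have L1c := tconv_L1 m 0 t (blf_L1 ell0 (blf_wip muB XPz) (core_V core)).
have L1d := tconv_L1 m 0 t (blf_L1 ell0 (blf_wip rB Xz) (core_Z core)).
rewrite [X in _ = X + _ - _ - _]mulrC [X in _ = _ + X - _ - _]mulrC.
rewrite -!RintegralZl//; [|exact: (tconv_L1 m 0 t Lg)|exact: (tconv_L1 m 0 t LM)].
rewrite -RintegralD// -RintegralB//; last exact: L1D.
rewrite -RintegralB//; last by apply: L1B => //; exact: L1D.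
rewrite -mulN1r -RintegralZl//; first by apply: eq_Rintegral => s _; ring.
have LL := L1N (L1B (L1B (L1D L1a L1b) L1c) L1d).
by apply: L1_ext LL => s _; rewrite !derive1n0; ring.
Qed.

(** [sqrt ell * (1 + ell)] bounds the two traces together. In [2 + T], the growth of the modified
    energy accounts for 1 + T, the mass of the kernel plus the elapsed time, and the subtracted load
    terms for 1. The factor 2 is that of (x + y)^2 <= 2 (x^2 + y^2), and the denominator is the
    coercivity constant. *)
Definition energy_const :=
  Num.sqrt ell * (1 + ell) * (2 + T) * 2 / (Num.min rho0 r0 / 2).

Lemma energy_const_ge0 : 0 <= energy_const.
Proof.
have l0 := ltW ell0; have t0 := ltW T0.
rewrite /energy_const divr_ge0//; first by rewrite !mulr_ge0 ?sqrtr_ge0 ?addr_ge0.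
by rewrite divr_ge0// le_min !ltW.
Qed.

(* The work of the boundary loads contains the traces of u_t, which the energy does
   not control; subtracting loads times traces from the energy moves the time
   derivative to the loads. *)
Lemma mollified_energy M g Z V S C h ker H Y Y1 K W W1 K' t : mollifier C h ker H ->
  beam_core M g Z V -> 0 <= S -> bounded_datum S M -> bounded_datum S g ->
  mollified ell T ker Z Y Y1 K -> mollified ell T ker V W W1 K' -> t \in `[0, T] ->
  N (Y t) + N (W t) <= energy_const * S.
Proof.
move=> m core S0 dM dg mY mW tT.
have LM := datum_L1 dM; have Lg := datum_L1 dg.
have XY := moll_in mY; have XW := moll_in mW.
have c0 : 0 < Num.min rho0 r0 / 2 by rewrite divr_gt0// lt_min rho0_gt0.
have tr := blf_prim_trace ell0; have tr2 := blf_prim2_trace ell0.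
pose k := Num.sqrt ell * (1 + ell).
have k0 : 0 <= k by rewrite mulr_ge0 ?sqrtr_ge0 ?addr_ge0 ?ltW.
pose th s := prim 0 (Y s) ell; pose y s := prim2 0 (Y s) ell.
pose Mh := tconv T ker M; pose gh := tconv T ker g.
pose e s := 2^-1 * wip ell rho (W s) (W s) + 2^-1 * wip ell r (Y s) (Y s)
  - (Mh s * th s + gh s * y s).
have trace_le s a b A : 0 <= A -> `|a| <= A -> `|b| <= A ->
    `|a * th s + b * y s| <= A * (k * N (Y s)).
  move=> A0 aA bA; apply: le_trans (ler_normD _ _) _.
  have -> : A * (k * N (Y s)) = A * (Num.sqrt ell * N (Y s)) + A * (Num.sqrt ell * ell * N (Y s)).
    by rewrite /k; ring.
  rewrite !normrM lerD// ler_pM//; [exact: (blf_le tr)|exact: (blf_le tr2)].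
have MhS s : `|Mh s| <= S by exact: (tconv_le T0 m s LM S0 (datum_le dM)).
have ghS s : `|gh s| <= S by exact: (tconv_le T0 m s Lg S0 (datum_le dg)).
(* The estimate is quadratic in the norms on the left and, through the traces, linear in their
   supremum [G] on the right. *)
apply: (@sup_quadratic `[0, T]%classic (fun s => N (Y s) + N (W s)) (K + K')) => //.
- by exists t.
- by rewrite mulr_ge0// energy_const_ge0.
- by move=> s _; rewrite addr_ge0 ?L2norm_ge0//= lerD ?(moll_bound mY) ?(moll_bound mW).
move=> G hG {}t {}tT; have G0 : 0 <= G by apply: le_trans (hG t tT); rewrite addr_ge0 ?L2norm_ge0.
have YG s : s \in `[0, T] -> N (Y s) <= G.
  by move=> sT; apply: le_trans (hG s sT); rewrite lerDl L2norm_ge0.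
pose de s := wip ell rho (W1 s) (W s) + wip ell r (Y1 s) (Y s)
  - ((tconv T (derive1n 1 ker) M s * th s + Mh s * prim 0 (Y1 s) ell) +
     (tconv T (derive1n 1 ker) g s * y s + gh s * prim2 0 (Y1 s) ell)).
have dth s : is_derive s 1 th (prim 0 (Y1 s) ell).
  exact: (mollified_trace_derive ell0 m s (core_Z core) mY tr).
have dy s : is_derive s 1 y (prim2 0 (Y1 s) ell).
  exact: (mollified_trace_derive ell0 m s (core_Z core) mY tr2).
have dMh s : is_derive s 1 Mh (tconv T (derive1n 1 ker) M s) by exact: (tconv_is_derive m).
have dgh s : is_derive s 1 gh (tconv T (derive1n 1 ker) g s) by exact: (tconv_is_derive m).
have dW s := mollified_wip_derive ell0 s mW rhoB.
have dY s := mollified_wip_derive ell0 s mY rB.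
have dE s : is_derive s 1 e (de s).
  have h1 : is_derive s 1 (fun t => 2^-1 * wip ell rho (W t) (W t))
      (2^-1 * (2 * wip ell rho (W1 s) (W s))) by exact: is_deriveZ (dW s).
  have h2 : is_derive s 1 (fun t => 2^-1 * wip ell r (Y t) (Y t))
      (2^-1 * (2 * wip ell r (Y1 s) (Y s))) by exact: is_deriveZ (dY s).
  have h3 := is_deriveM (dMh s) (dth s); have h4 := is_deriveM (dgh s) (dy s).
  have := is_deriveB (is_deriveD h1 h2) (is_deriveD h3 h4).
  move=> h5; apply: (is_derive_eq h5); rewrite /de /GRing.scale/= {h1 h2 h3 h4 h5}.
  by field.
have de_le s : s \in `[0, T] -> de s <= S * (k * G) * (ker s + 1).
  move=> sT; have sT' : s <= T by move: sT; rewrite in_itv/= => /andP[].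
  have [P1 P2] := mollified_momentum m core LM Lg mY mW sT'.
  have XY1 := moll_in1 mY s; have XP := prim2_in_L2 ell0 XY1.
  (* Testing with [Y1 s], whose double primitive is the velocity [W s]: kinetic and elastic power
     balance the work of the loads, and the damping term has a sign. *)
  have := P2 _ XY1; rewrite (wip_ae rhoB (moll_in1 mW s) XP (XW s) P1).
  rewrite (wip_ae muB (XW s) XP (XW s) P1) (wip_sym _ _ (Y s)) => e1.
  have mu0 : 0 <= wip ell mu (W s) (W s).
    by have := wip_ge muB (XW s) mu_ge; rewrite mul0r.
  have ks0 := mol_ge0 m s.
  have A0 : 0 <= S * (ker s + 1) by rewrite mulr_ge0// addr_ge0.
  have := trace_le s _ _ _ A0 (datum_derive_le m dM S0 sT') (datum_derive_le m dg S0 sT').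
  move=> h1; have h2 : S * (ker s + 1) * (k * N (Y s)) <= S * (k * G) * (ker s + 1).
    rewrite [leRHS](_ : _ = S * (ker s + 1) * (k * G)); last by ring.
    by rewrite ler_wpM2l// ler_wpM2l// YG.
  have := le_trans h1 h2; rewrite ler_norml => /andP[h3 _].
  by rewrite /de e1 /Mh /gh; lra.
(* [H s + s] is a primitive of [ker s + 1]. Since [H <= 1], the spike due to the initial jump of the
   loads costs an amount independent of the width of the kernel. *)
pose F s := e s - S * (k * G) * (H s + s).
have dF s : is_derive s 1 F (de s - S * (k * G) * (ker s + 1)).
  have h1 : is_derive s 1 (fun s => H s + s) (ker s + 1).
    exact: is_deriveD (mol_prim m s) (is_derive_id s 1).
  have h2 : is_derive s 1 (fun s => S * (k * G) * (H s + s)) (S * (k * G) * (ker s + 1)).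
    exact: is_deriveZ h1.
  exact: is_deriveB (dE s) h2.
have t0T : 0 <= t <= T by move: tT; rewrite /= in_itv.
have /andP[t0 leT] := t0T.
have F0 : F 0 = 0.
  have NW0 := mollified_past m mW (lexx 0); have NY0 := mollified_past m mY (lexx 0).
  have q0 : wip ell rho (W 0) (W 0) = 0.
    by apply/eqP; rewrite -normr_le0; have := wip_le rhoB (XW 0) (XW 0); rewrite NW0 mulr0.
  have q1 : wip ell r (Y 0) (Y 0) = 0.
    by apply/eqP; rewrite -normr_le0; have := wip_le rB (XY 0) (XY 0); rewrite NY0 mulr0.
  rewrite /F /e q0 q1 /Mh /gh !(tconv_past _ m)// (mol_prim0 m)//; ring.
have Ft : F t <= 0.
  have := @mvt_le R F _ 0 t 0 t0 dF; rewrite F0 subr0 mul0r; apply => s.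
  rewrite in_itv/= => /andP[s0 st]; rewrite subr_le0; apply: de_le.
  by rewrite in_itv/= s0 (le_trans st).
have et : e t <= S * (k * G) * (1 + T).
  move: Ft; rewrite /F subr_le0 => eH; apply: le_trans eH _.
  apply: ler_wpM2l; first exact: mulr_ge0 S0 (mulr_ge0 k0 G0).
  exact: lerD (mol_prim_le1 m t) leT.
have E1 := wip_ge rhoB (XW t) rho_ge; have E2 := wip_ge rB (XY t) r_ge.
have h1 := trace_le t _ _ _ S0 (MhS t) (ghS t).
have h2 : S * (k * N (Y t)) <= S * (k * G) by rewrite ler_wpM2l// ler_wpM2l// YG.
have h3 : Mh t * th t + gh t * y t <= S * (k * G) by apply: le_trans (ler_norm _) (le_trans h1 h2).
pose c := Num.min rho0 r0.
have c1 : c * N (W t) ^+ 2 <= rho0 * N (W t) ^+ 2 by rewrite ler_wpM2r ?sqr_ge0// ge_min lexx.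
have c2 : c * N (Y t) ^+ 2 <= r0 * N (Y t) ^+ 2 by rewrite ler_wpM2r ?sqr_ge0// ge_min lexx orbT.
have h4 : c / 2 * (N (Y t) ^+ 2 + N (W t) ^+ 2) <= S * (k * G) * (2 + T).
  by move: et; rewrite /e; lra.
have h5 : (N (Y t) + N (W t)) ^+ 2 <= 2 * (N (Y t) ^+ 2 + N (W t) ^+ 2).
  by have := sqr_ge0 (N (Y t) - N (W t)); nra.
apply: le_trans h5 _.
have -> : energy_const * S * G = 2 * (S * (k * G) * (2 + T) / (c / 2)).
  by rewrite /energy_const -/k -/c; field; rewrite /c gt_eqF// lt_min rho0_gt0.
by rewrite ler_wpM2l// ler_pdivlMr// mulrC.
Qed.

Lemma core_estimate M g Z V S : beam_core M g Z V -> 0 <= S -> bounded_datum S M ->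
  bounded_datum S g ->
  ae (fun t => t \in `]0, T[ -> N (Z t) <= energy_const * S) /\
  ae (fun t => t \in `]0, T[ -> N (V t) <= energy_const * S).
Proof.
move=> core S0 dM dg; have [C C0 mex] := @mollifier_ex R.
have eS : 0 <= energy_const * S by rewrite mulr_ge0// energy_const_ge0.
have key h ker H t : mollifier C h ker H -> t \in `]0, T[ -> forall w, X w ->
    `|tconv T ker (fun s => ip 0 ell (Z s) w) t| <= energy_const * S * N w /\
    `|tconv T ker (fun s => ip 0 ell (V s) w) t| <= energy_const * S * N w.
  move=> m tT w Xw; have bw := blf_ip Xw.
  have [Y [Y1 [K mY]]] := mollified_ex ell0 m (core_Z core).
  have [W [W1 [K' mW]]] := mollified_ex ell0 m (core_V core).
  have tT' : t \in `[0, T] by apply: subset_itv_oo_cc tT.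
  have en := mollified_energy m core S0 dM dg mY mW tT'.
  rewrite -(moll_blf mY _ bw) -(moll_blf mW _ bw).
  have h1 := blf_le bw (moll_in mY t); have h2 := blf_le bw (moll_in mW t).
  split; [apply: le_trans h1 _|apply: le_trans h2 _]; rewrite mulrC ler_wpM2r ?L2norm_ge0//.
    by apply: le_trans en; rewrite lerDl L2norm_ge0.
  by apply: le_trans en; rewrite lerDr L2norm_ge0.
split; apply: (ae_norm_le_of_mollified _ eS C0 mex).
- exact: core_Z core.
- by move=> h ker H w t _ m Xw tT; exact: (key h ker H t m tT w Xw).1.
- exact: core_V core.
- by move=> h ker H w t _ m Xw tT; exact: (key h ker H t m tT w Xw).2.
Qed.

End EnergyEstimate.

(** * The dual space and initial conditions *)

Section EssentiallyBounded.
Context {R : realType}.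
Local Notation leb := (@lebesgue_measure R).

Lemma coefficient_of_Linfty (ell : R) c : Linfty 0 ell c -> exists B, coefficient ell B c.
Proof.
rewrite /Linfty/= inE => /andP[+ +]; rewrite inE/= => mc; rewrite inE/= /finite_norm unlock.
have -> : (0%E < leb setT)%E by rewrite -set_itvNyy lebesgue_measure_itv/= ltry.
move=> /ess_supr_bounded[B hB]; exists (Num.max B 0); split.
- by rewrite le_max lexx orbT.
- exact/(measurable_restrictT c (measurable_itv _)).
apply: aeS hB => x h xl; rewrite le_max; apply/orP; left.
by move: h; rewrite /= patchT// mem_setE.
Qed.

End EssentiallyBounded.

Section DualSpace.
Context {R : realType}.
Local Notation leb := (@lebesgue_measure R).
Variable (ell : R).
Hypothesis ell0 : 0 < ell.
Local Notation X := (L2 0 ell).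
Local Notation N := (L2norm 0 ell).
Local Notation nV := (H2norm 0 ell).
Local Notation Xd := (Hm2 ell).
Local Notation Nd := (Hm2norm ell).
Implicit Types (F G : (R -> R) -> R) (L : (R -> R) -> R) (v w : R -> R) (c d C : R).

Lemma Hm2_0 F : Xd F -> F 0 = 0.
Proof.
move=> [FL _]; have := FL 1 0 0 (V2_0 ell0) (V2_0 ell0).
rewrite (_ : (fun x : R => _) = 0); last by apply/funext => x; rewrite mulr0 addr0.
by move=> e; apply: (@addrI _ (F 0)); rewrite addr0 [RHS]e mul1r.
Qed.

Lemma Hm2_lin F c d v w : Xd F -> V2 ell v -> V2 ell w ->
  F (lin2 c d v w) = c * F v + d * F w.
Proof.
move=> XF Vv Vw; have [FL _] := XF; have V0 := V2_0 ell0.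
have [Vdw _] := V2_lin2 ell0 d 0 Vw Vw.
have Fw : F (lin2 d 0 w w) = d * F w.
  have := FL d w 0 Vw V0; rewrite (Hm2_0 XF) addr0 => <-; congr F.
  by apply/funext => x; rewrite /lin2 mul0r.
by rewrite -Fw -FL//; congr F; apply/funext => x; rewrite /lin2 mul0r addr0.
Qed.

Lemma Hm2_has_sup F : Xd F -> has_sup [set `|F v| | v in [set v | V2 ell v /\ nV v <= 1]].
Proof.
move=> XF; have [_ [C hC]] := XF; split.
  by exists `|F 0|, 0 => //; split; [exact: (V2_0 ell0)|rewrite (seminorm0 (V2_seminormed ell0))].
exists `|C| => _ [v [Vv v1] <-]; apply: le_trans (hC v Vv) _.
by apply: le_trans (ler_wpM2r (H2norm_ge0 _ _ _) (ler_norm C)) _; rewrite ler_piMr.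
Qed.

Lemma Hm2_le F v : Xd F -> V2 ell v -> `|F v| <= Nd F * nV v.
Proof.
move=> XF Vv; have := H2norm_ge0 0 ell v; rewrite le_eqVlt => /predU1P[v0|v0].
  by have [_ [C /(_ v Vv)]] := XF; rewrite -v0 !mulr0.
have [Vw _] := V2_lin2 ell0 (nV v)^-1 0 Vv Vv.
have e : F (lin2 (nV v)^-1 0 v v) = (nV v)^-1 * F v by rewrite Hm2_lin// mul0r addr0.
rewrite -ler_pdivrMr//; apply: le_trans (_ : `|F (lin2 (nV v)^-1 0 v v)| <= _).
  by rewrite e normrM mulrC ger0_norm// invr_ge0 ltW.
apply: ub_le_sup; first exact: (Hm2_has_sup XF).2.
exists (lin2 (nV v)^-1 0 v v) => //; split => //.
have h := H2norm_lin2 (nV v)^-1 0 (V2_H2 Vv) (V2_H2 Vv); apply: (le_trans h).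
by rewrite normr0 mul0r addr0 ger0_norm ?invr_ge0 ?(ltW v0)// mulVf ?lexx// lt0r_neq0.
Qed.

Lemma Hm2norm_le F c : 0 <= c -> (forall v, V2 ell v -> `|F v| <= c * nV v) -> Nd F <= c.
Proof.
move=> c0 h; apply: ge_sup.
  by exists `|F 0|, 0 => //; split; [exact: (V2_0 ell0)|rewrite (seminorm0 (V2_seminormed ell0))].
by move=> _ [v [Vv v1] <-]; apply: le_trans (h v Vv) _; rewrite ler_piMr.
Qed.

Lemma Hm2norm_ge0 F : Xd F -> 0 <= Nd F.
Proof.
move=> XF; apply: le_trans (normr_ge0 (F 0)) _; apply: ub_le_sup; first exact: (Hm2_has_sup XF).2.
by exists 0 => //; split; [exact: (V2_0 ell0)|rewrite (seminorm0 (V2_seminormed ell0))].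
Qed.

Lemma Hm2B F G : Xd F -> Xd G -> Xd (F - G).
Proof.
move=> XF XG; have [FL [C hC]] := XF; have [GL [D hD]] := XG; split.
  by move=> c v w Vv Vw; rewrite !fctE FL// GL//; ring.
exists (C + D) => v Vv; rewrite !fctE mulrDl; apply: le_trans (ler_normB _ _) _.
by rewrite lerD ?hC ?hD.
Qed.

Lemma Hm2_seminormed : seminormed Xd Nd.
Proof.
split.
- split=> [c v w _ _|]; first by rewrite mulr0 addr0.
  by exists 0 => v _; rewrite normr0 mul0r.
- exact: Hm2B.
- apply/eqP; rewrite eq_le; apply/andP; split.
    by apply: Hm2norm_le => // v _; rewrite normr0 mul0r.
  apply: Hm2norm_ge0; split=> [c v w _ _|]; first by rewrite mulr0 addr0.
  by exists 0 => v _; rewrite normr0 mul0r.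
- exact: Hm2norm_ge0.
- move=> F G XF XG; apply: Hm2norm_le; first by rewrite addr_ge0 ?Hm2norm_ge0.
  move=> v Vv; rewrite !fctE mulrDl; apply: le_trans (ler_normB _ _) _.
  by rewrite lerD// Hm2_le.
Qed.

Lemma cauchy_seq_cvg (f : nat -> R) : cauchy_seq (@Num.norm R R) f ->
  f n @[n --> \oo] --> lim (f n @[n --> \oo]).
Proof.
move=> fC; apply: cauchy_cvg; apply: cauchy_exP => e e0.
have e20 : 0 < e / 2 by rewrite divr_gt0.
have [n0 hn0] := fC _ e20; exists (f n0); exists n0 => // n /= n0n.
rewrite /ball/=; apply: le_lt_trans (hn0 _ _ (leqnn _) n0n) _.
by rewrite ltr_pdivrMr// ltr_pMr// ltr1n.
Qed.

(** The limit is taken pointwise: [F] is a true limit on V^2, and off V^2 it is whatever value [lim]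
    supplies. *)
Lemma Hm2_complete : complete_seminorm Xd Nd.
Proof.
move=> f Xf fC; pose F v := lim (f n v @[n --> \oo]).
have Xd' m n : Xd (f m - f n) by exact: Hm2B.
have cF v : V2 ell v -> f n v @[n --> \oo] --> F v.
  move=> Vv; apply: cauchy_seq_cvg => e e0.
  have D0 : 0 < nV v + 1 by rewrite ltr_wpDl// H2norm_ge0.
  have [n0 hn0] := fC _ (divr_gt0 e0 D0); exists n0 => m n n0m n0n.
  apply: le_trans (Hm2_le (Xd' m n) Vv) _.
  apply: le_trans (ler_wpM2r (H2norm_ge0 _ _ _) (hn0 _ _ n0m n0n)) _.
  by rewrite mulrAC ler_pdivrMr// ler_wpM2l ?lerDl// ltW.
have est e n0 : 0 <= e -> (forall m n, (n0 <= m)%N -> (n0 <= n)%N -> Nd (f m - f n) <= e) ->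
    forall n, (n0 <= n)%N -> forall v, V2 ell v -> `|f n v - F v| <= e * nV v.
  move=> e0 h n n0n v Vv.
  have c : `|f n v - f m v| @[m --> \oo] --> `|f n v - F v|.
    by apply: cvg_norm; apply: cvgB; [exact: cvg_cst|exact: cF].
  apply: (@ler_cvg_to _ _ _ _ (fun m => `|f n v - f m v|) (cst (e * nV v)) _ _ c).
    exact: cvg_cst.
  exists n0 => // m /= n0m; apply: le_trans (Hm2_le (Xd' n m) Vv) _.
  by rewrite ler_wpM2r ?H2norm_ge0// h.
have XF : Xd F.
  split=> [c v w Vv Vw|].
    have [Vl _] := V2_lin2 ell0 c 1 Vv Vw.
    have e : lin2 c 1 v w = (fun x => c * v x + w x) by apply/funext => x; rewrite /lin2 mul1r.
    have c1 : f n (lin2 c 1 v w) @[n --> \oo] --> c * F v + F w.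
      rewrite (_ : (fun n => _) = (fun n => c * f n v + f n w)); last first.
        by apply/funext => n; rewrite (Hm2_lin _ _ (Xf n))// mul1r.
      by apply: cvgD; [apply: cvgM; [exact: cvg_cst|exact: cF]|exact: cF].
    by rewrite -e; apply: (cvg_unique _ (cF _ Vl) c1).
  have [n0 hn0] := fC 1 ltr01; exists (1 + Nd (f n0)) => v Vv.
  rewrite mulrDl; apply: le_trans (_ : `|F v - f n0 v| + `|f n0 v| <= _).
    by apply: le_trans (ler_normD _ _); rewrite subrK.
  by rewrite lerD ?Hm2_le// distrC; exact: (est 1 n0).
exists F => //; apply/cvgr0Pnorm_le => e e0.
have [n0 hn0] := fC _ e0; exists n0 => // n /= n0n.
rewrite ger0_norm; last by apply: Hm2norm_ge0; exact: Hm2B.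
by apply: Hm2norm_le; [exact: ltW|move=> v Vv; rewrite !fctE; apply: (est e n0) => //; exact: ltW].
Qed.

Lemma blf_ae L C v w : bounded_functional ell L C -> X v -> X w ->
  ae (fun x => x \in `]0, ell[ -> v x = w x) -> L v = L w.
Proof.
move=> bL Xv Xw vw; apply/eqP; rewrite -subr_eq0 -(blfB bL)// -normr_le0.
apply: le_trans (blf_le bL (seminormedB (L2_seminormed (ltW ell0)) Xv Xw)) _.
rewrite (L2norm_ae (g := cst 0)) ?(seminorm0 (L2_seminormed (ltW ell0))) ?mulr0//.
- exact: (seminormedB (L2_seminormed (ltW ell0))).
- exact: L2_cst.
- by apply: aeS vw => x h xl; rewrite !fctE h// subrr.
Qed.

(** The second derivative is a contraction from V^2 to L^2, so a bound on an L^2 functional becomes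
    a bound in H^{-2}. *)
Lemma Hm2_intro L C : 0 <= C -> bounded_functional ell L C ->
  Xd (fun v => L (wD 0 ell 2 v)) /\ Nd (fun v => L (wD 0 ell 2 v)) <= C.
Proof.
move=> C0 bL; have h v : V2 ell v -> `|L (wD 0 ell 2 v)| <= C * nV v.
  move=> Vv; have [_ Xz] := V2_L2 Vv; apply: le_trans (blf_le bL Xz) _.
  by rewrite ler_wpM2l// V2norm_ge.
split; last exact: Hm2norm_le.
split; last by exists C.
move=> c v w Vv Vw; have [_ Xv] := V2_L2 Vv; have [_ Xw] := V2_L2 Vw.
have [Vl e] := V2_lin2 ell0 c 1 Vv Vw; have [_ Xl] := V2_L2 Vl.
have -> : (fun x => c * v x + w x) = lin2 c 1 v w by apply/funext => x; rewrite /lin2 mul1r.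
by rewrite (blf_ae bL Xl (L2_lin2 c 1 Xv Xw) e) (blf_lin bL)// mul1r.
Qed.

Lemma Hm2_eq F G : Xd F -> (forall v, V2 ell v -> G v = F v) ->
  Xd G /\ Nd (F - G) = 0.
Proof.
move=> [FL [C hC]] GF; have XG : Xd G.
  split; last by exists C => v Vv; rewrite GF//; exact: hC.
  move=> c v w Vv Vw; have [Vl _] := V2_lin2 ell0 c 1 Vv Vw.
  have e : (fun x => c * v x + w x) = lin2 c 1 v w by apply/funext => x; rewrite /lin2 mul1r.
  by rewrite e (GF _ Vl) -e FL// !GF.
split => //; apply/eqP; rewrite eq_le; apply/andP; split.
  by apply: Hm2norm_le => // v Vv; rewrite !fctE GF// subrr normr0 mul0r.
by apply: Hm2norm_ge0; apply: Hm2B => //; split => //; exists C.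
Qed.

End DualSpace.

(** * Zero initial values through continuous representatives *)

Section InitialCondition.
Context {R : realType} {V : zmodType}.
Variables (T : R) (X : set V) (N : V -> R).
Hypotheses (T0 : 0 < T) (XN : seminormed X N).
Implicit Types (u w : R -> V) (s t e d : R).
Let T0' : (0 : R) \in `[0, T]. Proof. by rewrite in_itv/= lexx ltW. Qed.

Record vanishing_rep u w : Prop := VanishingRep {
  vrep_in : forall t, t \in `[0, T] -> X (w t);
  vrep_cont : forall s, s \in `[0, T] -> forall e, 0 < e -> exists2 d, 0 < d &
    forall t, t \in `[0, T] -> `|t - s| < d -> N (w t - w s) <= e;
  vrep_ae : ae (fun t => t \in `]0, T[ -> N (w t - u t) = 0);
  vrep_0 : N (w 0) = 0 }.

Lemma initially0P u : initially0 T X N u <-> exists w, vanishing_rep u w.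
Proof.
split=> [[w [Xw cw we w0]]|[w [Xw cw we w0]]]; exists w; split => //.
  move=> s sT e e0; have /cvgr0Pnorm_le/(_ e e0) := cw s sT.
  move=> [d /= d0 hd]; exists d => // t tT ts.
  apply: le_trans (ler_norm _) (hd t _ tT).
  by rewrite /ball_/= distrC.
move=> s sT; apply/cvgr0Pnorm_le => e e0; have [d d0 hd] := cw s sT e e0.
exists d => //= t; rewrite /ball_/= => st tT.
rewrite ger0_norm; first by apply: hd => //; rewrite distrC.
by apply: (seminorm_ge0 XN); apply: (seminormedB XN); exact: Xw.
Qed.

Lemma initially0_map2 (h : V -> V -> V) C u1 u2 : 0 <= C ->
  (forall x y, X x -> X y -> X (h x y)) ->
  (forall x y, X x -> X y -> N (h x y) <= C * (N x + N y)) ->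
  (forall x y x' y', X x -> X y -> X x' -> X y' ->
    N (h x y - h x' y') <= C * (N (x - x') + N (y - y'))) ->
  valued_in T X u1 -> valued_in T X u2 ->
  initially0 T X N u1 -> initially0 T X N u2 ->
  initially0 T X N (fun t => h (u1 t) (u2 t)).
Proof.
move=> C0 hX hC hL Xu1 Xu2 /initially0P[w1 [Xw1 cw1 we1 w10]] /initially0P[w2 [Xw2 cw2 we2 w20]].
apply/initially0P; exists (fun t => h (w1 t) (w2 t)); split.
- by move=> t tT; apply: hX; [exact: Xw1|exact: Xw2].
- move=> s sT e e0; have De : 0 < e / (2 * (C + 1)) by rewrite divr_gt0// mulr_gt0// ltr_wpDl.
  have [d1 d10 h1] := cw1 s sT _ De; have [d2 d20 h2] := cw2 s sT _ De.
  exists (Num.min d1 d2); first by rewrite lt_min d10.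
  move=> t tT; rewrite lt_min => /andP[t1 t2].
  apply: le_trans (hL _ _ _ _ (Xw1 t tT) (Xw2 t tT) (Xw1 s sT) (Xw2 s sT)) _.
  apply: le_trans (ler_wpM2l C0 (lerD (h1 t tT t1) (h2 t tT t2))) _.
  have -> : e / (2 * (C + 1)) + e / (2 * (C + 1)) = e / (C + 1).
    by field; rewrite gt_eqF// ltr_wpDl.
  by rewrite mulrA ler_pdivrMr ?ltr_wpDl// mulrC ler_wpM2l ?lerDl// ltW.
- apply: aeS2 we1 we2 => t e1 e2 tT; have tT' := subset_itv_oo_cc tT.
  have Xa := Xw1 t tT'; have Xb := Xw2 t tT'; have Xc := Xu1 t tT; have Xd := Xu2 t tT.
  apply/eqP; rewrite eq_le; apply/andP; split.
    by apply: le_trans (hL _ _ _ _ Xa Xb Xc Xd) _; rewrite e1// e2// addr0 mulr0.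
  by apply: (seminorm_ge0 XN); apply: (seminormedB XN); exact: hX.
- have Xa := Xw1 _ T0'; have Xb := Xw2 _ T0'.
  apply/eqP; rewrite eq_le; apply/andP; split.
    by apply: le_trans (hC _ _ Xa Xb) _; rewrite w10 w20 addr0 mulr0.
  by apply: (seminorm_ge0 XN); exact: hX.
Qed.

Lemma initially0_ae u u' : valued_in T X u -> valued_in T X u' ->
  ae (fun t => t \in `]0, T[ -> N (u t - u' t) = 0) ->
  initially0 T X N u -> initially0 T X N u'.
Proof.
move=> Xu Xu' uu' /initially0P[w [Xw cw we w0]]; apply/initially0P; exists w; split => //.
apply: aeS2 we uu' => t e1 e2 tT; have Xwt := Xw t (subset_itv_oo_cc tT).
apply/eqP; rewrite eq_le; apply/andP; split.
  apply: le_trans (seminorm_dist XN Xwt (Xu t tT) (Xu' t tT)) _.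
  by rewrite e1// e2// addr0.
by apply: (seminorm_ge0 XN); apply: (seminormedB XN) => //; exact: Xu'.
Qed.

(** The distance of two continuous representatives is continuous in time, so a bound valid almost
    everywhere holds at every time, 0 included. *)
Lemma vrep_le u1 w1 u2 w2 c : valued_in T X u1 -> valued_in T X u2 ->
  vanishing_rep u1 w1 -> vanishing_rep u2 w2 ->
  ae (fun t => t \in `]0, T[ -> N (u1 t - u2 t) <= c) ->
  forall t, t \in `[0, T] -> N (w1 t - w2 t) <= c.
Proof.
move=> Xu1 Xu2 [Xw1 cw1 we1 _] [Xw2 cw2 we2 _] hc.
have Xw t : t \in `[0, T] -> X (w1 t - w2 t).
  by move=> tT; apply: (seminormedB XN); [exact: Xw1|exact: Xw2].
apply: (within_continuous_ae_le T0).
  apply/within_continuousP => s sT e e0; have e20 : 0 < e / 2 by rewrite divr_gt0.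
  have [d1 d10 h1] := cw1 s sT _ e20; have [d2 d20 h2] := cw2 s sT _ e20.
  exists (Num.min d1 d2); first by rewrite lt_min d10.
  move=> t tT; rewrite lt_min => /andP[t1 t2].
  apply: le_trans (ler_seminorm XN (Xw t tT) (Xw s sT)) _.
  have -> : w1 t - w2 t - (w1 s - w2 s) = (w1 t - w1 s) - (w2 t - w2 s).
    by rewrite !opprB addrACA [RHS]addrACA [- w2 t + _]addrC.
  apply: le_trans (seminorm_leB XN _ _) _; [| |].
  - by apply: (seminormedB XN); exact: Xw1.
  - by apply: (seminormedB XN); exact: Xw2.
  - by rewrite [leRHS]splitr lerD ?h1 ?h2.
apply: aeS3 we1 we2 hc => t e1 e2 h tT; have tT' := subset_itv_oo_cc tT.
have Xa := Xw1 t tT'; have Xb := Xw2 t tT'; have Xc := Xu1 t tT; have Xd := Xu2 t tT.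
apply: le_trans (seminorm_dist XN Xa Xc Xb) _; rewrite e1// add0r.
apply: le_trans (seminorm_dist XN Xc Xd Xb) _.
by rewrite (seminorm_distC XN Xd Xb) e2// addr0 h.
Qed.

(** By [vrep_le] the continuous representatives are uniformly Cauchy on all of [[0, T]]; their
    uniform limit is continuous, vanishes at 0 and represents [u]. *)
Lemma initially0_limit (un : nat -> R -> V) u (eps : nat -> R) :
  complete_seminorm X N -> (forall n, valued_in T X (un n)) -> valued_in T X u ->
  eps @ \oo --> (0 : R) ->
  (forall n, ae (fun t => t \in `]0, T[ -> N (un n t - u t) <= eps n)) ->
  (forall n, initially0 T X N (un n)) -> initially0 T X N u.
Proof.
move=> cX Xun Xu ceps hu hin.
have hw n : {w | vanishing_rep (un n) w} by apply: cid; exact/initially0P.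
pose w n := sval (hw n); have rw n : vanishing_rep (un n) (w n) := svalP (hw n).
have small e : 0 < e -> exists n0, forall n, (n0 <= n)%N -> eps n <= e.
  move=> e0; have /cvgr0Pnorm_le/(_ e e0)[n0 _ h] := ceps.
  by exists n0 => n n0n; apply: le_trans (ler_norm _) (h n n0n).
have wmn m n t : t \in `[0, T] -> N (w m t - w n t) <= eps m + eps n.
  apply: (vrep_le (Xun m) (Xun n) (rw m) (rw n)).
  apply: aeS2 (hu m) (hu n) => s h1 h2 sT.
  apply: le_trans (seminorm_dist XN (Xun m s sT) (Xu s sT) (Xun n s sT)) _.
  by rewrite (seminorm_distC XN (Xu s sT) (Xun n s sT)) lerD ?h1 ?h2.
have lim_ex t : {y | t \in `[0, T] -> X y /\ forall n, N (w n t - y) <= eps n}.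
  apply: cid; have [tT|_] := boolP (t \in `[0, T]); last by exists 0.
  have [|y Xy hy] := uniform_limit XN cX (fun n => vrep_in (rw n) tT) ceps; last by exists y.
  by move=> m n; exact: wmn.
pose y t := sval (lim_ex t); have Xy t tT := (svalP (lim_ex t) tT).1.
have wy n t : t \in `[0, T] -> N (w n t - y t) <= eps n.
  by move=> tT; exact: (svalP (lim_ex t) tT).2.
apply/initially0P; exists y; split.
- by move=> t tT; exact: Xy.
- move=> s sT e e0; have e40 : 0 < e / 3 by rewrite divr_gt0.
  have [n0 h0] := small _ e40; have {}h0 := h0 n0 (leqnn _).
  have [d d0 hd] := vrep_cont (rw n0) sT e40; exists d => // t tT ts.
  have Xa := Xy t tT; have Xb := Xy s sT; have Xc := vrep_in (rw n0) tT.
  have Xd := vrep_in (rw n0) sT.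
  apply: le_trans (seminorm_dist XN Xa Xc Xb) _.
  have h1 := seminorm_dist XN Xc Xd Xb; have h2 := wy n0 t tT; have h3 := wy n0 s sT.
  rewrite (seminorm_distC XN) in h2 => //; have h4 := hd t tT ts.
  by lra.
- have key : ae (fun t => forall n, t \in `]0, T[ -> N (w n t - un n t) = 0 /\ N (un n t - u t) <=
  eps n).
    apply: ae_forall => n; apply: aeS2 (vrep_ae (rw n)) (hu n) => t h1 h2 tT.
    by split; [exact: h1|exact: h2].
  apply: aeS key => t ht tT; have tT' := subset_itv_oo_cc tT.
  have Xa := Xy t tT'; have Xb := Xu t tT.
  apply/eqP; rewrite eq_le; apply/andP; split; last first.
    by apply: (seminorm_ge0 XN); exact: (seminormedB XN).
  apply/ler_addgt0Pr => e e0; have e20 : 0 < e / 2 by rewrite divr_gt0.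
  have [n0 h0] := small _ e20; have {}h0 := h0 n0 (leqnn _).
  have Xc := vrep_in (rw n0) tT'; have Xd := Xun n0 t tT; have [h1 h2] := ht n0 tT.
  have h3 := seminorm_dist XN Xa Xc Xb; have h4 := seminorm_dist XN Xc Xd Xb.
  have h5 := wy n0 t tT'; rewrite (seminorm_distC XN) in h5 => //.
  by lra.
- have Xa := Xy 0 T0'; apply/eqP; rewrite eq_le (seminorm_ge0 XN Xa) andbT.
  apply/ler_addgt0Pr => e e0; have [n0 h0] := small _ e0; have {}h0 := h0 n0 (leqnn _).
  have Xc := vrep_in (rw n0) T0'; have h1 := wy n0 0 T0'; have h2 := vrep_0 (rw n0).
  have h3 := ler_seminorm XN Xa Xc; rewrite h2 subr0 (ger0_norm (seminorm_ge0 XN Xa)) in h3.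
  rewrite (seminorm_distC XN) in h1 => //; rewrite add0r.
  exact: le_trans h3 (le_trans h1 h0).
Qed.

Lemma vrep_real u w (L : V -> R) C : 0 <= C ->
  (forall x y, X x -> X y -> `|L x - L y| <= C * N (x - y)) ->
  (forall x, X x -> `|L x| <= C * N x) -> valued_in T X u -> vanishing_rep u w ->
  [/\ {within `[0, T], continuous (fun t => L (w t))},
      ae (fun t => t \in `]0, T[ -> L (w t) = L (u t)) & L (w 0) = 0].
Proof.
move=> C0 LB LC Xu [Xw cw we w0]; split.
- apply/within_continuousP => s sT e e0.
  have De : 0 < e / (C + 1) by rewrite divr_gt0// ltr_wpDl.
  have [d d0 hd] := cw s sT _ De; exists d => // t tT ts.
  apply: le_trans (LB _ _ (Xw t tT) (Xw s sT)) _.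
  apply: le_trans (ler_wpM2l C0 (hd t tT ts)) _.
  by rewrite mulrA ler_pdivrMr ?ltr_wpDl// mulrC ler_wpM2l ?lerDl// ltW.
- apply: aeS we => t e tT; apply/eqP; rewrite -subr_eq0 -normr_le0.
  apply: le_trans (LB _ _ (Xw t (subset_itv_oo_cc tT)) (Xu t tT)) _.
  by rewrite e// mulr0.
- by apply/eqP; rewrite -normr_le0; apply: le_trans (LC _ (Xw _ T0')) _; rewrite w0 mulr0.
Qed.

End InitialCondition.

(** * Stability and closedness of weak solutions *)

Section BochnerSpaces.
Context {R : realType}.
Local Notation leb := (@lebesgue_measure R).
Variable T : R.
Hypothesis T0 : 0 < T.
Implicit Types (c d C s t : R).

Lemma weak_deriv_eq a b k (f g f' g' : R -> R) : {in `]a, b[, f =1 f'} ->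
  {in `]a, b[, g =1 g'} -> weak_deriv a b k f g -> weak_deriv a b k f' g'.
Proof.
move=> ff gg w phi tphi; have := w phi tphi.
rewrite (@eq_Rintegral _ _ _ leb _ (fun x => f' x * derive1n k phi x)); last first.
  by move=> x; rewrite inE/= => xab; rewrite ff.
rewrite [in RHS](@eq_Rintegral _ _ _ leb _ (fun x => g' x * phi x))//.
by move=> x; rewrite inE/= => xab; rewrite gg.
Qed.

Lemma bochner_norm (V : zmodType) (X : set V) (N : V -> R) (u : R -> V) f :
  seminormed X N -> valued_in T X u -> strongly_measurable T X N u -> L2 0 T f ->
  (forall t, t \in `]0, T[ -> N (u t) <= f t) -> bochner_L2 T X N u.
Proof.
move=> XN Xu su Lf uf; split => //.
apply: (L2_le _ Lf); first exact: (sm_norm XN).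
move=> t tT; rewrite ger0_norm; last by apply: (seminorm_ge0 XN); exact: Xu.
exact: le_trans (uf t tT) (ler_norm _).
Qed.

Lemma bochner_map2 (V V3 : zmodType) (X : set V) (X3 : set V3) (N : V -> R) (N3 : V3 -> R)
    (h : V -> V -> V3) C (u1 u2 : R -> V) :
  seminormed X3 N3 -> 0 <= C ->
  (forall x y, X x -> X y -> X3 (h x y)) ->
  (forall x y, X x -> X y -> N3 (h x y) <= C * (N x + N y)) ->
  (forall x y x' y', X x -> X y -> X x' -> X y' ->
    N3 (h x y - h x' y') <= C * (N (x - x') + N (y - y'))) ->
  bochner_L2 T X N u1 -> bochner_L2 T X N u2 -> bochner_L2 T X3 N3 (fun t => h (u1 t) (u2 t)).
Proof.
move=> XN3 C0 hX hC hL [Xu1 su1 Lu1] [Xu2 su2 Lu2].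
apply: (bochner_norm XN3 (f := fun t => C * (N (u1 t) + N (u2 t)))).
- by move=> t tT; apply: hX; [exact: Xu1|exact: Xu2].
- apply: (@sm_map2 R T _ _ _ X X X3 N N N3 h C) => // x y Xx Xy.
  by apply: (seminorm_ge0 XN3); exact: (seminormedB XN3).
- by apply: L2Z; exact: L2D.
- by move=> t tT; apply: hC; [exact: Xu1|exact: Xu2].
Qed.

Lemma bochner_map1 (V V3 : zmodType) (X : set V) (X3 : set V3) (N : V -> R) (N3 : V3 -> R)
    (h : V -> V3) C (u : R -> V) :
  seminormed X3 N3 -> 0 <= C -> (forall x, X x -> X3 (h x)) ->
  (forall x, X x -> N3 (h x) <= C * N x) ->
  (forall x x', X x -> X x' -> N3 (h x - h x') <= C * N (x - x')) ->
  bochner_L2 T X N u -> bochner_L2 T X3 N3 (fun t => h (u t)).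
Proof.
move=> XN3 C0 hX hC hL [Xu su Lu].
apply: (bochner_norm XN3 (f := fun t => C * N (u t))).
- by move=> t tT; apply: hX; exact: Xu.
- apply: (@sm_map1 R T _ _ X X3 N N3 h C) => // x y Xx Xy.
  by apply: (seminorm_ge0 XN3); exact: (seminormedB XN3).
- exact: L2Z.
- by move=> t tT; apply: hC; exact: Xu.
Qed.

(** The exceptional null sets of all pairs of indices are collected in [E], and the functions are
    set to 0 there, because strong measurability is required at every time. The modified functions
    converge everywhere with rate [a]. *)
Lemma bochner_limit (V : zmodType) (X : set V) (N : V -> R) (un : nat -> R -> V) (a : nat -> R) :
  seminormed X N -> complete_seminorm X N -> (forall n, bochner_L2 T X N (un n)) ->
  a @ \oo --> (0 : R) ->
  (forall m n, ae (fun t => t \in `]0, T[ -> N (un m t - un n t) <= a m + a n)) ->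
  exists2 u, bochner_L2 T X N u &
    forall n, ae (fun t => t \in `]0, T[ -> N (un n t - u t) <= a n).
Proof.
move=> XN cX Bun a0 hae.
have /ae_null[E [mE E0 hE]] : ae (fun t => forall m n, t \in `]0, T[ -> N (un m t - un n t) <= a m
  + a n).
  by apply: ae_forall => m; apply: ae_forall => n; exact: hae.
pose A := ~` E; have mA : measurable A by exact: measurableC.
pose vn n t := if t \in A then un n t else 0.
have Xvn n : valued_in T X (vn n).
  move=> t tT; rewrite /vn; case: ifP => _; last exact: (seminormed0 XN).
  by have [Xu _ _] := Bun n; exact: Xu.
have svn n : strongly_measurable T X N (vn n).
  have [_ su _] := Bun n; apply: sm_restrict => //; first exact: (seminormed0 XN).
  by rewrite subrr (seminorm0 XN).
have a_ge0 n : 0 <= a n.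
  have [t tT ht] : exists2 t, t \in `]0, T[ & (t \in `]0, T[ -> N (un n t - un n t) <= a n + a n).
    exact: (ae_dense T0 (hae n n)).
  by have := ht tT; rewrite subrr (seminorm0 XN) -mulr2n pmulrn_lge0.
have vmn m n t : t \in `]0, T[ -> N (vn m t - vn n t) <= a m + a n.
  move=> tT; rewrite /vn; case: ifPn => [|_]; first by rewrite inE => tA; exact: hE.
  by rewrite subrr (seminorm0 XN) addr_ge0.
have lim_ex t : {y | t \in `]0, T[ -> X y /\ forall n, N (vn n t - y) <= a n}.
  apply: cid; have [tT|_] := boolP (t \in `]0, T[); last by exists 0.
  have [|y Xy hy] := uniform_limit XN cX (fun n => Xvn n t tT) a0; last by exists y.
  by move=> m n; exact: vmn.
pose u t := sval (lim_ex t).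
have Xu : valued_in T X u by move=> t tT; exact: (svalP (lim_ex t) tT).1.
have vu n t : t \in `]0, T[ -> N (vn n t - u t) <= a n.
  by move=> tT; exact: (svalP (lim_ex t) tT).2.
have su : strongly_measurable T X N u.
  apply: (sm_limit XN Xvn Xu svn) => t tT.
  apply: (@squeeze_cvgr _ _ _ _ (cst 0) a) => //; last exact: cvg_cst.
  apply: nearW => n; rewrite vu// andbT; apply: (seminorm_ge0 XN).
  by apply: (seminormedB XN); [exact: Xvn|exact: Xu].
exists u.
  apply: (bochner_norm XN (f := fun t => N (un 0%N t) + a 0%N)) => //.
    by apply: L2D; [have [_ _] := Bun 0%N|exact: L2_cst].
  move=> t tT; have Xa := Xu t tT; have Xb := Xvn 0%N t tT.
  have h1 := seminorm_leB XN Xb (seminormedB XN Xb Xa); rewrite opprB addrC subrK in h1.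
  apply: le_trans h1 _; rewrite lerD ?vu// /vn; case: ifP => _ //.
  by rewrite (seminorm0 XN); apply: (seminorm_ge0 XN); have [Xu0 _ _] := Bun 0%N; exact: Xu0.
move=> n; apply/ae_null; exists E => // t tE tT.
by have := vu n t tT; rewrite /vn mem_set.
Qed.

Lemma L2norm_cvg_uniform (fn : nat -> R -> R) f C (a : nat -> R) :
  0 <= C -> (forall n, L2 0 T (fn n)) -> L2 0 T f -> a @ \oo --> (0 : R) ->
  (forall n, ae (fun t => t \in `]0, T[ -> `|fn n t - f t| <= C * a n)) ->
  L2norm 0 T (fn n - f) @[n --> \oo] --> (0 : R).
Proof.
move=> C0 Lfn Lf a0 h.
apply: (@squeeze_cvgr _ _ _ _ (cst 0) (fun n => C * `|a n| * Num.sqrt (T - 0))).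
- apply: nearW => n; rewrite L2norm_ge0; apply: L2norm_le_bounded; first exact: ltW.
  + by rewrite mulr_ge0.
  + exact: L2B.
  + by apply: aeS (h n) => t ht tT; apply: le_trans (ht tT) _; rewrite ler_wpM2l ?ler_norm.
- exact: cvg_cst.
- rewrite -[X in _ --> X](mul0r (Num.sqrt (T - 0))); apply: cvgM; last exact: cvg_cst.
  rewrite -(mulr0 C); apply: cvgM; first exact: cvg_cst.
  by rewrite -(normr0 R); apply: cvg_norm.
Qed.

End BochnerSpaces.

Section Evolution.
Context {R : realType}.
Local Notation leb := (@lebesgue_measure R).
Variables (ell T : R).
Hypotheses (ell0 : 0 < ell) (T0 : 0 < T).
Local Notation X := (L2 0 ell).
Local Notation N := (L2norm 0 ell).
Local Notation nV := (H2norm 0 ell).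
Local Notation Xd := (Hm2 ell).
Local Notation Nd := (Hm2norm ell).
Local Notation D2 := (wD 0 ell 2).
Implicit Types (f g w z v M : R -> R) (u ut : R -> R -> R) (c d C D s t : R)
  (L : (R -> R) -> R).
Let XN : seminormed X N := L2_seminormed (ltW ell0).
Let VN : seminormed (V2 ell) nV := V2_seminormed ell0.
Let XdN : seminormed Xd Nd := Hm2_seminormed ell0.

Lemma V2_norm_D2 v w : V2 ell v -> V2 ell w -> N (D2 v - D2 w) <= nV (v - w).
Proof. by move=> Vv Vw; have [_ _] := H2_dist_ge (V2_H2 Vv) (V2_H2 Vw). Qed.

Lemma bochner_V2 u : bochner_L2 T (V2 ell) nV u ->
  bochner_L2 T X N u /\ bochner_L2 T X N (fun t => D2 (u t)).
Proof.
move=> Bu; split.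
  apply: (bochner_map1 XN ler01 _ _ _ Bu (h := id)) => [v /V2_L2[]//|v Vv|v w Vv Vw].
    by rewrite mul1r; have [] := H2norm_ge 0 ell v.
  by rewrite mul1r; have [] := H2norm_ge 0 ell (v - w).
apply: (bochner_map1 XN ler01 _ _ _ Bu (h := D2)) => [v /V2_L2[]//|v Vv|v w Vv Vw].
  by rewrite mul1r V2norm_ge.
by rewrite mul1r V2_norm_D2.
Qed.

Variables (rho mu r : R -> R) (Brho Bmu Br : R).
Hypotheses (rhoB : coefficient ell Brho rho) (muB : coefficient ell Bmu mu)
  (rB : coefficient ell Br r).

(** Loads minus damping and elastic terms at one instant, as a functional of the second derivative
    [z] of the test function; [m], [k], [w], [z0] stand for the values of M, g, u_t, u_xx. *)
Definition force m k w z0 z : R := m * prim 0 z ell + k * prim2 0 z ell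
  - wip ell mu w (prim2 0 z) - wip ell r z0 z.

(* [weak_solution] without its witness for u_tt, the elements of V2 being written
   as double primitives of their second derivatives [z]. *)
Record evolution M g u ut : Prop := Evolution {
  evo_u : bochner_L2 T (V2 ell) nV u;
  evo_ut : bochner_L2 T X N ut;
  evo_velocity : forall w, X w ->
    weak_deriv 0 T 1 (fun t => ip 0 ell (u t) w) (fun t => ip 0 ell (ut t) w);
  evo_momentum : forall z, X z ->
    weak_deriv 0 T 1 (fun t => wip ell rho (ut t) (prim2 0 z))
      (fun t => force (M t) (g t) (ut t) (D2 (u t)) z);
  evo_init : initially0 T X N u;
  evo_init_ut : initially0 T Xd Nd (fun t => pivot ell rho (ut t)) }.

Lemma blf_wip_prim2 B (c : R -> R) w : coefficient ell B c -> X w ->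
  bounded_functional ell (fun z => wip ell c w (prim2 0 z)) (B * ell ^+ 2 * N w).
Proof.
move=> cB Xw; have bL := blf_prim2_ip ell0 (coef_L2 cB Xw).
have e z : wip ell c w (prim2 0 z) = ip 0 ell (prim2 0 z) (fun x => c x * w x).
  by rewrite ip_sym.
split=> [a b f g Xf Xg|f Xf]; first by rewrite !e; exact: (blf_lin bL).
have XP := prim2_in_L2 ell0 Xf; apply: le_trans (wip_le cB Xw XP) _.
have := prim2_L2norm ell0 Xf; rewrite subr0 => h.
rewrite [leRHS](_ : _ = B * N w * (ell ^+ 2 * N f)); last by ring.
by rewrite ler_wpM2l// mulr_ge0 ?L2norm_ge0// (coef_ge0 cB).
Qed.

Lemma blf_wip_r B (c : R -> R) w : coefficient ell B c -> X w ->
  bounded_functional ell (fun z => wip ell c w z) (B * N w).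
Proof.
move=> cB Xw; have bL := blf_wip cB Xw.
split=> [a b f g Xf Xg|f Xf]; last exact: (wip_le cB).
by rewrite !(wip_sym ell c w); exact: (blf_lin bL).
Qed.

Lemma pivot_prim2 w v : X w -> V2 ell v ->
  pivot ell rho w v = wip ell rho w (prim2 0 (D2 v)).
Proof.
move=> Xw Vv; have [Xv Xz] := V2_L2 Vv; have [vE _] := V2_repr ell0 Vv.
by apply: (wip_ae rhoB Xw Xv _ vE); exact: prim2_in_L2.
Qed.

Lemma pivot_Hm2 w : X w -> Xd (pivot ell rho w) /\ Nd (pivot ell rho w) <= Brho * ell ^+ 2 * N w.
Proof.
move=> Xw; have C0 : 0 <= Brho * ell ^+ 2 * N w.
  by rewrite mulr_ge0 ?L2norm_ge0// mulr_ge0 ?sqr_ge0// (coef_ge0 rhoB).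
have [XG _] := Hm2_intro ell0 C0 (blf_wip_prim2 rhoB Xw).
have bL := blf_wip_prim2 rhoB Xw.
split; first exact: (Hm2_eq ell0 XG (fun v Vv => pivot_prim2 Xw Vv)).1.
apply: Hm2norm_le => // v Vv; have [_ Xz] := V2_L2 Vv; rewrite pivot_prim2//.
apply: le_trans (blf_le bL Xz) _.
by rewrite ler_wpM2l// V2norm_ge.
Qed.

Lemma pivot_lin2 c d w w' v : X w -> X w' -> V2 ell v ->
  pivot ell rho (lin2 c d w w') v = c * pivot ell rho w v + d * pivot ell rho w' v.
Proof. by move=> Xw Xw' Vv; have [Xv _] := V2_L2 Vv; exact: (wip_lin c d rhoB). Qed.

Lemma pivotB_le w w' : X w -> X w' ->
  Nd (pivot ell rho w - pivot ell rho w') <= Brho * ell ^+ 2 * N (w - w').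
Proof.
move=> Xw Xw'; have XB := seminormedB XN Xw Xw'; have [X3 N3] := pivot_Hm2 XB.
apply: Hm2norm_le => //.
  by rewrite mulr_ge0 ?L2norm_ge0// mulr_ge0 ?sqr_ge0// (coef_ge0 rhoB).
move=> v Vv; apply: le_trans (_ : `|pivot ell rho (w - w') v| <= _).
  by rewrite (subr_lin2 w) pivot_lin2// mul1r mulN1r !fctE.
apply: le_trans (Hm2_le ell0 X3 Vv) _.
by rewrite ler_wpM2r ?H2norm_ge0.
Qed.

Definition force_bound (m k : R) w z0 : R := Num.sqrt ell * `|m| + Num.sqrt ell * ell * `|k|
  + Bmu * ell ^+ 2 * N w + Br * N z0.

Lemma force_bound_ge0 m k w z0 : 0 <= force_bound m k w z0.
Proof.
have l0 := ltW ell0; rewrite /force_bound !addr_ge0 ?mulr_ge0 ?sqrtr_ge0 ?L2norm_ge0 ?sqr_ge0//.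
  exact: (coef_ge0 muB).
exact: (coef_ge0 rB).
Qed.

Lemma force_blf m k w z0 : X w -> X z0 ->
  bounded_functional ell (force m k w z0) (force_bound m k w z0).
Proof.
move=> Xw Xz0; have b1 := blf_prim_trace ell0; have b2 := blf_prim2_trace ell0.
have b3 := blf_wip_prim2 muB Xw; have b4 := blf_wip_r rB Xz0.
split=> [a b f g Xf Xg|f Xf].
  have e1 := blf_lin b1 a b Xf Xg; have e2 := blf_lin b2 a b Xf Xg.
  have e3 := blf_lin b3 a b Xf Xg; have e4 := blf_lin b4 a b Xf Xg.
  rewrite /force; move: (prim 0 f ell) (prim 0 g ell) (prim 0 (lin2 a b f g) ell) e1 => p1 p2 _ ->.
  move: (prim2 0 f ell) (prim2 0 g ell) (prim2 0 (lin2 a b f g) ell) e2 => q1 q2 _ ->.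
  move: (wip ell mu w (prim2 0 f)) (wip ell mu w (prim2 0 g)) e3 => s1 s2 ->.
  move: (wip ell r z0 f) (wip ell r z0 g) e4 => t1 t2 ->.
  by ring.
have h1 := blf_le b1 Xf; have h2 := blf_le b2 Xf.
have h3 := blf_le b3 Xf; have h4 := blf_le b4 Xf.
rewrite /force /force_bound; apply: le_trans (ler_normB _ _) _.
rewrite mulrDl lerD//; apply: le_trans (ler_normB _ _) _.
rewrite mulrDl lerD//; apply: le_trans (ler_normD _ _) _.
rewrite mulrDl !normrM; apply: lerD; rewrite mulrAC mulrC.
  by rewrite ler_wpM2r.
by rewrite ler_wpM2r.
Qed.

Lemma force_lin2 c d m m' k k' w w' z0 z0' z : X w -> X w' -> X z0 -> X z0' -> X z ->
  force (c * m + d * m') (c * k + d * k') (lin2 c d w w') (lin2 c d z0 z0') z =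
  c * force m k w z0 z + d * force m' k' w' z0' z.
Proof.
move=> Xw Xw' Xz0 Xz0' Xz; have XP := prim2_in_L2 ell0 Xz.
by rewrite /force (wip_lin c d muB Xw Xw' XP) (wip_lin c d rB Xz0 Xz0' Xz); ring.
Qed.

Lemma force_diff m m' k k' w w' z0 z0' z : X w -> X w' -> X z0 -> X z0' -> X z ->
  `|force m k w z0 z - force m' k' w' z0' z| <=
  force_bound (m - m') (k - k') (w - w') (z0 - z0') * N z.
Proof.
move=> Xw Xw' Xz0 Xz0' Xz.
have := force_lin2 1 (-1) m m' k k' Xw Xw' Xz0 Xz0' Xz.
rewrite !mul1r !mulN1r -!subr_lin2 => <-.
apply: (blf_le (force_blf _ _ _ _)) => //; exact: (seminormedB XN).
Qed.

Lemma force_crep m k w z0 v : X w -> X z0 -> V2 ell v ->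
  m * crep 0 ell (wD 0 ell 1 v) ell + k * crep 0 ell v ell
    - \int[leb]_(x in `]0, ell[) (mu x * w x * v x)
    - \int[leb]_(x in `]0, ell[) (r x * z0 x * D2 v x) = force m k w z0 (D2 v).
Proof.
move=> Xw Xz0 Vv; have le : ell \in `[0, ell] by rewrite in_itv/= lexx ltW.
have [-> ->] := V2_crep ell0 Vv le; have [Xv Xz] := V2_L2 Vv; have [vE _] := V2_repr ell0 Vv.
by rewrite /force (wip_ae muB Xw (prim2_in_L2 ell0 Xz) Xv)//; apply: aeS vE => x h xl; rewrite h.
Qed.

(** The momentum equation itself supplies u_tt, namely the force composed with the second
    derivative. Strong measurability in H^{-2} follows from the Lipschitz dependence of the force on
    its arguments. *)
Lemma evolution_weak_solution M g u ut : L2 0 T M -> L2 0 T g -> evolution M g u ut ->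
  weak_solution ell T rho mu r M g u.
Proof.
move=> LM Lg ev; have [BZu BZ] := bochner_V2 (evo_u ev).
have [Xut _ _] := evo_ut ev; have [XZ _ _] := BZ; have [Vu _ _] := evo_u ev.
pose utt t v := force (M t) (g t) (ut t) (D2 (u t)) (D2 v).
have X0 : X 0 := seminormed0 XN; have N0 : N 0 = 0 := seminorm0 XN.
have hom v : V2 ell v -> weak_deriv 0 T 1 (fun t => pivot ell rho (ut t) v) (fun t => utt t v).
  move=> Vv; have [_ Xz] := V2_L2 Vv.
  apply: weak_deriv_eq (evo_momentum ev Xz) => t tT //.
  by rewrite pivot_prim2//; exact: Xut.
exists ut, utt; split.
- split; [exact: (evo_u ev)|exact: (evo_ut ev)|].
  have BR f : L2 0 T f -> bochner_L2 T setT (@Num.norm R R) f.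
    move=> Lf; split => //; first by apply: measurable_sm; exact: L2_L1.
    apply: (L2_le _ Lf); last by move=> t _; rewrite normr_id.
    by apply: measurableT_comp => //; exact: L2_measurable Lf.
  pose C1 := Num.sqrt ell + Num.sqrt ell * ell.
  have l0 := ltW ell0.
  have C10 : 0 <= C1 by rewrite addr_ge0 ?mulr_ge0 ?sqrtr_ge0.
  pose C2 := Bmu * ell ^+ 2 + Br.
  have muB0 := coef_ge0 muB; have rB0 := coef_ge0 rB.
  have C20 : 0 <= C2 by rewrite addr_ge0 ?mulr_ge0 ?sqr_ge0.
  have fb1 m k : force_bound m k 0 0 <= C1 * (`|m| + `|k|).
    have s0 := sqrtr_ge0 ell; have sl0 : 0 <= Num.sqrt ell * ell by rewrite mulr_ge0.
    have h1 : 0 <= Num.sqrt ell * `|k| by rewrite mulr_ge0.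
    have h2 : 0 <= Num.sqrt ell * ell * `|m| by rewrite mulr_ge0.
    by rewrite /force_bound N0 /C1; lra.
  have fb2 w z : force_bound 0 0 w z <= C2 * (N w + N z).
    have Nw := L2norm_ge0 0 ell w; have Nz := L2norm_ge0 0 ell z.
    have h1 : 0 <= Bmu * ell ^+ 2 * N z by rewrite !mulr_ge0 ?sqr_ge0.
    have h2 : 0 <= Br * N w by rewrite mulr_ge0.
    by rewrite /force_bound normr0 /C2; lra.
  have B1 : bochner_L2 T Xd Nd (fun t v => force (M t) (g t) 0 0 (D2 v)).
    apply: (bochner_map2 XdN C10 _ _ _ (BR M LM) (BR g Lg)
      (h := fun m k v => force m k 0 0 (D2 v))) => [m k _ _|m k _ _|m k m' k' _ _ _ _].
    + exact: (Hm2_intro ell0 (force_bound_ge0 m k 0 0) (force_blf m k X0 X0)).1.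
    + apply: le_trans (fb1 m k).
      exact: (Hm2_intro ell0 (force_bound_ge0 m k 0 0) (force_blf m k X0 X0)).2.
    + apply: Hm2norm_le => //; first by rewrite mulr_ge0// addr_ge0.
      move=> v Vv; have [_ Xz] := V2_L2 Vv; rewrite !fctE.
      apply: le_trans (force_diff m m' k k' X0 X0 X0 X0 Xz) _; rewrite subrr.
      by apply: ler_pM => //; [exact: force_bound_ge0|exact: L2norm_ge0|exact: V2norm_ge].
  have B2 : bochner_L2 T Xd Nd (fun t v => force 0 0 (ut t) (D2 (u t)) (D2 v)).
    apply: (bochner_map2 XdN C20 _ _ _ (evo_ut ev) BZ
      (h := fun w z0 v => force 0 0 w z0 (D2 v))) => [w z Xw Xz|w z Xw Xz|w z w' z' Xw Xz Xw' Xz'].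
    + exact: (Hm2_intro ell0 (force_bound_ge0 0 0 w z) (force_blf 0 0 Xw Xz)).1.
    + apply: le_trans (fb2 w z).
      exact: (Hm2_intro ell0 (force_bound_ge0 0 0 w z) (force_blf 0 0 Xw Xz)).2.
    + apply: Hm2norm_le => //; first by rewrite mulr_ge0// addr_ge0 ?L2norm_ge0.
      move=> v Vv; have [_ Xzv] := V2_L2 Vv; rewrite !fctE.
      apply: le_trans (force_diff 0 0 0 0 Xw Xw' Xz Xz' Xzv) _; rewrite !subrr.
      by apply: ler_pM => //; [exact: force_bound_ge0|exact: L2norm_ge0|exact: V2norm_ge].
  (* The force is split into a load part and a state part, each a Lipschitz function of two
     arguments. *)
  have -> : utt = (fun t => (fun v => force (M t) (g t) 0 0 (D2 v)) +
      (fun v => force 0 0 (ut t) (D2 (u t)) (D2 v))).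
    have w0 (c z : R -> R) : wip ell c 0 z = 0.
      rewrite /wip (@eq_Rintegral _ _ _ leb _ (cst 0)) ?Rintegral_cst ?mul0r// => x _.
      by rewrite mulr0 mul0r.
    by apply/funext => t; apply/funext => v; rewrite !fctE /utt /force !w0; ring.
  apply: (bochner_map2 XdN ler01 _ _ _ B1 B2 (h := fun F G => F + G)) => [F G|F G XF XG|F G F' G'
    XF XG XF' XG'].
  + exact: (seminormedD XdN).
  + by rewrite mul1r; exact: (seminormD XdN).
  + rewrite mul1r [X in Nd X](_ : _ = (F - F') + (G - G')); last by rewrite opprD addrACA.
    by apply: (seminormD XdN); exact: (seminormedB XdN).
- by split; [exact: evo_velocity ev|exact: hom].
- by split; [exact: evo_init ev|exact: evo_init_ut ev].
- move=> v Vv; apply: weak_deriv_eq (hom v Vv) => t tT //.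
  by rewrite force_crep//; [exact: Xut|exact: XZ].
Qed.

Lemma weak_solution_evolution M g u : weak_solution ell T rho mu r M g u ->
  exists ut, evolution M g u ut.
Proof.
move=> [ut [utt [[Bu But _] [hv _] [iu iut] hm]]]; exists ut; split => //.
move=> z Xz; have [Vv zE] := V2_prim2 ell0 Xz; have [_ XZ] := bochner_V2 Bu.
have [Xut _ _] := But; have {}XZ : valued_in T X (fun t => D2 (u t)) by have [] := XZ.
have [_ Xz'] := V2_L2 Vv.
apply: weak_deriv_eq (hm _ Vv) => t tT //.
rewrite force_crep//; [|exact: Xut|exact: XZ].
by apply: (blf_ae ell0 (force_blf _ _ (Xut t tT) (XZ t tT))).
Qed.

Lemma blf_L2 L D u : bounded_functional ell L D -> bochner_L2 T X N u ->
  L2 0 T (fun t => L (u t)).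
Proof.
move=> bL [Xu su Lu]; apply: (L2_le (sm_blf ell0 bL Xu su) (L2Z D Lu)) => t tT.
by apply: le_trans (ler_norm _); apply: (blf_le bL); exact: Xu.
Qed.

Lemma force_L2 M g u ut z : L2 0 T M -> L2 0 T g ->
  bochner_L2 T (V2 ell) nV u -> bochner_L2 T X N ut -> X z ->
  L2 0 T (fun t => force (M t) (g t) (ut t) (D2 (u t)) z).
Proof.
move=> LM Lg Bu But Xz; have [_ BZ] := bochner_V2 Bu.
have [XZ _ LZ] := BZ; have [Xut _ Lut] := But; have XP := prim2_in_L2 ell0 Xz.
apply: L2B; last exact: (blf_L2 (blf_wip rB Xz) BZ).
apply: L2B; last exact: (blf_L2 (blf_wip muB XP) But).
apply: L2D; first by under eq_fun do rewrite mulrC; exact: L2Z.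
by under eq_fun do rewrite mulrC; exact: L2Z.
Qed.

(** Compactly supported time weights are traded for weights vanishing at [T] only, by
    [weak_deriv_initial]. The initial condition in L^2 serves the velocity relation; the one in
    H^{-2}, evaluated at [prim2 0 z], serves the momentum relation. *)
Lemma evolution_core M g u ut : L2 0 T M -> L2 0 T g -> evolution M g u ut ->
  beam_core ell T rho mu r M g (fun t => D2 (u t)) ut.
Proof.
move=> LM Lg ev; have [Bu BZ] := bochner_V2 (evo_u ev); have But := evo_ut ev.
have [Xu _ _] := Bu; have [XZ _ _] := BZ; have [Xut _ _] := But; have [Vu _ _] := evo_u ev.
split => //.
- move=> w phi dphi Xw cd dp pT; have bw := blf_ip Xw.
  have [W rW] := (initially0P T XN u).1 (evo_init ev).
  have [||c e W0] := vrep_real T0 (L2norm_ge0 0 ell w) _ _ Xu rW (L := fun f => ip 0 ell f w).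
  + by move=> f g' Xf Xg; rewrite -(blfB bw)//; apply: (blf_le bw); exact: (seminormedB XN).
  + exact: (blf_le bw).
  have := weak_deriv_initial T0 (blf_L1 ell0 bw Bu) (blf_L1 ell0 bw But) (evo_velocity ev Xw) c e
    W0 cd dp pT.
  move=> <-; apply: eq_Rintegral => t; rewrite inE/= => tT; congr (_ * _).
  have [vE _] := V2_repr ell0 (Vu t tT); have Xp := prim2_in_L2 ell0 (XZ t tT).
  apply: ip_ae => //; [exact: Xu|by apply: aeS vE => x h xl; rewrite h|exact: aeW].
- move=> z phi dphi Xz cd dp pT; have XP := prim2_in_L2 ell0 Xz; have bw := blf_wip rhoB XP.
  have [Vv zE] := V2_prim2 ell0 Xz; have [_ Xz'] := V2_L2 Vv.
  have Xpiv : valued_in T Xd (fun t => pivot ell rho (ut t)).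
    by move=> t tT; exact: (pivot_Hm2 (Xut t tT)).1.
  have [W rW] := (initially0P T XdN _).1 (evo_init_ut ev).
  have [||c e W0] := vrep_real T0 (H2norm_ge0 0 ell (prim2 0 z)) _ _ Xpiv rW
    (L := fun F => F (prim2 0 z)).
  + move=> F G XF XG; rewrite mulrC.
    exact: (Hm2_le ell0 (seminormedB XdN XF XG) Vv).
  + by move=> F XF; rewrite mulrC; exact: Hm2_le.
  have L1f := L2_L1 (force_L2 LM Lg (evo_u ev) But Xz).
  exact: (weak_deriv_initial T0 (blf_L1 ell0 bw But) L1f (evo_momentum ev Xz) c e W0 cd dp pT).
Qed.

Lemma lin2B c d v w v' w' : lin2 c d v w - lin2 c d v' w' = lin2 c d (v - v') (w - w').
Proof. by apply/funext => x; rewrite /lin2 !fctE; ring. Qed.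

Lemma lin2_N_le c d f g : X f -> X g -> N (lin2 c d f g) <= (`|c| + `|d|) * (N f + N g).
Proof.
move=> Xf Xg; apply: le_trans (L2normD (L2Z c Xf) (L2Z d Xg)) _; rewrite !L2normZ//.
have Nf := L2norm_ge0 0 ell f; have Ng := L2norm_ge0 0 ell g.
by have h1 := mulr_ge0 (normr_ge0 c) Ng; have h2 := mulr_ge0 (normr_ge0 d) Nf; lra.
Qed.

(** Superposition, applied with coefficients 1 and -1 to differences and with 1/2 and 1/2 to
    midpoints. *)
Lemma evolution_lin2 c d M g u ut M' g' u' ut' :
  L2 0 T M -> L2 0 T g -> L2 0 T M' -> L2 0 T g' ->
  evolution M g u ut -> evolution M' g' u' ut' ->
  evolution (lin2 c d M M') (lin2 c d g g')
    (fun t => lin2 c d (u t) (u' t)) (fun t => lin2 c d (ut t) (ut' t)).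
Proof.
move=> LM Lg LM' Lg' ev ev'.
have [Bu BZ] := bochner_V2 (evo_u ev); have [Bu' BZ'] := bochner_V2 (evo_u ev').
have But := evo_ut ev; have But' := evo_ut ev'.
have [Xu _ _] := Bu; have [XZ _ _] := BZ; have [Xut _ _] := But; have [Vu _ _] := evo_u ev.
have [Xu' _ _] := Bu'; have [XZ' _ _] := BZ'; have [Xut' _ _] := But'; have [Vu' _ _] := evo_u ev'.
have cd0 : 0 <= `|c| + `|d| by rewrite addr_ge0.
have N2 f f1 f' f1' : X f -> X f1 -> X f' -> X f1' ->
    N (lin2 c d f f1 - lin2 c d f' f1') <= (`|c| + `|d|) * (N (f - f') + N (f1 - f1')).
  by move=> *; rewrite lin2B; apply: lin2_N_le; exact: (seminormedB XN).
split.
- have nle v w : V2 ell v -> V2 ell w -> nV (lin2 c d v w) <= (`|c| + `|d|) * (nV v + nV w).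
    move=> Vv Vw; apply: le_trans (H2norm_lin2 c d (V2_H2 Vv) (V2_H2 Vw)) _.
    have Nf := H2norm_ge0 0 ell v; have Ng := H2norm_ge0 0 ell w.
    by have h1 := mulr_ge0 (normr_ge0 c) Ng; have h2 := mulr_ge0 (normr_ge0 d) Nf; lra.
  apply: (bochner_map2 VN cd0 _ nle _ (evo_u ev) (evo_u ev')) => [v w Vv Vw|v w v' w' Vv Vw Vv'
    Vw'].
    exact: (V2_lin2 ell0 c d Vv Vw).1.
  by rewrite lin2B; apply: nle; exact: (seminormedB VN).
- apply: (bochner_map2 XN cd0 _ (lin2_N_le c d) N2 But But') => v w Xv Xw.
  exact: L2_lin2.
- move=> w Xw; have bw := blf_ip Xw.
  apply: weak_deriv_eq (weak_deriv_lin2 c d (blf_L1 ell0 bw Bu) (blf_L1 ell0 bw Bu')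
    (blf_L1 ell0 bw But) (blf_L1 ell0 bw But') (evo_velocity ev Xw) (evo_velocity ev' Xw)).
    by move=> t tT; rewrite (blf_lin bw)//; [exact: Xu|exact: Xu'].
  by move=> t tT; rewrite (blf_lin bw)//; [exact: Xut|exact: Xut'].
- move=> z Xz; have XP := prim2_in_L2 ell0 Xz; have bw := blf_wip rhoB XP.
  have L1f := L2_L1 (force_L2 LM Lg (evo_u ev) But Xz).
  have L1f' := L2_L1 (force_L2 LM' Lg' (evo_u ev') But' Xz).
  apply: weak_deriv_eq (weak_deriv_lin2 c d (blf_L1 ell0 bw But) (blf_L1 ell0 bw But')
    L1f L1f' (evo_momentum ev Xz) (evo_momentum ev' Xz)).
    by move=> t tT; rewrite (blf_lin bw)//; [exact: Xut|exact: Xut'].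
  move=> t tT; have Xa := Xut t tT; have Xb := Xut' t tT; have Xc := XZ t tT; have Xe := XZ' t tT.
  have [Vl e] := V2_lin2 ell0 c d (Vu t tT) (Vu' t tT); have [_ Xl] := V2_L2 Vl.
  rewrite [in LHS]/lin2 -force_lin2// /force; congr (_ - _).
  rewrite ![wip ell r _ z]wip_sym; apply: (wip_ae rB Xz (L2_lin2 c d Xc Xe) Xl).
  by apply: aeS e => x h xl; rewrite h.
- apply: (initially0_map2 T0 XN cd0 _ (lin2_N_le c d) N2 Xu Xu' (evo_init ev) (evo_init ev')).
  by move=> v w Xv Xw; exact: L2_lin2.
- have Xpiv1 : valued_in T Xd (fun t => pivot ell rho (ut t)).
    by move=> t tT; exact: (pivot_Hm2 (Xut t tT)).1.
  have Xpiv2 : valued_in T Xd (fun t => pivot ell rho (ut' t)).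
    by move=> t tT; exact: (pivot_Hm2 (Xut' t tT)).1.
  (* The combination of the two pivots and the pivot of the combined velocities are compared on V^2
     only; they are at distance 0 in H^{-2}, which is enough for [initially0_ae]. *)
  pose h (F G : (R -> R) -> R) v := c * F v + d * G v.
  have Xh F G : Xd F -> Xd G -> Xd (h F G).
    move=> XF XG; have [FL [C hC]] := XF; have [GL [D hD]] := XG; split.
      by move=> a v w Vv Vw; rewrite /h FL// GL//; ring.
    exists (`|c| * C + `|d| * D) => v Vv; apply: le_trans (ler_normD _ _) _.
    by rewrite mulrDl !normrM -!mulrA lerD ?ler_wpM2l ?hC ?hD.
  have hN F G : Xd F -> Xd G -> Nd (h F G) <= (`|c| + `|d|) * (Nd F + Nd G).
    move=> XF XG; have NF := Hm2norm_ge0 ell0 XF; have NG := Hm2norm_ge0 ell0 XG.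
    apply: Hm2norm_le => //; first by rewrite mulr_ge0// addr_ge0.
    move=> v Vv; have h1 := Hm2_le ell0 XF Vv; have h2 := Hm2_le ell0 XG Vv.
    have nv := H2norm_ge0 0 ell v.
    apply: le_trans (ler_normD _ _) _; rewrite !normrM.
    apply: le_trans (lerD (ler_wpM2l (normr_ge0 c) h1) (ler_wpM2l (normr_ge0 d) h2)) _.
    rewrite !mulrA -mulrDl ler_wpM2r//.
    by have h3 := mulr_ge0 (normr_ge0 c) NG; have h4 := mulr_ge0 (normr_ge0 d) NF; lra.
  have i0 : initially0 T Xd Nd (fun t => h (pivot ell rho (ut t)) (pivot ell rho (ut' t))).
    apply: (initially0_map2 T0 XdN cd0 Xh hN _ Xpiv1 Xpiv2 (evo_init_ut ev) (evo_init_ut ev')).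
    move=> F G F' G' XF XG XF' XG'.
    have -> : h F G - h F' G' = h (F - F') (G - G').
      by apply/funext => v; rewrite /h !fctE; ring.
    by apply: hN; exact: (seminormedB XdN).
  apply: (initially0_ae XdN _ _ _ i0).
  + by move=> t tT; apply: Xh; [exact: Xpiv1|exact: Xpiv2].
  + by move=> t tT; apply: (pivot_Hm2 _).1; apply: L2_lin2; [exact: Xut|exact: Xut'].
  + apply: aeW => t tT; apply: (Hm2_eq ell0 _ _).2.
      by apply: Xh; [exact: Xpiv1|exact: Xpiv2].
    by move=> v Vv; apply: pivot_lin2 => //; [exact: Xut|exact: Xut'].
Qed.

End Evolution.

Section NullSequences.
Context {R : realType}.
Implicit Types (x y : nat -> R).

Lemma null_seqD x y : x @ \oo --> (0 : R) -> y @ \oo --> (0 : R) ->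
  x n + y n @[n --> \oo] --> (0 : R).
Proof. by move=> cx cy; rewrite -(addr0 0); exact: cvgD. Qed.

Lemma null_seqZ c x : x @ \oo --> (0 : R) -> c * x n @[n --> \oo] --> (0 : R).
Proof. by move=> cx; rewrite -(mulr0 c); apply: cvgM => //; exact: cvg_cst. Qed.

End NullSequences.

(** * Continuous dependence on the input *)

Section EvolutionEstimates.
Context {R : realType}.
Local Notation leb := (@lebesgue_measure R).
Variables (ell T : R).
Hypotheses (ell0 : 0 < ell) (T0 : 0 < T).
Local Notation X := (L2 0 ell).
Local Notation N := (L2norm 0 ell).
Local Notation nV := (H2norm 0 ell).
Local Notation Xd := (Hm2 ell).
Local Notation Nd := (Hm2norm ell).
Local Notation D2 := (wD 0 ell 2).
Local Notation nT := (H2norm 0 T).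
Implicit Types (f g w z v M : R -> R) (u ut : R -> R -> R) (c d C D S s t : R)
  (L : (R -> R) -> R).
Let XN : seminormed X N := L2_seminormed (ltW ell0).
Let VN : seminormed (V2 ell) nV := V2_seminormed ell0.
Let XdN : seminormed Xd Nd := Hm2_seminormed ell0.
Let TN : seminormed (H2 0 T) nT := H2_seminormed 0 T.
Variables (rho mu r : R -> R) (Brho Bmu Br rho0 r0 : R).
Hypotheses (rhoB : coefficient ell Brho rho) (muB : coefficient ell Bmu mu)
  (rB : coefficient ell Br r) (rho0_gt0 : 0 < rho0) (r0_gt0 : 0 < r0).
Hypothesis rho_ge : ae (fun x => x \in `]0, ell[ -> rho0 <= rho x).
Hypothesis r_ge : ae (fun x => x \in `]0, ell[ -> r0 <= r x).
Hypothesis mu_ge : ae (fun x => x \in `]0, ell[ -> 0 <= mu x).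
Local Notation evolution := (evolution ell T rho mu r).

Lemma H2_L2 M : H2 0 T M -> L2 0 T M. Proof. by case/H2P. Qed.

Lemma H2_bounded_datum M S : H2 0 T M -> H1const 0 T * nT M <= S -> bounded_datum T S M.
Proof.
move=> HM MS; have [c [M1 [cM1 cS M1S hS ME]]] := H2_bound T0 HM.
have LM := H2_L2 HM; split; first exact: L2_L1.
  apply: aeS ME => t h tT; rewrite h//; apply: le_trans MS; apply: hS.
  exact: subset_itv_oo_cc.
exists c, M1; split => //; [|exact: le_trans cS MS|].
  apply: (@L1_bounded _ _ _ _ (H1const 0 T * nT M)).
    exact: within_continuous_measurable.
  by move=> t tT; apply: M1S; exact: subset_itv_oo_cc.
apply: aeW => t tT; apply: le_trans MS; apply: M1S.
exact: subset_itv_oo_cc.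
Qed.

Lemma datum_cvg (Mn : nat -> R -> R) M : (forall n, H2 0 T (Mn n)) -> H2 0 T M ->
  nT (Mn n - M) @[n --> \oo] --> (0 : R) ->
  exists S : nat -> R, [/\ forall n, 0 <= S n,
    forall n, bounded_datum T (S n) (Mn n - M) & S @ \oo --> (0 : R)].
Proof.
move=> HMn HM cM; exists (fun n => H1const 0 T * nT (Mn n - M)); split.
- move=> n; rewrite mulr_ge0 ?H1const_ge0//.
  by apply: (seminorm_ge0 TN); exact: (seminormedB TN).
- by move=> n; apply: H2_bounded_datum => //; exact: (seminormedB TN).
- exact: null_seqZ.
Qed.

Definition stability_const := energy_const ell T rho0 r0 * H1const 0 T.

Lemma stability_const_ge0 : 0 <= stability_const.
Proof. by rewrite mulr_ge0 ?H1const_ge0// energy_const_ge0. Qed.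

(** By linearity the energy estimate applies to the difference of the solutions, driven by the
    difference of the inputs. With equal inputs it yields uniqueness. *)
Lemma evolution_stability M g u ut M' g' u' ut' :
  H2 0 T M -> H2 0 T g -> H2 0 T M' -> H2 0 T g' ->
  evolution M g u ut -> evolution M' g' u' ut' ->
  ae (fun t => t \in `]0, T[ ->
    N (D2 (u t) - D2 (u' t)) <= stability_const * (nT (M - M') + nT (g - g'))) /\
  ae (fun t => t \in `]0, T[ ->
    N (ut t - ut' t) <= stability_const * (nT (M - M') + nT (g - g'))).
Proof.
move=> HM Hg HM' Hg' ev ev'.
have HdM := seminormedB TN HM HM'; have Hdg := seminormedB TN Hg Hg'.
have NdM := seminorm_ge0 TN HdM; have Ndg := seminorm_ge0 TN Hdg.
have evd := evolution_lin2 ell0 T0 rhoB muB rB 1 (-1) (H2_L2 HM) (H2_L2 Hg) (H2_L2 HM') (H2_L2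
  Hg') ev ev'.
rewrite -(subr_lin2 M) -(subr_lin2 g) in evd.
have core := evolution_core ell0 T0 rhoB muB rB (H2_L2 HdM) (H2_L2 Hdg) evd.
pose S := H1const 0 T * (nT (M - M') + nT (g - g')).
have k0 : 0 <= H1const 0 T by exact: H1const_ge0.
have S0 : 0 <= S by rewrite mulr_ge0// addr_ge0.
have dM : bounded_datum T S (M - M') by apply: H2_bounded_datum; rewrite // ler_wpM2l// lerDl.
have dg : bounded_datum T S (g - g') by apply: H2_bounded_datum; rewrite // ler_wpM2l// lerDr.
have [h1 h2] := core_estimate ell0 T0 rhoB muB rB rho0_gt0 r0_gt0 rho_ge r_ge mu_ge core S0 dM dg.
have [Vu _ _] := evo_u ev; have [Vu' _ _] := evo_u ev'.
rewrite /stability_const -mulrA; split.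
  apply: aeS h1 => t h tT; have Va := Vu t tT; have Vb := Vu' t tT.
  have [Vl e] := V2_lin2 ell0 1 (-1) Va Vb; have [_ Xl] := V2_L2 Vl.
  have [_ Xa] := V2_L2 Va; have [_ Xb] := V2_L2 Vb.
  by rewrite subr_lin2 -(L2norm_ae Xl (L2_lin2 1 (-1) Xa Xb) e) h.
by apply: aeS h2 => t h tT; rewrite (subr_lin2 (ut t)) h.
Qed.

Lemma blf_L2norm_cvg L D (un : nat -> R -> R -> R) u (b : nat -> R) :
  bounded_functional ell L D -> 0 <= D ->
  (forall n, bochner_L2 T X N (un n)) -> bochner_L2 T X N u -> b @ \oo --> (0 : R) ->
  (forall n, ae (fun t => t \in `]0, T[ -> N (un n t - u t) <= b n)) ->
  L2norm 0 T ((fun t => L (un n t)) - (fun t => L (u t))) @[n --> \oo] --> (0 : R).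
Proof.
move=> bL D0 Bun Bu cb hb.
apply: (L2norm_cvg_uniform T0 D0 (fun n => blf_L2 ell0 bL (Bun n)) (blf_L2 ell0 bL Bu) cb).
move=> n; apply: aeS (hb n) => t h tT.
have Xa : X (un n t) by have [Xw _ _] := Bun n; exact: Xw.
have Xb : X (u t) by have [Xw _ _] := Bu; exact: Xw.
rewrite -(blfB bL)//; apply: le_trans (blf_le bL (seminormedB XN Xa Xb)) _.
by rewrite ler_wpM2l// h.
Qed.

(** The stability bound makes u_xx and u_t Cauchy with a rate independent of time. This uniformity
    carries the initial conditions to the limit; for the weak equations the resulting convergence in
    L^2(0, T) of the scalar terms is enough. *)
Lemma evolution_limit (Mn gn : nat -> R -> R) (un utn : nat -> R -> R -> R) M g :
  (forall n, H2 0 T (Mn n)) -> (forall n, H2 0 T (gn n)) -> H2 0 T M -> H2 0 T g ->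
  nT (Mn n - M) @[n --> \oo] --> (0 : R) -> nT (gn n - g) @[n --> \oo] --> (0 : R) ->
  (forall n, evolution (Mn n) (gn n) (un n) (utn n)) ->
  exists u ut (a : nat -> R), [/\ evolution M g u ut, a @ \oo --> (0 : R) &
    forall n, ae (fun t => t \in `]0, T[ -> nV (un n t - u t) <= a n)].
Proof.
move=> HMn Hgn HM Hg cM cg evn.
pose q n := nT (Mn n - M) + nT (gn n - g).
have q0 n : 0 <= q n by rewrite addr_ge0//; apply: (seminorm_ge0 TN); exact: (seminormedB TN).
have cq : q @ \oo --> (0 : R) by exact: null_seqD.
have k0 := stability_const_ge0; have v0 := V2const_ge0 ell0.
have nTmn m n : nT (Mn m - Mn n) + nT (gn m - gn n) <= q m + q n.
  have h1 := seminorm_dist TN (HMn m) HM (HMn n); have h2 := seminorm_dist TN (Hgn m) Hg (Hgn n).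
  rewrite (seminorm_distC TN HM (HMn n)) in h1; rewrite (seminorm_distC TN Hg (Hgn n)) in h2.
  by rewrite /q addrACA; exact: lerD h1 h2.
(* [e] is the rate for u_xx and u_t, and [a] the resulting rate for u in the norm of V^2. *)
pose e n := stability_const * q n; pose a n := V2const ell * e n.
have e0 n : 0 <= e n by rewrite mulr_ge0.
have ce : e @ \oo --> (0 : R) by exact: null_seqZ.
have ca : a @ \oo --> (0 : R) by exact: null_seqZ.
have st m n := evolution_stability (HMn m) (Hgn m) (HMn n) (Hgn n) (evn m) (evn n).
have stE m n : stability_const * (nT (Mn m - Mn n) + nT (gn m - gn n)) <= e m + e n.
  by rewrite /e -mulrDr ler_wpM2l.
have [|u Bu hu] := bochner_limit T0 VN (V2_complete ell0) (fun n => evo_u (evn n)) ca.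
  move=> m n; apply: aeS (st m n).1 => t h tT.
  have [Va _ _] := evo_u (evn m); have [Vb _ _] := evo_u (evn n).
  have {}Va := Va t tT; have {}Vb := Vb t tT; have [Vl eD] := V2_subr ell0 Va Vb.
  have [_ Xl] := V2_L2 Vl; have [_ Xa] := V2_L2 Va; have [_ Xb] := V2_L2 Vb.
  apply: le_trans (V2norm_le ell0 Vl) _; rewrite /a -mulrDr ler_wpM2l//.
  rewrite (L2norm_ae Xl (seminormedB XN Xa Xb) eD).
  exact: le_trans (h tT) (stE m n).
have [|ut But hut] := bochner_limit T0 XN (L2_complete (ltW ell0)) (fun n => evo_ut (evn n)) ce.
  by move=> m n; apply: aeS (st m n).2 => t h tT; exact: le_trans (h tT) (stE m n).
have [Xu _ _] := (bochner_V2 ell0 Bu).1; have [XZ _ _] := (bochner_V2 ell0 Bu).2.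
have [Vu _ _] := Bu; have [Xut _ _] := But.
have Vun n : valued_in T (V2 ell) (un n) by have [] := evo_u (evn n).
have Xun n : valued_in T X (un n) by have [[]] := bochner_V2 ell0 (evo_u (evn n)).
have XZn n : valued_in T X (fun t => D2 (un n t)) by have [_ []] := bochner_V2 ell0 (evo_u (evn n)).
have Xutn n : valued_in T X (utn n) by have [] := evo_ut (evn n).
have huX n : ae (fun t => t \in `]0, T[ -> N (un n t - u t) <= a n).
  apply: aeS (hu n) => t h tT; apply: le_trans (h tT).
  by have [] := H2norm_ge 0 ell (un n t - u t).
have huZ n : ae (fun t => t \in `]0, T[ -> N (D2 (un n t) - D2 (u t)) <= a n).
  apply: aeS (hu n) => t h tT; apply: le_trans (h tT).
  by apply: V2_norm_D2 => //; [exact: Vun|exact: Vu].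
exists u, ut, a; split => //; split => //.
- move=> w Xw; have bw := blf_ip Xw; have w0 := L2norm_ge0 0 ell w.
  have Bun n := (bochner_V2 ell0 (evo_u (evn n))).1; have Bu' := (bochner_V2 ell0 Bu).1.
  have Butn n := evo_ut (evn n).
  apply: (weak_deriv_cvg (fun n => blf_L2 ell0 bw (Bun n)) (blf_L2 ell0 bw Bu')
    (fun n => blf_L2 ell0 bw (Butn n)) (blf_L2 ell0 bw But)
    (blf_L2norm_cvg bw w0 Bun Bu' ca huX) (blf_L2norm_cvg bw w0 Butn But ce hut)).
  by move=> n; exact: (evo_velocity (evn n) Xw).
- move=> z Xz; have XP := prim2_in_L2 ell0 Xz; have bw := blf_wip rhoB XP.
  have w0 : 0 <= Brho * N (prim2 0 z) by rewrite mulr_ge0 ?L2norm_ge0// (coef_ge0 rhoB).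
  have Butn n := evo_ut (evn n).
  have LF n := force_L2 ell0 muB rB (H2_L2 (HMn n)) (H2_L2 (Hgn n)) (evo_u (evn n)) (Butn n) Xz.
  have LF0 := force_L2 ell0 muB rB (H2_L2 HM) (H2_L2 Hg) Bu But Xz.
  have cF : L2norm 0 T ((fun t => force ell mu r (Mn n t) (gn n t) (utn n t) (D2 (un n t)) z) -
      (fun t => force ell mu r (M t) (g t) (ut t) (D2 (u t)) z)) @[n --> \oo] --> (0 : R).
    have [sM [sM0 dM csM]] := datum_cvg HMn HM cM; have [sg [sg0 dg csg]] := datum_cvg Hgn Hg cg.
    clearbody a e.
    pose b n := Num.sqrt ell * sM n + Num.sqrt ell * ell * sg n + Bmu * ell ^+ 2 * e n + Br * a n.
    have cb : b @ \oo --> (0 : R).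
      by apply: (null_seqD (null_seqD (null_seqD _ _) _) _); exact: null_seqZ.
    apply: (L2norm_cvg_uniform T0 (L2norm_ge0 0 ell z) LF LF0 cb) => n.
    have h12 : ae (fun t => t \in `]0, T[ -> `|Mn n t - M t| <= sM n /\ `|gn n t - g t| <= sg n).
      apply: aeS2 (datum_le (dM n)) (datum_le (dg n)) => t h1 h2 tT.
      by split; [exact: h1|exact: h2].
    apply: aeS3 h12 (hut n) (huZ n) => t hMg h3 h4 tT.
    have [h1 h2] := hMg tT; have Xa := Xutn n t tT; have Xb := Xut t tT.
    have Xc := XZn n t tT; have Xe := XZ t tT.
    apply: le_trans (force_diff ell0 muB rB (Mn n t) (M t) (gn n t) (g t) Xa Xb Xc Xe Xz) _.
    rewrite mulrC ler_wpM2l ?L2norm_ge0// /b /force_bound.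
    have s0 := sqrtr_ge0 ell; have sl0 : 0 <= Num.sqrt ell * ell by rewrite mulr_ge0// ltW.
    have m0 : 0 <= Bmu * ell ^+ 2 by rewrite mulr_ge0 ?sqr_ge0// (coef_ge0 muB).
    apply: lerD; [apply: lerD; [apply: lerD|]|].
    + by apply: (ler_wpM2l s0); exact: h1.
    + by apply: (ler_wpM2l sl0); exact: h2.
    + by apply: (ler_wpM2l m0); exact: h3.
    + by apply: (ler_wpM2l (coef_ge0 rB)); exact: h4.
  apply: (weak_deriv_cvg (fun n => blf_L2 ell0 bw (Butn n)) (blf_L2 ell0 bw But) LF LF0
    (blf_L2norm_cvg bw w0 Butn But ce hut) cF).
  by move=> n; exact: (evo_momentum (evn n) Xz).
- exact: (initially0_limit T0 XN (L2_complete (ltW ell0)) Xun Xu ca huX (fun n => evo_init (evn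
  n))).
- have c0 : 0 <= Brho * ell ^+ 2 by rewrite mulr_ge0 ?sqr_ge0// (coef_ge0 rhoB).
  apply: (initially0_limit T0 XdN (Hm2_complete ell0) (un := fun n t => pivot ell rho (utn n t))
    (eps := fun n => Brho * ell ^+ 2 * e n)).
  + by move=> n t tT; apply: (pivot_Hm2 ell0 rhoB (Xutn n t tT)).1.
  + by move=> t tT; apply: (pivot_Hm2 ell0 rhoB (Xut t tT)).1.
  + by exact: null_seqZ.
  + move=> n; apply: aeS (hut n) => t h tT.
    apply: le_trans (pivotB_le ell0 rhoB (Xutn n t tT) (Xut t tT)) _.
    by rewrite ler_wpM2l// h.
  + by move=> n; exact: (evo_init_ut (evn n)).
Qed.

End EvolutionEstimates.

(** * The minimization problem *)

Section MinimizingSequence.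
Context {R : realType}.

(* Nearly minimal norm elements of nested convex sets form a Cauchy sequence, by
   the parallelogram law; this replaces weak compactness. *)
Lemma cauchy_minimal_norm (Q : Type) (K : nat -> set Q) (nrm : Q -> R)
    (mid : Q -> Q -> Q) (dst : Q -> Q -> R) (B : R) :
  (forall p, 0 <= nrm p) -> (forall n p, K n p -> nrm p <= B) ->
  (forall n, K n !=set0) -> (forall m n, (m <= n)%N -> K n `<=` K m) ->
  (forall n p q, K n p -> K n q -> K n (mid p q)) ->
  (forall n p q, K n p -> K n q -> dst p q + nrm (mid p q) = 2^-1 * (nrm p + nrm q)) ->
  exists q : nat -> Q, (forall n, K n (q n)) /\
    forall e, 0 < e -> exists n0, forall m n, (n0 <= m)%N -> (n0 <= n)%N -> dst (q m) (q n) <= e.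
Proof.
move=> nrm0 nrmB K0 Kmon Kmid par; pose A n := [set nrm p | p in K n]; pose d n := inf (A n).
have infA n : has_inf (A n).
  by split; [have [p Kp] := K0 n; exists (nrm p), p|exists 0 => _ [p _ <-]].
have d_le n p : K n p -> d n <= nrm p by move=> Kp; apply: ge_inf; [exact: (infA n).2|exists p].
have dB n : d n <= B by have [p Kp] := K0 n; exact: le_trans (d_le n p Kp) (nrmB n p Kp).
have dmon m n : (m <= n)%N -> d m <= d n.
  move=> mn; apply: lb_le_inf; first exact: (infA n).1.
  by move=> _ [p Kp <-]; apply: d_le; exact: (Kmon m n).
have hq n : {p | K n p /\ nrm p <= d n + n.+1%:R^-1}.
  apply: cid; have n0 : 0 < (n.+1%:R^-1 : R) by rewrite invr_gt0 ltr0n.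
  by have [_ [p Kp <-] h] := inf_adherent n0 (infA n); exists p; split => //; exact: ltW.
pose q n := sval (hq n); have Kq n : K n (q n) := (svalP (hq n)).1.
have nq n : nrm (q n) <= d n + n.+1%:R^-1 := (svalP (hq n)).2.
exists q; split => // e e0.
(* The infima [d n] increase because the sets shrink, and they are bounded by [B]; from some index
   on they stay within [e / 2] of their supremum. *)
pose D := sup (range d); have supD : has_sup (range d).
  by split; [exists (d 0%N), 0%N|exists B => _ [n _ <-]; exact: dB].
have dD n : d n <= D by apply: ub_le_sup; [exact: supD.2|exists n].
have e20 : 0 < e / 2 by rewrite divr_gt0.
have [_ [n1 _ <-] hn1] := sup_adherent e20 supD.
have [n2 hn2] : exists n2 : nat, n2.+1%:R^-1 <= e / 2.
  have /cvgr0Pnorm_le/(_ _ e20)[n2 _ h] := @cvg_harmonic R.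
  by exists n2; exact: le_trans (ler_norm _) (h n2 (leqnn n2)).
exists (maxn n1 n2).
(* The midpoint lies in [K m], so its [nrm] is at least [d m]; the parallelogram identity then
   bounds the distance by half the sum of [d n - d m] and the two tolerances. *)
have key m n : (maxn n1 n2 <= m)%N -> (m <= n)%N ->
    forall a b, K m a -> K m b -> nrm a + nrm b <= d m + d n + m.+1%:R^-1 + n.+1%:R^-1 ->
    dst a b <= e.
  rewrite geq_max => /andP[n1m n2m] mn a b Ka Kb hab.
  have h1 := par m _ _ Ka Kb; have h2 := d_le m _ (Kmid m _ _ Ka Kb).
  have h3 : m.+1%:R^-1 <= e / 2.
    by apply: le_trans hn2; rewrite lef_pV2 ?posrE ?ltr0n// ler_nat.
  have h4 : n.+1%:R^-1 <= e / 2.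
    apply: le_trans hn2; rewrite lef_pV2 ?posrE ?ltr0n// ler_nat ltnS.
    exact: leq_trans mn.
  have h5 := dmon n1 m n1m; have h6 := dD n; rewrite -/D in hn1.
  move: h1 h2 h3 h4 h5 h6 hn1 hab {par hn2}.
  by move: m.+1%:R^-1 n.+1%:R^-1 => x y; lra.
move=> m n hm hn; have hqm := nq m; have hqn := nq n.
have [mn|/ltnW nm] := leqP m n.
  apply: (key m n hm mn) => //; first exact: (Kmon m n).
  by move: hqm hqn; move: m.+1%:R^-1 n.+1%:R^-1 => x y hqm hqn; lra.
apply: (key n m hn nm) => //; first exact: (Kmon n m).
by move: hqm hqn; move: m.+1%:R^-1 n.+1%:R^-1 => x y hqm hqn; lra.
Qed.

End MinimizingSequence.

Lemma half_sum_le (R : realFieldType) (x1 x2 x3 y1 y2 y3 : R) :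
  x1 <= 2^-1 * (x2 + x3) -> y1 <= 2^-1 * (y2 + y3) ->
  2^-1 * x1 + 2^-1 * y1 <= 2^-1 * ((2^-1 * x2 + 2^-1 * y2) + (2^-1 * x3 + 2^-1 * y3)).
Proof. by move=> h1 h2; lra. Qed.

Lemma sum_half_eq (R : realFieldType) (a b c d x1 x2 y1 y2 : R) :
  a + c = 2^-1 * (x1 + y1) -> b + d = 2^-1 * (x2 + y2) ->
  a + b + (c + d) = 2^-1 * ((x1 + x2) + (y1 + y2)).
Proof. by move=> h1 h2; lra. Qed.

Section QuasiSolution.
Context {R : realType}.
Local Notation leb := (@lebesgue_measure R).
Variables (ell T CQ : R) (w_ell theta_ell : R -> R).
Hypotheses (ell0 : 0 < ell) (T0 : 0 < T) (CQ0 : 0 < CQ).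
Hypotheses (wL2 : L2 0 T w_ell) (thL2 : L2 0 T theta_ell).
Local Notation X := (L2 0 ell).
Local Notation N := (L2norm 0 ell).
Local Notation nV := (H2norm 0 ell).
Local Notation D2 := (wD 0 ell 2).
Local Notation nT := (H2norm 0 T).
Implicit Types (f g M : R -> R) (u : R -> R -> R) (q p : (R -> R) * (R -> R)).
Let XN : seminormed X N := L2_seminormed (ltW ell0).
Let VN : seminormed (V2 ell) nV := V2_seminormed ell0.
Let TN : seminormed (H2 0 T) nT := H2_seminormed 0 T.
Let TL : seminormed (L2 0 T) (L2norm 0 T) := L2_seminormed (ltW T0).
Variables (rho mu r : R -> R) (Brho Bmu Br rho0 r0 : R).
Hypotheses (rhoB : coefficient ell Brho rho) (muB : coefficient ell Bmu mu)
  (rB : coefficient ell Br r) (rho0_gt0 : 0 < rho0) (r0_gt0 : 0 < r0).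
Hypothesis rho_ge : ae (fun x => x \in `]0, ell[ -> rho0 <= rho x).
Hypothesis r_ge : ae (fun x => x \in `]0, ell[ -> r0 <= r x).
Hypothesis mu_ge : ae (fun x => x \in `]0, ell[ -> 0 <= mu x).
Local Notation wsol := (weak_solution ell T rho mu r).
Local Notation bochnerV := (bochner_L2 T (V2 ell) nV).

(** In this form the trace is a bounded functional of u_xx, the quantity controlled by the stability
    estimate; [V2_crep] identifies it with the end value of [crep]. *)
Definition deflection u t : R := prim2 0 (D2 (u t)) ell.
Definition slope u t : R := prim 0 (D2 (u t)) ell.
Definition rmisfit u : R := 2^-1 * L2norm 0 T (deflection u - w_ell) ^+ 2
  + 2^-1 * L2norm 0 T (slope u - theta_ell) ^+ 2.

Lemma traces_L2 u : bochnerV u -> L2 0 T (deflection u) /\ L2 0 T (slope u).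
Proof.
move=> Bu; have [_ BZ] := bochner_V2 ell0 Bu; split.
  exact: (blf_L2 ell0 (blf_prim2_trace ell0) BZ).
exact: (blf_L2 ell0 (blf_prim_trace ell0) BZ).
Qed.

Lemma int_sqr_EFin f (h : R -> R) : L2 0 T f -> {in `]0, T[, h =1 f} ->
  (\int[leb]_(t in `]0%R, T[) ((h t) ^+ 2)%:E)%E = (L2norm 0 T f ^+ 2)%:E.
Proof.
move=> Lf hf; rewrite L2norm_sqr /ip /Rintegral fineK.
  apply: eq_integral => t; rewrite inE/= => tT.
  by rewrite hf// expr2.
by apply: integrable_fin_num => //; exact: (L2_mul Lf Lf).
Qed.

Lemma misfitE u : bochnerV u -> misfit ell T w_ell theta_ell u = (rmisfit u)%:E.
Proof.
move=> Bu; have [Ly Lth] := traces_L2 Bu; have [Vu _ _] := Bu.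
have le : ell \in `[0, ell] by rewrite in_itv/= lexx ltW.
rewrite /misfit (int_sqr_EFin (L2B Ly wL2)); last first.
  by move=> t tT; have [-> _] := V2_crep ell0 (Vu t tT) le.
rewrite (int_sqr_EFin (L2B Lth thL2)); last first.
  by move=> t tT; have [_ ->] := V2_crep ell0 (Vu t tT) le.
by rewrite -!EFinM -EFinD.
Qed.

Lemma wsol_bochner M g u : wsol M g u -> bochnerV u.
Proof. by move=> [ut [utt [[]]]]. Qed.

Lemma traces_lin2 c d u u' t : V2 ell (u t) -> V2 ell (u' t) ->
  deflection (fun s => lin2 c d (u s) (u' s)) t = c * deflection u t + d * deflection u' t /\
  slope (fun s => lin2 c d (u s) (u' s)) t = c * slope u t + d * slope u' t.
Proof.
move=> Va Vb; have [Vl e] := V2_lin2 ell0 c d Va Vb; have [_ Xl] := V2_L2 Vl.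
have [_ Xa] := V2_L2 Va; have [_ Xb] := V2_L2 Vb; have Xc := L2_lin2 c d Xa Xb.
have b1 := blf_prim2_trace ell0; have b2 := blf_prim_trace ell0.
rewrite /deflection /slope; split.
  by have -> := blf_ae ell0 b1 Xl Xc e; exact: (blf_lin b1).
by have -> := blf_ae ell0 b2 Xl Xc e; exact: (blf_lin b2).
Qed.

Lemma wsol_mid M g u M' g' u' : H2 0 T M -> H2 0 T g -> H2 0 T M' -> H2 0 T g' ->
  wsol M g u -> wsol M' g' u' ->
  wsol (lin2 2^-1 2^-1 M M') (lin2 2^-1 2^-1 g g') (fun t => lin2 2^-1 2^-1 (u t) (u' t)).
Proof.
move=> /H2_L2 LM /H2_L2 Lg /H2_L2 LM' /H2_L2 Lg' su su'.
have [ut ev] := weak_solution_evolution ell0 muB rB su.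
have [ut' ev'] := weak_solution_evolution ell0 muB rB su'.
have evm := evolution_lin2 ell0 T0 rhoB muB rB 2^-1 2^-1 LM Lg LM' Lg' ev ev'.
by apply: (evolution_weak_solution ell0 rhoB muB rB _ _ evm); exact: L2_lin2.
Qed.

(** The parallelogram identity with the half difference dropped. *)
Lemma L2norm_mid_sqr f g h : L2 0 T f -> L2 0 T g -> L2 0 T h ->
  L2norm 0 T (lin2 2^-1 2^-1 f g - h) ^+ 2 <=
  2^-1 * (L2norm 0 T (f - h) ^+ 2 + L2norm 0 T (g - h) ^+ 2).
Proof.
move=> Lf Lg Lh; rewrite -(parallelogram_L2 (L2B Lf Lh) (L2B Lg Lh)).
rewrite (_ : lin2 2^-1 2^-1 f g - h = lin2 2^-1 2^-1 (f - h) (g - h)).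
  by rewrite lerDr sqr_ge0.
by apply/funext => x; rewrite /lin2 !fctE; field.
Qed.

Lemma rmisfit_mid u u' : bochnerV u -> bochnerV u' ->
  bochnerV (fun t => lin2 2^-1 2^-1 (u t) (u' t)) ->
  rmisfit (fun t => lin2 2^-1 2^-1 (u t) (u' t)) <= 2^-1 * (rmisfit u + rmisfit u').
Proof.
move=> Bu Bu' Bm; have [Vu _ _] := Bu; have [Vu' _ _] := Bu'.
have [Ly Lth] := traces_L2 Bu; have [Ly' Lth'] := traces_L2 Bu'; have [Lym Lthm] := traces_L2 Bm.
have h1 := L2norm_mid_sqr Ly Ly' wL2; have h2 := L2norm_mid_sqr Lth Lth' thL2.
rewrite /rmisfit.
have e1 : L2norm 0 T (deflection (fun t => lin2 2^-1 2^-1 (u t) (u' t)) - w_ell) =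
    L2norm 0 T (lin2 2^-1 2^-1 (deflection u) (deflection u') - w_ell).
  apply: L2norm_ae; [exact: L2B|by apply: L2B => //; exact: L2_lin2|].
  apply: aeW => t tT; rewrite !fctE; congr (_ - _).
  exact: (traces_lin2 _ _ (Vu t tT) (Vu' t tT)).1.
have e2 : L2norm 0 T (slope (fun t => lin2 2^-1 2^-1 (u t) (u' t)) - theta_ell) =
    L2norm 0 T (lin2 2^-1 2^-1 (slope u) (slope u') - theta_ell).
  apply: L2norm_ae; [exact: L2B|by apply: L2B => //; exact: L2_lin2|].
  apply: aeW => t tT; rewrite !fctE; congr (_ - _).
  exact: (traces_lin2 _ _ (Vu t tT) (Vu' t tT)).2.
have {e1}h1 := eq_ind_r (fun x => x ^+ 2 <= _) h1 e1.
have {e2}h2 := eq_ind_r (fun x => x ^+ 2 <= _) h2 e2.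
exact: half_sum_le h1 h2.
Qed.

(** [solution] is a choice by [xget]; uniqueness of u_xx almost everywhere makes the value of [J]
    computable from any weak solution at hand. *)
Lemma rmisfit_unique M g u u' : H2 0 T M -> H2 0 T g -> wsol M g u -> wsol M g u' ->
  rmisfit u = rmisfit u'.
Proof.
move=> HM Hg su su'.
have [ut ev] := weak_solution_evolution ell0 muB rB su.
have [ut' ev'] := weak_solution_evolution ell0 muB rB su'.
have [h _] := evolution_stability ell0 T0 rhoB muB rB rho0_gt0 r0_gt0 rho_ge r_ge mu_ge HM Hg HM
  Hg ev ev'.
rewrite !subrr (seminorm0 TN) addr0 mulr0 in h.
have Bu := wsol_bochner su; have Bu' := wsol_bochner su'.
have [Ly Lth] := traces_L2 Bu; have [Ly' Lth'] := traces_L2 Bu'.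
have [XZ _ _] := (bochner_V2 ell0 Bu).2; have [XZ' _ _] := (bochner_V2 ell0 Bu').2.
have key L C : bounded_functional ell L C ->
    ae (fun t => t \in `]0, T[ -> L (D2 (u t)) = L (D2 (u' t))).
  move=> bL; apply: aeS h => t ht tT; have Xa := XZ t tT; have Xb := XZ' t tT.
  apply/eqP; rewrite -subr_eq0 -(blfB bL)// -normr_le0.
  apply: le_trans (blf_le bL (seminormedB XN Xa Xb)) _.
  have -> : N (D2 (u t) - D2 (u' t)) = 0 by apply/eqP; rewrite eq_le ht// L2norm_ge0.
  by rewrite mulr0.
have e1 : L2norm 0 T (deflection u - w_ell) = L2norm 0 T (deflection u' - w_ell).
  apply: (L2norm_ae (L2B Ly wL2) (L2B Ly' wL2)).
  by apply: aeS (key _ _ (blf_prim2_trace ell0)) => t e tT; exact: (f_equal (fun x => x - w_ell t)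
    (e tT)).
have e2 : L2norm 0 T (slope u - theta_ell) = L2norm 0 T (slope u' - theta_ell).
  apply: (L2norm_ae (L2B Lth thL2) (L2B Lth' thL2)).
  by apply: aeS (key _ _ (blf_prim_trace ell0)) => t e tT; exact: (f_equal (fun x => x - theta_ell
    t) (e tT)).
exact: (f_equal2 (fun x y => 2^-1 * x ^+ 2 + 2^-1 * y ^+ 2) e1 e2).
Qed.

Local Notation Jf := (J ell T rho mu r w_ell theta_ell).
Local Notation adm := (admissible T CQ).

Lemma J_some q u : H2 0 T q.1 -> H2 0 T q.2 -> wsol q.1 q.2 u -> Jf q = (rmisfit u)%:E.
Proof.
move=> H1 Hq2 su; have ss : wsol q.1 q.2 (solution ell T rho mu r q).
  exact: (@xgetPex _ _ [set u | wsol q.1 q.2 u] (ex_intro _ u su)).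
rewrite /J asboolT// misfitE; last exact: wsol_bochner ss.
by rewrite (rmisfit_unique H1 Hq2 ss su).
Qed.

Lemma J_none q : ~ (exists u, wsol q.1 q.2 u) -> Jf q = +oo%E.
Proof. by move=> h; rewrite /J asboolF// => hs; apply: h; eexists; exact: hs. Qed.

Lemma quasi_solution_of_le q : adm q -> (forall p, adm p -> (Jf q <= Jf p)%E) ->
  quasi_solution ell T rho mu r CQ w_ell theta_ell q.
Proof.
move=> Aq hq; split => //; apply/eqP; rewrite eq_le; apply/andP; split.
  by apply: le_ereal_inf_tmp => _ [p Ap <-]; exact: hq.
by apply: ereal_inf_lbound; exists q.
Qed.

Lemma adm_mid p q : adm p -> adm q ->
  adm (lin2 2^-1 2^-1 p.1 q.1, lin2 2^-1 2^-1 p.2 q.2).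
Proof.
move=> [H1 Hp2 n1 n2] [H3 H4 n3 n4].
have h f g : H2 0 T f -> H2 0 T g -> nT f <= CQ -> nT g <= CQ -> nT (lin2 2^-1 2^-1 f g) <= CQ.
  move=> Hf Hg nf ng; apply: le_trans (H2norm_lin2 2^-1 2^-1 Hf Hg) _.
  by rewrite ger0_norm ?invr_ge0//; move: nf ng; move: (nT f) (nT g) => x y; lra.
have HL f g : H2 0 T f -> H2 0 T g -> H2 0 T (lin2 2^-1 2^-1 f g).
  by move=> Hf Hg; have [] := H2_lin2 2^-1 2^-1 Hf Hg.
by split; [exact: HL|exact: HL|exact: h|exact: h].
Qed.

Lemma H2norm_half_diff f g e : H2 0 T f -> H2 0 T g -> 0 <= e ->
  nT (lin2 2^-1 (- 2^-1) f g) ^+ 2 <= (e / 2) ^+ 2 -> nT (f - g) <= e.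
Proof.
move=> Hf Hg e0; have [Hl _ _] := H2_lin2 2^-1 (- 2^-1) Hf Hg.
rewrite ler_pXn2r ?nnegrE ?H2norm_ge0 ?divr_ge0// => h.
have -> : f - g = lin2 2 0 (lin2 2^-1 (- 2^-1) f g) (lin2 2^-1 (- 2^-1) f g).
  by apply/funext => x; rewrite /lin2 !fctE; field.
apply: le_trans (H2norm_lin2 2 0 Hl Hl) _.
by rewrite normr0 mul0r addr0 ger0_norm// mulrC -ler_pdivlMr.
Qed.

Lemma rmisfit_cvg (un : nat -> R -> R -> R) u (a : nat -> R) :
  (forall n, bochnerV (un n)) -> bochnerV u -> a @ \oo --> (0 : R) ->
  (forall n, ae (fun t => t \in `]0, T[ -> nV (un n t - u t) <= a n)) ->
  rmisfit (un n) @[n --> \oo] --> rmisfit u.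
Proof.
move=> Bun Bu ca h; have BZn n := (bochner_V2 ell0 (Bun n)).2; have BZ := (bochner_V2 ell0 Bu).2.
have hZ n : ae (fun t => t \in `]0, T[ -> N (D2 (un n t) - D2 (u t)) <= a n).
  apply: aeS (h n) => t ht tT; apply: le_trans (ht tT).
  by apply: V2_norm_D2; [have [Vu _ _] := Bun n; exact: Vu|have [Vu _ _] := Bu; exact: Vu].
have [Ly Lth] := traces_L2 Bu.
have c1 := blf_L2norm_cvg ell0 T0 (blf_prim2_trace ell0) (mulr_ge0 (sqrtr_ge0 _) (ltW ell0)) BZn
  BZ ca hZ.
have c2 := blf_L2norm_cvg ell0 T0 (blf_prim_trace ell0) (sqrtr_ge0 _) BZn BZ ca hZ.
have {}c1 := seminorm_cvg_shift TL (fun n => (traces_L2 (Bun n)).1) Ly wL2 c1.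
have {}c2 := seminorm_cvg_shift TL (fun n => (traces_L2 (Bun n)).2) Lth thL2 c2.
by apply: cvgD; apply: cvgM; [exact: cvg_cst|exact: cvgM|exact: cvg_cst|exact: cvgM].
Qed.

Lemma quasi_solution_ex : exists q, quasi_solution ell T rho mu r CQ w_ell theta_ell q.
Proof.
(* Only inputs that have a solution enter [S]; for the others [J] is +oo by [J_none]. *)
pose S := [set x : R | exists q u, [/\ adm q, wsol q.1 q.2 u & x = rmisfit u]].
have [S0|Snone] := pselect (S !=set0); last first.
  have none p : adm p -> Jf p = +oo%E.
    by move=> Ap; apply: J_none => -[u su]; apply: Snone; exists (rmisfit u), p, u.
  have A0 : adm (0, 0).
    by split; rewrite /= ?(seminorm0 TN) ?(ltW CQ0)//; exact: H2_0.
  exists (0, 0); apply: (quasi_solution_of_le A0) => p Ap.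
  exact: (eq_ind_r (fun x => (_ <= x)%E) (leey _) (none p Ap)).
have rm0 u : 0 <= rmisfit u by rewrite addr_ge0// mulr_ge0// sqr_ge0.
have infS : has_inf S by split => //; exists 0 => _ [q [u [_ _ ->]]].
pose m := inf S.
have m_le q u : adm q -> wsol q.1 q.2 u -> m <= rmisfit u.
  by move=> Aq su; apply: ge_inf; [exact: infS.2|exists q, u].
pose K n := [set q | adm q /\ exists2 u, wsol q.1 q.2 u & rmisfit u <= m + n.+1%:R^-1].
pose nrm q := nT q.1 ^+ 2 + nT q.2 ^+ 2.
pose mid p q := (lin2 2^-1 2^-1 p.1 q.1 : R -> R, lin2 2^-1 2^-1 p.2 q.2 : R -> R).
(* The squared norm of half the difference: with this choice the parallelogram law for pairs is the
   last hypothesis of [cauchy_minimal_norm]. *)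
pose dst p q := nT (lin2 2^-1 (- 2^-1) p.1 q.1) ^+ 2 + nT (lin2 2^-1 (- 2^-1) p.2 q.2) ^+ 2.
have [||||||qn [Kq cq]] := @cauchy_minimal_norm R _ K nrm mid dst (CQ ^+ 2 + CQ ^+ 2).
- by move=> q; rewrite addr_ge0 ?sqr_ge0.
- move=> n q [[_ _ n1 n2] _]; rewrite lerD// lerXn2r ?nnegrE ?H2norm_ge0 ?(ltW CQ0)//.
- move=> n; have n0 : 0 < (n.+1%:R^-1 : R) by rewrite invr_gt0 ltr0n.
  have [_ [q [u [Aq su ->]]] h] := inf_adherent n0 infS.
  by exists q; split => //; exists u => //; exact: ltW.
- move=> i n le_in q [Aq [u su hu]]; split => //; exists u => //; apply: le_trans hu _.
  by rewrite lerD2l lef_pV2 ?posrE ?ltr0n// ler_nat.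
- move=> n p q [Ap [u su hu]] [Aq [u' su' hu']]; split; first exact: adm_mid.
  have [H1 H3 _ _] := Ap; have [H4 H5 _ _] := Aq.
  have sm := wsol_mid H1 H3 H4 H5 su su'.
  exists (fun t => lin2 2^-1 2^-1 (u t) (u' t)); first exact: sm.
  apply: le_trans (rmisfit_mid (wsol_bochner su) (wsol_bochner su') (wsol_bochner sm)) _.
  by move: hu hu'; move: (rmisfit u) (rmisfit u') (n.+1%:R^-1) => x y z; lra.
- move=> n p q [[H1 H3 _ _] _] [[H4 H5 _ _] _].
  exact: sum_half_eq (parallelogram_H2 H1 H4) (parallelogram_H2 H3 H5).
have HMn n : H2 0 T (qn n).1 by have [[]] := Kq n.
have Hgn n : H2 0 T (qn n).2 by have [[]] := Kq n.
have dst_le e : 0 < e -> exists n0, forall i n, (n0 <= i)%N -> (n0 <= n)%N ->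
    dst (qn i) (qn n) <= (e / 2) ^+ 2.
  by move=> e0; apply: cq; rewrite exprn_gt0// divr_gt0.
have [|M HM cM] := H2_complete T0 HMn.
  move=> e e0; have [n0 h] := dst_le e e0; exists n0 => i n hi hn.
  apply: (H2norm_half_diff (HMn i) (HMn n) (ltW e0)); apply: le_trans (h i n hi hn).
  by rewrite lerDl sqr_ge0.
have [|g Hg cg] := H2_complete T0 Hgn.
  move=> e e0; have [n0 h] := dst_le e e0; exists n0 => i n hi hn.
  apply: (H2norm_half_diff (Hgn i) (Hgn n) (ltW e0)); apply: le_trans (h i n hi hn).
  by rewrite lerDr sqr_ge0.
have hu n : {u | wsol (qn n).1 (qn n).2 u /\ rmisfit u <= m + n.+1%:R^-1}.
  by apply: cid; have [_ [u su h]] := Kq n; exists u.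
pose un n := sval (hu n); have sun n : wsol (qn n).1 (qn n).2 (un n) := (svalP (hu n)).1.
have hev n : {ut | evolution ell T rho mu r (qn n).1 (qn n).2 (un n) ut}.
  by apply: cid; exact: (weak_solution_evolution ell0 muB rB (sun n)).
have [u [ut [a [ev ca ha]]]] := evolution_limit ell0 T0 rhoB muB rB rho0_gt0 r0_gt0
  rho_ge r_ge mu_ge HMn Hgn HM Hg cM cg (fun n => svalP (hev n)).
have su : wsol M g u := evolution_weak_solution ell0 rhoB muB rB (H2_L2 HM) (H2_L2 Hg) ev.
have Bun n := wsol_bochner (sun n).
have cm := rmisfit_cvg Bun (wsol_bochner su) ca ha.
have ru : rmisfit u <= m.
  have c1 : m + n.+1%:R^-1 @[n --> \oo] --> m.
    by rewrite -[X in _ --> X]addr0; apply: cvgD; [exact: cvg_cst|exact: cvg_harmonic].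
  apply: (@ler_cvg_to _ _ _ _ _ _ _ _ cm c1); apply: nearW => n.
  exact: (svalP (hu n)).2.
have nle (Fn : nat -> R -> R) F : (forall n, H2 0 T (Fn n)) -> H2 0 T F ->
    nT (Fn n - F) @[n --> \oo] --> (0 : R) -> (forall n, nT (Fn n) <= CQ) -> nT F <= CQ.
  move=> HFn HF cF hF; have c1 := seminorm_cvg_shift TN HFn HF (H2_0 0 T) cF.
  rewrite subr0 in c1.
  apply: (@ler_cvg_to _ _ _ _ _ _ _ _ c1 (cvg_cst CQ)); apply: nearW => n.
  by rewrite subr0; exact: hF.
have Aq : adm (M, g).
  split => //=; first by apply: (nle _ _ HMn HM cM) => n; have [[]] := Kq n.
  by apply: (nle _ _ Hgn Hg cg) => n; have [[]] := Kq n.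
exists (M, g); apply: (quasi_solution_of_le Aq) => p Ap.
rewrite (J_some (q := (M, g)) HM Hg su); have [[v sv]|none] := pselect (exists v, wsol p.1 p.2 v).
  have [Hp1 Hp2 _ _] := Ap; rewrite (J_some Hp1 Hp2 sv) lee_fin.
  exact: le_trans ru (m_le p v Ap sv).
by rewrite J_none// leey.
Qed.

End QuasiSolution.

Theorem theorem3 (R : realType) (ell T CQ rho0 rho1 r0 r1 : R)
    (rho mu r w_ell theta_ell : R -> R)
    (ell_gt0 : 0 < ell) (T_gt0 : 0 < T) (CQ_gt0 : 0 < CQ)
    (rhoL : Linfty 0 ell rho) (muL : Linfty 0 ell mu) (rL : Linfty 0 ell r)
    (rho0_gt0 : 0 < rho0) (r0_gt0 : 0 < r0)
    (rho_bnd : {ae @lebesgue_measure R, forall x,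
                  x \in `]0, ell[ -> rho0 <= rho x <= rho1})
    (r_bnd : {ae @lebesgue_measure R, forall x,
                x \in `]0, ell[ -> r0 <= r x <= r1})
    (mu_ge0 : {ae @lebesgue_measure R, forall x,
                x \in `]0, ell[ -> 0 <= mu x})
    (wL2 : L2 0 T w_ell) (thetaL2 : L2 0 T theta_ell) :
  exists q : (R -> R) * (R -> R),
    quasi_solution ell T rho mu r CQ w_ell theta_ell q.
Proof.
have [Brho rhoB] := coefficient_of_Linfty rhoL.
have [Bmu muB] := coefficient_of_Linfty muL.
have [Br rB] := coefficient_of_Linfty rL.
have rho_ge : ae (fun x => x \in `]0, ell[ -> rho0 <= rho x).
  by apply: aeS rho_bnd => x h /h /andP[].
have r_ge : ae (fun x => x \in `]0, ell[ -> r0 <= r x).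
  by apply: aeS r_bnd => x h /h /andP[].
exact: (quasi_solution_ex ell_gt0 T_gt0 CQ_gt0 wL2 thetaL2 rhoB muB rB
  rho0_gt0 r0_gt0 rho_ge r_ge mu_ge0).
Qed.
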